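(* Let $S\in\mathrm{Sing}^{\mathrm{tr}}(\Delta,\overline x)$ have circuit $C_S=\{(1,0,0),(2,1,0),(0,2,0),(1,1,0)\}$ (a circuit of type C). Let $\Lambda':\Delta\to\mathbb R$ be the unique affine linear function, depending only on the coordinates $x$ and $y$, which coincides with $\nu_S$ along $\mathrm{Conv}(C_S)$. Set $\nu'=\nu_S-\Lambda'$. Let $\mathrm{pr}_z(\Delta)$ be the projection of $\Delta$ to the $z$-axis, and set $$-c'_{m}=\min\{\nu'(\omega): \omega\in\Delta\cap\mathbb Z^3,\ \mathrm{pr}_z(\omega)=m\},\quad m\in\mathrm{pr}_z(\Delta)\cap\mathbb Z\setminus\{0\},\qquad -c'_0\gg\max\{-c'_{m}: m\ne0\}.$$ Let $\nu_z:\mathrm{pr}_z(\Delta)\to\mathbb R$ be the convex piecewise linear function whose graph is the lower convex hull of $\mathrm{Conv}\{(m,-c'_{m}): m\in\mathrm{pr}_z(\Delta)\cap\mathbb Z\}$. Then the possible singular points $y\in S$ are in one-to-one correspondence with the linear functions $\Lambda'':\mathrm{pr}_z(\Delta)\to\mathbb R$ that vanish at the origin, are strictly less than $\nu_z$, and whose graph is parallel to an edge of $\mathrm{Graph}(\nu_z)$ which projects to one of the segments $$[-3,-1],\quad[-3,1],\quad[-3,3],\quad[-1,1],\quad[-1,3],\quad[1,3].$$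
   Context: General setting. $\mathbb K=\bigcup_{m\ge1}\mathbb C\{t^{1/m}\}$ is the field of locally convergent Puiseux series with $\mathrm{Val}(\sum_r a_rt^r)=-\min\{r:a_r\ne0\}$. $\Delta\subset\mathbb R^3$ is a convex lattice polytope such that the differences of points of $\Delta\cap\mathbb Z^3$ generate $\mathbb Z^3$; $N=|\Delta\cap\mathbb Z^3|-2>0$. $\mathrm{Sing}(\Delta)$ is the family of surfaces defined by Laurent polynomials over $\mathbb K$ with support in $\Delta$ having a singular point in $(\mathbb K^* )^3$; $\Delta$ is assumed non-defective, i.e. $\mathrm{Sing}(\Delta)$ is a hypersurface. A tropical surface $S$ with Newton polytope $\Delta$ is the corner locus of $F_S(X)=\max_{\omega\in\Delta\cap\mathbb Z^3}(c_\omega+\langle\omega,X\rangle)$; $\nu_S:\Delta\to\mathbb R$ is the Legendre dual convex piecewise linear function (its graph is the lower part of the convex hull of the points $(\omega,-c_\omega)$) and $\Sigma_S$ is the dual subdivision of $\Delta$ into linearity domains of $\nu_S$. $\mathrm{Sing}^{\mathrm{tr}}(\Delta)$ is the set of tropicalizations of surfaces in $\mathrm{Sing}(\Delta)$. Point configuration. $v\in\mathbb Q^3$ is not parallel or orthogonal to any proper affine subspace of $\mathbb R^3$ spanned by a subset of $\Delta\cap\mathbb Z^3$; $\overline x=(x_1,\dots,x_N)$ with $x_i=M_iv$, where $0\ll M_1\ll\dots\ll M_N$ are generic rationals ($M_1$ and the ratios $M_{i+1}/M_i$ exceed a sufficiently large constant depending only on $\Delta$ and $v$). $\mathrm{Sing}^{\mathrm{tr}}(\Delta,\overline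 x)=\{S\in\mathrm{Sing}^{\mathrm{tr}}(\Delta): S\supset\overline x\}$; all its elements are of maximal-dimensional geometric type (deformation space of dimension $N$), and for each of them $\Sigma_S$ has a unique circuit $C_S$ (affinely dependent set of lattice points all of whose proper subsets are affinely independent). $C_S$ is of type C if it consists of the vertices and the unique interior lattice point of a triangle $\mathrm{Conv}(C_S)$ having no further lattice points; by an affine automorphism of $\mathbb Z^3$ every such circuit can be brought to the form in the claim. A point $y\in S$ is a possible singular point if it is the tropicalization (coordinatewise $\mathrm{Val}$) of a singular point in $(\mathbb K^* )^3$ of some surface in $\mathrm{Sing}(\Delta)$ tropicalizing to $S$. Translations of $S$ correspond to adding affine linear functions to $\nu_S$; the correspondence in the claim attaches to $\Lambda''$ (viewed as a function of $z$ on $\mathbb R^3$) the point $y$ such that the translation moving $y$ to the origin replaces $\nu_S$ by $\nu_S-\Lambda'-\Lambda''$ up to a constant, i.e. $y$ is the gradient of $\Lambda'+\Lambda''$. *)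

(* Defs.v *)
From HB Require Import structures.
From mathcomp Require Import all_boot all_order all_algebra.
From mathcomp Require Import finmap complex.
From mathcomp Require mpoly.
From mathcomp Require Import all_classical all_reals all_analysis.
From mathcomp Require Import ring lra zify.
Set Implicit Arguments. Unset Strict Implicit. Unset Printing Implicit Defensive.
Import Order.TTheory GRing.Theory Num.Theory.
Import numFieldNormedType.Exports.
Local Open Scope classical_set_scope.
Local Open Scope ring_scope.

(* f r is the coefficient of t^r.  The exponents lie in n/m + N/m, and the power
   series in t^(1/m) that remains after factoring out t^(n/m) converges
   absolutely at some rho > 0, i.e. near the origin. *)
Definition pexp (m : nat) (n : int) (k : nat) : rat := (n + k%:Z)%:~R / m%:R.

Definition puiseux_series (R : realType) (f : rat -> R[i]) : Prop :=
  exists (m : nat) (n : int) (rho : R),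
    [/\ (0 < m)%N, 0 < rho,
        forall r, f r != 0 -> exists k, r = pexp m n k
      & cvgn (series (fun k => Normc.normc (f (pexp m n k)) * rho ^+ k))].

Definition puiseux_mul (R : realType) (f g : rat -> R[i]) : rat -> R[i] :=
  fun r => \sum_(s \in [set: rat]) f s * g (r - s).

Section PuiseuxField.
Variable R : realType.
Implicit Types f g h : rat -> R[i].
Local Notation C := R[i].
Local Notation nrm := (@Normc.normc R).

Lemma nrm_ge0 (x : C) : 0 <= nrm x.
Proof. by case: x => a b; apply: sqrtr_ge0. Qed.
Lemma nrm0 : nrm 0 = 0. Proof. exact: Normc.normc0. Qed.
Lemma nrmM (x y : C) : nrm (x * y) = nrm x * nrm y.
Proof. exact: Normc.normcM. Qed.
Lemma nrmD (x y : C) : nrm (x + y) <= nrm x + nrm y.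
Proof. exact: le_normcD. Qed.
Lemma nrmN (x : C) : nrm (- x) = nrm x.
Proof. exact: normcN. Qed.
Lemma nrm_sum (I : Type) (s : seq I) (P : pred I) (F : I -> C) :
  nrm (\sum_(i <- s | P i) F i) <= \sum_(i <- s | P i) nrm (F i).
Proof.
elim/big_rec2: _ => [|i y x _ H]; first by rewrite nrm0.
by rewrite (le_trans (nrmD _ _))// lerD2l.
Qed.

Definition psupp m n f := forall r, f r != 0 -> exists k, r = pexp m n k.
Definition pbnd m n f := exists rho M : R,
  0 < rho /\ forall k, nrm (f (pexp m n k)) * rho ^+ k <= M.
Definition prep m n f := [/\ (0 < m)%N, psupp m n f & pbnd m n f].

Lemma pexp_inj m n : (0 < m)%N -> injective (pexp m n).
Proof.
move=> m0 i j; rewrite /pexp => /mulIf H.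
have /H/intr_inj : (m%:R : rat)^-1 != 0 by rewrite invr_eq0 pnatr_eq0 -lt0n.
by move=> /addrI [].
Qed.

Lemma puiseuxP f : puiseux_series f <-> exists m n, prep m n f.
Proof.
split=> [[m [n [rho [m0 r0 sf cf]]]]|[m [n [m0 sf [rho [M [r0 bf]]]]]]].
  exists m, n; split=> //; exists rho.
  have /cvg_series_cvg_0/cvgP/cvg_seq_bounded/bounded_fun_has_ubound[M HM] := cf.
  by exists M; split=> // k; apply: HM; exists k.
exists m, n, (rho / 2); split=> //; first by lra.
have M0 : 0 <= M by apply: le_trans (bf 0%N); rewrite expr0 mulr1 nrm_ge0.
apply: (@series_le_cvg R _ (geometric M 2^-1)).
- by move=> k; rewrite mulr_ge0 ?nrm_ge0// exprn_ge0//; lra.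
- by move=> k; rewrite /geometric/= mulr_ge0// exprn_ge0//.
- by move=> k; rewrite /geometric/= exprMn mulrA ler_wpM2r// exprn_ge0.
- by apply: is_cvg_geometric_series; rewrite ger0_norm//; lra.
Qed.

Lemma prep_scale m n f d (e : nat) : (0 < d)%N -> prep m n f ->
  prep (m * d) (n * d%:Z - e%:Z) f.
Proof.
move=> d0 [m0 sf [rho [M [r0 bf]]]].
have E k : pexp m n k = pexp (m * d) (n * d%:Z - e%:Z) (k * d + e).
  rewrite /pexp; have m1 : (m%:R : rat) != 0 by rewrite pnatr_eq0 -lt0n.
  have d1 : (d%:R : rat) != 0 by rewrite pnatr_eq0 -lt0n.
  rewrite PoszD PoszM !natrM !(rmorphD, rmorphN, rmorphM)/= -!pmulrn.
  by field; rewrite m1 d1.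
have sf' : psupp (m * d) (n * d%:Z - e%:Z) f.
  by move=> r /sf[k ->]; exists (k * d + e)%N; rewrite E.
split=> //; first by rewrite muln_gt0 m0.
exists (Num.min rho 1), M.
have q0 : 0 < Num.min rho 1 by rewrite lt_min r0 ltr01.
split=> // k'.
have M0 : 0 <= M by apply: le_trans (bf 0%N); rewrite expr0 mulr1 nrm_ge0.
case: (eqVneq (f (pexp (m * d) (n * d%:Z - e%:Z) k')) 0) => [->|nz].
  by rewrite nrm0 mul0r.
have [k Ek] := sf _ nz.
have Ek' := Ek; rewrite E in Ek'; move/pexp_inj: Ek' => Ek'.
rewrite Ek; apply: le_trans (bf k); rewrite ler_wpM2l ?nrm_ge0//.
apply: (@le_trans _ _ (Num.min rho 1 ^+ k)).
  apply: ler_wiXn2l; [exact: ltW| by rewrite ge_min lexx orbT|].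
  by rewrite Ek' ?muln_gt0 ?m0 //; nia.
by rewrite lerXn2r ?nnegrE ?(ltW q0) ?(ltW r0)// ge_min lexx.
Qed.

Lemma prep_common m n m' n' f g : prep m n f -> prep m' n' g ->
  exists M N, prep M N f /\ prep M N g.
Proof.
move=> pf pg; have [m0 _ _] := pf; have [m0' _ _] := pg.
pose N : int := Num.min (n * m'%:Z) (n' * m%:Z).
exists (m * m')%N, N; split.
  have -> : N = n * m'%:Z - (absz (n * m'%:Z - N)%R)%:Z by rewrite /N; lia.
  exact: prep_scale.
have -> : N = n' * m%:Z - (absz (n' * m%:Z - N)%R)%:Z by rewrite /N; lia.
rewrite mulnC; exact: prep_scale.
Qed.

Lemma puiseux_mulE m n n' f g k : (0 < m)%N -> psupp m n f -> psupp m n' g ->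
  puiseux_mul f g (pexp m (n + n') k) =
  \sum_(i < k.+1) f (pexp m n i) * g (pexp m n' (k - i)%N).
Proof.
move=> m0 sf sg; rewrite /puiseux_mul.
have m1 : (m%:R : rat) != 0 by rewrite pnatr_eq0 -lt0n.
have E i : (i <= k)%N ->
   pexp m (n + n') k - pexp m n i = pexp m n' (k - i)%N.
  move=> ik; rewrite /pexp -subzn// !(rmorphD, rmorphN)/=; field; exact: m1.
rewrite (@fsbigE _ _ _ _ _ [seq pexp m n i | i <- index_iota 0 k.+1]) //.
- under eq_bigl do rewrite in_setT.
  rewrite big_map big_mkord; apply: eq_bigr => i _.
  by rewrite E// -ltnS.
- by rewrite map_inj_uniq ?iota_uniq//;  exact: pexp_inj.
- move=> r _ nr; apply/eqP; rewrite mulf_eq0; apply/orP.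
  case: (eqVneq (f r) 0) => [|/sf[i Ei]]; first by left.
  right; apply/negPn/negP => /sg[j Ej].
  case/negP: nr; apply/mapP; exists i => //; rewrite mem_index_iota ltnS.
  suff -> : k = (i + j)%N by rewrite leq_addr.
  apply: (@pexp_inj m (n + n')) => //.
  have -> : pexp m (n + n') k = r + (pexp m (n + n') k - r) by ring.
  by rewrite Ej Ei /pexp -mulrDl -rmorphD; congr (_%:~R / _); rewrite PoszD; ring.
Qed.

Lemma mul_supp m n n' f g : (0 < m)%N -> psupp m n f -> psupp m n' g ->
  psupp m (n + n') (puiseux_mul f g).
Proof.
move=> m0 sf sg r; apply: contraNP => H; apply/eqP; apply: fsbig1 => s _.
apply/eqP; rewrite mulf_eq0; apply/orP.
case: (eqVneq (f s) 0) => [|/sf[i Ei]]; first by left.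
right; apply/negPn/negP => /sg[j Ej]; apply: H; exists (i + j)%N.
have -> : r = s + (r - s) by ring.
by rewrite Ej Ei /pexp -mulrDl -rmorphD; congr (_%:~R / _); rewrite PoszD; ring.
Qed.

Lemma mul_prep m n n' f g : prep m n f -> prep m n' g ->
  prep m (n + n') (puiseux_mul f g).
Proof.
move=> [m0 sf [rho [M [r0 bf]]]] [_ sg [rho' [M' [r0' bg]]]].
split=> //; first exact: mul_supp.
have M0 : 0 <= M by apply: le_trans (bf 0%N); rewrite expr0 mulr1 nrm_ge0.
have M0' : 0 <= M' by apply: le_trans (bg 0%N); rewrite expr0 mulr1 nrm_ge0.
pose q := Num.min rho rho'.
have q0 : 0 < q by rewrite lt_min r0 r0'.
have qr : q <= rho by rewrite ge_min lexx.
have qr' : q <= rho' by rewrite ge_min lexx orbT.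
exists (q / 2), (M * M'); split; first by lra.
move=> k; rewrite (puiseux_mulE _ m0 sf sg) expr_div_n mulrA ler_pdivrMr ?exprn_gt0//.
apply: (@le_trans _ _ (M * M' *+ k.+1)); last first.
  rewrite -mulr_natr ler_wpM2l ?mulr_ge0// -natrX ler_nat; exact: ltn_expl.
apply: (@le_trans _ _ ((\sum_(i < k.+1)
    nrm (f (pexp m n i) * g (pexp m n' (k - i)%N))) * q ^+ k)).
  by rewrite ler_wpM2r ?exprn_ge0 ?nrm_sum// ltW.
rewrite mulr_suml -[leRHS](_ : \sum_(i < k.+1) M * M' = _); last first.
  by rewrite sumr_const card_ord.
apply: ler_sum => i _; have ik : (i <= k)%N by rewrite -ltnS.
rewrite nrmM -[in q ^+ k](subnKC ik) exprD mulrACA.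
apply: ler_pM; rewrite ?mulr_ge0 ?nrm_ge0 ?exprn_ge0 ?(ltW q0)//.
  apply: le_trans (bf i); rewrite ler_wpM2l ?nrm_ge0// lerXn2r ?nnegrE ?(ltW q0) ?(ltW r0) ?(ltW r0')//.
apply: le_trans (bg (k - i)%N); rewrite ler_wpM2l ?nrm_ge0// lerXn2r ?nnegrE ?(ltW q0) ?(ltW r0) ?(ltW r0')//.
Qed.

Lemma fun_subE f g r : (f - g) r = f r - g r.
Proof. by []. Qed.

Lemma add_prep m n f g : prep m n f -> prep m n g -> prep m n (f - g).
Proof.
move=> [m0 sf [rho [M [r0 bf]]]] [_ sg [rho' [M' [r0' bg]]]].
split=> //.
  move=> r; have [/eqP f0|/sf//] := boolP (f r == 0).
  have [/eqP g0|/sg//] := boolP (g r == 0).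
  by rewrite fun_subE f0 g0 subr0 eqxx.
pose q := Num.min rho rho'.
have q0 : 0 < q by rewrite lt_min r0 r0'.
have qr : q <= rho by rewrite ge_min lexx.
have qr' : q <= rho' by rewrite ge_min lexx orbT.
exists q, (M + M'); split=> // k.
apply: (@le_trans _ _ ((nrm (f (pexp m n k)) + nrm (g (pexp m n k))) * q ^+ k)).
  rewrite ler_wpM2r ?exprn_ge0 ?(ltW q0)// fun_subE.
  by apply: le_trans (nrmD _ _) _; rewrite nrmN.
rewrite mulrDl lerD//.
  by apply: le_trans (bf k); rewrite ler_wpM2l ?nrm_ge0// lerXn2r ?nnegrE ?(ltW q0) ?(ltW r0) ?(ltW r0').
by apply: le_trans (bg k); rewrite ler_wpM2l ?nrm_ge0// lerXn2r ?nnegrE ?(ltW q0) ?(ltW r0) ?(ltW r0').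
Qed.

Lemma zero_prep m n : (0 < m)%N -> prep m n (0 : rat -> C).
Proof.
move=> m0; split=> //; first by move=> r; rewrite (_ : (0 : rat -> C) r = 0)// eqxx.
by exists 1, 0; split=> // k; rewrite (_ : (0 : rat -> C) _ = 0)// nrm0 mul0r.
Qed.

Definition puiseux_one : rat -> C := fun r => (r == 0)%:R.

Lemma one_prep m : (0 < m)%N -> prep m 0 puiseux_one.
Proof.
move=> m0; split=> //.
  move=> r; rewrite /puiseux_one; case: (eqVneq r 0) => [-> _|_]; last by rewrite eqxx.
  by exists 0%N; rewrite /pexp mul0r.
exists 1, 1; split=> // k; rewrite expr1n mulr1 /puiseux_one.
by case: eqP => _; rewrite ?nrm0// Normc.normc1.
Qed.

Lemma prep_eq m n f g : psupp m n f -> psupp m n g ->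
  (forall k, f (pexp m n k) = g (pexp m n k)) -> f = g.
Proof.
move=> sf sg H; apply/funext => r.
have [/eqP f0|/sf[k ->]//] := boolP (f r == 0).
have [/eqP g0|/sg[k ->]//] := boolP (g r == 0).
by rewrite f0 g0.
Qed.

Lemma one_pexp m k : (0 < m)%N -> puiseux_one (pexp m 0 k) = (k == 0%N)%:R.
Proof.
move=> m0; rewrite /puiseux_one /pexp add0r mulf_eq0 invr_eq0 intr_eq0.
have m1 : (m%:R : rat) != 0 by rewrite pnatr_eq0 -lt0n.
by rewrite (negPf m1) orbF.
Qed.

Lemma puiseux_mul1 f m n : prep m n f -> puiseux_mul puiseux_one f = f.
Proof.
move=> [m0 sf _]; have [_ s1 _] := one_prep m0.
have s2 := mul_supp m0 s1 sf; rewrite add0r in s2.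
apply: (prep_eq s2 sf) => k; have := puiseux_mulE k m0 s1 sf; rewrite add0r => ->.
rewrite big_ord_recl big1 => [|i _]; last by rewrite one_pexp// mul0r.
by rewrite one_pexp// mul1r subn0 addr0.
Qed.

Lemma puiseux_mulC m n n' f g : prep m n f -> prep m n' g ->
  puiseux_mul f g = puiseux_mul g f.
Proof.
move=> [m0 sf _] [_ sg _]; have s1 := mul_supp m0 sf sg.
have s2 := mul_supp m0 sg sf.
apply: (prep_eq s1); first by rewrite addrC.
move=> k; rewrite puiseux_mulE// addrC puiseux_mulE//.
rewrite (reindex_inj rev_ord_inj); apply: eq_bigr => i _ /=.
by rewrite subSS mulrC subKn// -ltnS.
Qed.

Lemma addp_prep m n f g : prep m n f -> prep m n g -> prep m n (f + g).
Proof.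
move=> pf pg; rewrite -[g]opprK -[- g]sub0r; apply: add_prep => //.
by apply: add_prep => //; apply: zero_prep; case: pf.
Qed.

Lemma puiseux_mulD m n n' f g h : prep m n f -> prep m n g -> prep m n' h ->
  puiseux_mul (f + g) h = puiseux_mul f h + puiseux_mul g h.
Proof.
move=> pf pg ph; have [_ s1 _] := mul_prep (addp_prep pf pg) ph.
have [_ s2 _] := addp_prep (mul_prep pf ph) (mul_prep pg ph).
have [m0 s3 _] := addp_prep pf pg.
move: pf pg ph => [_ sf _] [_ sg _] [_ sh _].
apply: (prep_eq s1 s2) => k.
rewrite [RHS](_ : _ = puiseux_mul f h (pexp m (n + n') k) +
                      puiseux_mul g h (pexp m (n + n') k))// !puiseux_mulE// -big_split.
by apply: eq_bigr => i _ /=; rewrite -mulrDl.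
Qed.

Lemma puiseux_mulA m n1 n2 n3 f g h : prep m n1 f -> prep m n2 g -> prep m n3 h ->
  puiseux_mul f (puiseux_mul g h) = puiseux_mul (puiseux_mul f g) h.
Proof.
move=> pf pg ph; have [_ sfg _] := mul_prep pf pg.
have [_ sgh _] := mul_prep pg ph.
have [_ s1 _] := mul_prep pf (mul_prep pg ph).
have [_ s2 _] := mul_prep (mul_prep pf pg) ph; rewrite -addrA in s2.
move: pf pg ph => [m0 sf _] [_ sg _] [_ sh _].
apply: (prep_eq s1 s2) => k; rewrite puiseux_mulE// addrA puiseux_mulE//.
pose P n f := \poly_(i < k.+1) f (pexp m n i).
have cP n f' i : (i <= k)%N -> (P n f')`_i = f' (pexp m n i).
  by move=> ik; rewrite coef_poly ltnS ik.
have := congr1 (fun p : {poly C} => p`_k) (mulrA (P n1 f) (P n2 g) (P n3 h)).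
rewrite coefM coefM => E; move: E; congr (_ = _); apply: eq_bigr => i _.
  have ik : (i <= k)%N by rewrite -ltnS.
  rewrite cP// puiseux_mulE// coefM; congr (_ * _); apply: eq_bigr => j _.
  have ij : (j <= k - i)%N by rewrite -ltnS.
  by rewrite !cP//; lia.
have ik : (i <= k)%N by rewrite -ltnS.
rewrite cP ?leq_subr// puiseux_mulE// coefM; congr (_ * _); apply: eq_bigr => j _.
have ij : (j <= i)%N by rewrite -ltnS.
by rewrite !cP//; lia.
Qed.


Section Inverse.
Variable a : nat -> C.

Fixpoint inv_seq (t : nat) : seq C :=
  if t is t'.+1 then
    let s := inv_seq t' in
    rcons s ((a 0%N)^-1 * ((t' == 0%N)%:R - \sum_(j < t') a (t' - j)%N * s`_j))
  else [::].

Definition inv_coef t := (inv_seq t.+1)`_t.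

Lemma size_inv_seq t : size (inv_seq t) = t.
Proof. by elim: t => //= t IH; rewrite size_rcons IH. Qed.

Lemma nth_inv_seq t j : (j < t)%N -> (inv_seq t)`_j = inv_coef j.
Proof.
elim: t => // t IH; rewrite ltnS leq_eqVlt => /orP[/eqP -> //|jt].
by rewrite [inv_seq _]/= nth_rcons size_inv_seq jt IH.
Qed.

Lemma inv_coefE t : inv_coef t =
  (a 0%N)^-1 * ((t == 0%N)%:R - \sum_(j < t) a (t - j)%N * inv_coef j).
Proof.
rewrite {1}/inv_coef [inv_seq _]/= nth_rcons size_inv_seq ltnn eqxx.
by congr (_ * (_ - _)); apply: eq_bigr => j _; rewrite nth_inv_seq.
Qed.

Hypothesis a0 : a 0%N != 0.

Lemma inv_coef_mul t :
  \sum_(j < t.+1) inv_coef j * a (t - j)%N = (t == 0%N)%:R.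
Proof.
rewrite big_ord_recr/= subnn inv_coefE mulrAC mulVf// mul1r.
under eq_bigr do rewrite mulrC.
by rewrite addrC subrK.
Qed.

Lemma inv_coef_bnd (rho M : R) : 0 < rho ->
  (forall k, nrm (a k) * rho ^+ k <= M) ->
  exists rho' M' : R, 0 < rho' /\ forall k, nrm (inv_coef k) * rho' ^+ k <= M'.
Proof.
move=> r0 aM; set b := nrm (a 0%N)^-1.
have b0 : 0 <= b by exact: nrm_ge0.
have M0 : 0 <= M by apply: le_trans (aM 0%N); rewrite expr0 mulr1 nrm_ge0.
have D0 : 0 < 1 + b * M by rewrite ltr_pwDl// mulr_ge0.
pose q := rho / (1 + b * M).
have q0 : 0 < q by rewrite divr_gt0.
have aq k : nrm (a k) * q ^+ k <= M * (1 + b * M) ^- k.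
  by rewrite /q expr_div_n mulrA ler_wpM2r// invr_ge0 exprn_ge0// ltW.
exists q, b; split=> // k; elim/ltn_ind: k => k IH.
rewrite inv_coefE nrmM -/b -mulrA ler_piMr//.
case: k IH => [_|k IH].
  by rewrite eqxx big_ord0 subr0 Normc.normc1 expr0 mulr1.
rewrite (_ : k.+1 == 0%N = false)// sub0r nrmN.
apply: (@le_trans _ _ ((\sum_(j < k.+1) nrm (a (k.+1 - j)%N * inv_coef j)) * q ^+ k.+1)).
  by rewrite ler_wpM2r ?exprn_ge0 ?(ltW q0)// nrm_sum.
set x := (1 + b * M)^-1.
have x0 : 0 < x by rewrite invr_gt0.
have bMx : b * M * x = 1 - x.
  by rewrite /x; field; rewrite gt_eqF.
apply: (@le_trans _ _ (\sum_(j < k.+1) (b * M) * x ^+ (k.+1 - j))).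
  rewrite mulr_suml; apply: ler_sum => j _.
  have jk : (j <= k.+1)%N by apply: ltnW.
  rewrite nrmM -[in q ^+ _](subnK jk) exprD mulrACA.
  rewrite [leRHS](_ : _ = M * x ^+ (k.+1 - j) * b); last by ring.
  apply: ler_pM; rewrite ?mulr_ge0 ?nrm_ge0 ?exprn_ge0 ?(ltW q0)//.
    by apply: le_trans (aq _) _; rewrite exprVn.
  by apply: IH.
rewrite (reindex_inj rev_ord_inj)/=.
rewrite (eq_bigr (fun i : 'I_k.+1 => (b * M * x) * x ^+ i)); last first.
  move=> i _; have ik : (i <= k)%N by rewrite -ltnS.
  by rewrite subSS subSn ?leq_subr// subKn// exprS mulrA.
rewrite -mulr_sumr bMx -opprB mulNr -subrX1 opprB gerBl exprn_ge0//.
exact: ltW.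
Qed.
End Inverse.

Lemma inv_prep m n f : f != 0 -> prep m n f ->
  exists n' g, prep m n' g /\ puiseux_mul g f = puiseux_one.
Proof.
move=> f0 [m0 sf [rho [M [r0 bf]]]].
have [k0 [k0f k0min]] : exists k0, f (pexp m n k0) != 0 /\
    forall k, (k < k0)%N -> f (pexp m n k) = 0.
  have ex : exists k, f (pexp m n k) != 0.
    apply/not_existsP => H; case/negP: f0; apply/eqP/funext => r.
    apply/eqP/negPn/negP => /[dup] /sf[k ->]; exact: H.
  exists (ex_minn ex); case: ex_minnP => k fk kmin; split=> // j jk.
  by apply/eqP/negPn/negP => /kmin; rewrite leqNgt jk.
pose a k := f (pexp m (n + k0%:Z) k).
have pE k : pexp m (n + k0%:Z) k = pexp m n (k0 + k).
  by rewrite /pexp PoszD addrA.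
have sf' : psupp m (n + k0%:Z) f.
  move=> r /[dup] fr /sf[k Ek]; exists (k - k0)%N; rewrite pE subnKC//.
  by rewrite leqNgt; apply/negP => /k0min; rewrite -Ek => /eqP; apply/negP.
have a0 : a 0%N != 0 by rewrite /a pE addn0.
have [|rho' [M' [r0' bg]]] := @inv_coef_bnd a rho (M / rho ^+ k0) r0.
  move=> k; rewrite ler_pdivlMr ?exprn_gt0// -mulrA -exprD addnC /a pE.
  exact: bf.
pose n' := - (n + k0%:Z).
pose g r := if pselect (exists k, r = pexp m n' k) is left e
            then inv_coef a (projT1 (cid e)) else 0.
have gE k : g (pexp m n' k) = inv_coef a k.
  rewrite /g; case: pselect => [e|[]]; last by exists k.
  by case: cid => j /= /pexp_inj ->.
have sg : psupp m n' g.
  by move=> r; rewrite /g; case: pselect => [e _|]; [exact: e|rewrite eqxx].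
exists n', g; split.
  by split=> //; exists rho', M'; split=> // k; rewrite gE.
have s1 := mul_supp m0 sg sf'; rewrite addNr in s1.
have [_ s2 _] := one_prep m0.
apply: (prep_eq s1 s2) => k.
have := puiseux_mulE k m0 sg sf'; rewrite addNr => ->.
under eq_bigr do rewrite gE.
by rewrite inv_coef_mul// one_pexp.
Qed.

End PuiseuxField.

Definition puiseux_pred (R : realType) : {pred rat -> R[i]} :=
  fun f => `[< puiseux_series f >].

Lemma puiseux_zmod_closed (R : realType) : zmod_closed (@puiseux_pred R).
Proof.
split=> [|f g]; first by apply/asboolP/puiseuxP; exists 1%N, 0; exact: zero_prep.
move=> /asboolP/puiseuxP[m [n pf]] /asboolP/puiseuxP[m' [n' pg]].
have [M [N [pf' pg']]] := prep_common pf pg.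
by apply/asboolP/puiseuxP; exists M, N; exact: add_prep.
Qed.

HB.instance Definition _ (R : realType) :=
  GRing.isZmodClosed.Build (rat -> R[i]) (@puiseux_pred R) (@puiseux_zmod_closed R).

Record puiseux (R : realType) := Puiseux {
  pcoef :> rat -> R[i];
  _ : pcoef \in @puiseux_pred R }.

HB.instance Definition _ (R : realType) := [isSub for @pcoef R].
HB.instance Definition _ (R : realType) := [Choice of puiseux R by <:].
HB.instance Definition _ (R : realType) :=
  [SubChoice_isSubZmodule of puiseux R by <:].

Section PuiseuxInstances.
Variable R : realType.
Implicit Types f g h : puiseux R.

Lemma pcoefP f : exists m n, prep m n f.
Proof. by case: f => f /= /asboolP/puiseuxP. Qed.

Lemma puiseux_of_prep m n (f : rat -> R[i]) : prep m n f -> f \in @puiseux_pred R.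
Proof. by move=> pf; apply/asboolP/puiseuxP; exists m, n. Qed.

Lemma puiseux_mul_closed f g : puiseux_mul f g \in @puiseux_pred R.
Proof.
have [[m [n pf]] [m' [n' pg]]] := (pcoefP f, pcoefP g).
have [M [N [pf' pg']]] := prep_common pf pg.
exact: puiseux_of_prep (mul_prep pf' pg').
Qed.

Definition pmul f g : puiseux R := Puiseux (puiseux_mul_closed f g).
Definition pone : puiseux R := Puiseux (puiseux_of_prep (one_prep R (ltn0Sn 0))).

Lemma pcoef_inj : injective (@pcoef R).
Proof. exact: val_inj. Qed.

Lemma pcommon3 f g h : exists m n n', [/\ prep m n f, prep m n g & prep m n' h].
Proof.
have [[m [n pf]] [[m' [n' pg]] [m2 [n2 ph]]]] := (pcoefP f, (pcoefP g, pcoefP h)).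
have [M [N [pf' pg']]] := prep_common pf pg.
have [M0 _ _] := pf'; have [m20 _ _] := ph.
exists (M * m2)%N, (N * m2%:Z - 0%N%:Z), (n2 * M%:Z - 0%N%:Z); split.
- exact: prep_scale.
- exact: prep_scale.
- by rewrite mulnC; exact: prep_scale.
Qed.

Lemma pmulA : associative pmul.
Proof.
move=> f g h; apply: val_inj => /=.
by have [m [n [n' [pf pg ph]]]] := pcommon3 f g h; exact: (puiseux_mulA pf pg ph).
Qed.

Lemma pmulC : commutative pmul.
Proof.
move=> f g; apply: val_inj => /=.
by have [m [n [n' [pf pg _]]]] := pcommon3 f g g; exact: (puiseux_mulC pf pg).
Qed.

Lemma pmul1 : left_id pone pmul.
Proof.
move=> f; apply: val_inj => /=.
by have [m [n pf]] := pcoefP f; exact: (puiseux_mul1 pf).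
Qed.

Lemma pmulDl : left_distributive pmul +%R.
Proof.
move=> f g h; apply: val_inj => /=.
by have [m [n [n' [pf pg ph]]]] := pcommon3 f g h; exact: (puiseux_mulD pf pg ph).
Qed.

Lemma pone_neq0 : pone != 0.
Proof.
apply/eqP => /(congr1 (fun f : puiseux R => f 0)) H.
have : puiseux_one R 0 = 0 by exact: H.
by rewrite /puiseux_one eqxx => /eqP; rewrite oner_eq0.
Qed.

End PuiseuxInstances.

HB.instance Definition _ (R : realType) :=
  GRing.Zmodule_isComNzRing.Build (puiseux R)
    (@pmulA R) (@pmulC R) (@pmul1 R) (@pmulDl R) (@pone_neq0 R).

Definition puiseux_inv (R : realType) (f : puiseux R) : puiseux R :=
  xget 0 [set g | g * f = 1].

Lemma puiseux_mulVf (R : realType) (f : puiseux R) :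
  f != 0 -> puiseux_inv f * f = 1.
Proof.
move=> f0; rewrite /puiseux_inv; case: xgetP => [g -> //|no].
have [m [n pf]] := pcoefP f.
have f0' : (f : rat -> R[i]) != 0.
  by apply: contra f0 => /eqP fE; apply/eqP/val_inj.
have [n' [g [pg gf]]] := inv_prep f0' pf.
have [] := no (Puiseux (puiseux_of_prep pg)).
by apply: val_inj.
Qed.

Lemma puiseux_inv0 (R : realType) : puiseux_inv 0 = 0 :> puiseux R.
Proof.
rewrite /puiseux_inv; case: xgetP => // g _ /eqP.
by rewrite mulr0 eq_sym oner_eq0.
Qed.

HB.instance Definition _ (R : realType) :=
  GRing.ComNzRing_isField.Build (puiseux R)
    (@puiseux_mulVf R) (@puiseux_inv0 R).

Definition toR (R : realType) (w : 'rV[int]_3) : 'rV[R]_3 := map_mx intr w.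

Definition dot (R : realType) (u v : 'rV[R]_3) : R := \sum_j u 0 j * v 0 j.

Definition convex_weights (R : realType) (I : choiceType) (A : {fset I})
    (t : I -> R) : Prop :=
  (forall i, i \in A -> 0 <= t i) /\ \sum_(i <- A) t i = 1.

Definition lattice_hull (R : realType) (A : {fset 'rV[int]_3}) : set 'rV[R]_3 :=
  [set x | exists2 t, convex_weights A t & x = \sum_(w <- A) t w *: toR R w].

(* The value at x of the lower boundary of Conv {(pos i, h i) : i \in A}. *)
Definition lower_hull (R : realType) (V : lmodType R) (I : choiceType)
    (A : {fset I}) (pos : I -> V) (h : I -> R) (x : V) : R :=
  inf [set s | exists t, [/\ convex_weights A t,
    x = \sum_(i <- A) t i *: pos i & s = \sum_(i <- A) t i * h i]].

Definition affine_on (R : realType) (V : lmodType R) (D : set V) (nu : V -> R)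
    : Prop :=
  forall x y (t : R), D x -> D y -> 0 <= t <= 1 ->
    nu (t *: x + (1 - t) *: y) = t * nu x + (1 - t) * nu y.

(* For convex nu, the maximal convex sets on which nu is affine are exactly its
   maximal linearity domains: a convex set on which nu is affine lies in the
   contact set of any affine function that supports nu at a relative interior
   point of it. *)
Definition linearity_domain (R : realType) (V : lmodType R) (P : set V)
    (nu : V -> R) (D : set V) : Prop :=
  [/\ D `<=` P, convex_set D, affine_on D nu
    & forall D', D `<=` D' -> D' `<=` P -> convex_set D' -> affine_on D' nu ->
        D' = D].

Definition lattice_polytope (R : realType) (P : set 'rV[R]_3) : Prop :=
  exists A, P = lattice_hull A.

Definition lattice_points (R : realType) (P : set 'rV[R]_3)
    : {fset 'rV[int]_3} := fset_set [set w | P (toR R w)].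

Definition differences_generate (R : realType) (P : set 'rV[R]_3) : Prop :=
  forall u : 'rV[int]_3, exists n : 'rV[int]_3 -> 'rV[int]_3 -> int,
    u = \sum_(w <- lattice_points P) \sum_(w' <- lattice_points P)
          (w - w') *~ n w w'.

Definition aff (R : realType) (B : {fset 'rV[int]_3}) : set 'rV[R]_3 :=
  [set x | exists2 t : 'rV[int]_3 -> R, \sum_(w <- B) t w = 1
                           & x = \sum_(w <- B) t w *: toR R w].

Definition aff_direction (R : realType) (B : {fset 'rV[int]_3})
    : set 'rV[R]_3 :=
  [set x | exists2 t : 'rV[int]_3 -> R, \sum_(w <- B) t w = 0
                           & x = \sum_(w <- B) t w *: toR R w].

(* Orthogonality is only a condition for subspaces of positive dimension: every
   vector is orthogonal to a point. *)
Definition generic_direction (R : realType) (P : set 'rV[R]_3) (v : 'rV[rat]_3)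
    : Prop :=
  forall B : {fset 'rV[int]_3}, (B `<=` lattice_points P)%fset -> B != fset0 ->
    aff B <> (setT : set 'rV[R]_3) ->
    ~ aff_direction B (map_mx ratr v : 'rV[R]_3) /\
    (aff_direction B <> [set (0 : 'rV[R]_3)] ->
     ~ forall u : 'rV[R]_3, aff_direction B u -> dot (map_mx ratr v) u = 0).

Definition num_points (R : realType) (P : set 'rV[R]_3) : nat :=
  (#|` lattice_points P| - 2)%N.

(* For C large, such an M avoids any given finite set of nontrivial linear
   relations between 1, M 0, ..., M N.-1: no further genericity is needed. *)
Definition well_spaced (N : nat) (C : rat) (M : nat -> rat) : Prop :=
  C < M 0%N /\ forall i, (i.+1 < N)%N -> C < M i.+1 / M i.

Definition config (R : realType) (v : 'rV[rat]_3) (M : nat -> rat) (i : nat)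
    : 'rV[R]_3 := map_mx ratr (M i *: v).

Section Surfaces.
Variables (R : realType) (P : set 'rV[R]_3).
Local Notation K := (puiseux R).
Local Notation A := (lattice_points P).
(* f is the coefficient function of a Laurent polynomial. *)
Implicit Types (f : 'rV[int]_3 -> K) (p : 'rV[K]_3).

Definition supported f : Prop := forall w, f w != 0 -> w \in A.

Definition leval f p : K := \sum_(w <- A) f w * \prod_j p 0 j ^ w 0 j.

Definition lpartial (i : 'I_3) f p : K :=
  \sum_(w <- A) f w * (w 0 i)%:~R * \prod_j p 0 j ^ (w 0 j - (j == i)%:Z).

Definition singular_point f p : Prop :=
  [/\ forall j, p 0 j != 0, leval f p = 0 & forall i, lpartial i f p = 0].

Definition Sing : set ('rV[int]_3 -> K) :=
  [set f | [/\ exists w, f w != 0, supported f & exists p, singular_point f p]].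

Definition coef_vector f : 'I_(size A) -> K := fun i => f (nth 0 A i).

End Surfaces.

Definition zariski_closure (F : fieldType) (n : nat) (X : set ('I_n -> F))
    : set ('I_n -> F) :=
  [set a | forall Q : mpoly.mpoly n F,
     (forall b, X b -> mpoly.meval b Q = 0) -> mpoly.meval a Q = 0].

Definition is_hypersurface (F : fieldType) (n : nat) (X : set ('I_n -> F))
    : Prop :=
  exists2 Q : mpoly.mpoly n F, forall c, Q <> mpoly.mpolyC n c
    & X = [set a | mpoly.meval a Q = 0].

(* Sing P is invariant under scaling and is regarded as a cone in K^A. *)
Definition nondefective (R : realType) (P : set 'rV[R]_3) : Prop :=
  is_hypersurface (zariski_closure (@coef_vector R P @` Sing P)).

Definition Val (R : realType) (a : puiseux R) : R :=
  - ratr (xget 0 [set r | a r != 0 /\ forall s, a s != 0 -> r <= s]).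

Definition Val_point (R : realType) (p : 'rV[puiseux R]_3) : 'rV[R]_3 :=
  \row_j Val (p 0 j).

Definition trop_poly (R : realType) (A : {fset 'rV[int]_3})
    (c : 'rV[int]_3 -> R) (X : 'rV[R]_3) : R :=
  sup [set c w + dot (toR R w) X | w in [set` A]].

Definition corner_locus (R : realType) (A : {fset 'rV[int]_3})
    (c : 'rV[int]_3 -> R) : set 'rV[R]_3 :=
  [set X | exists w w', [/\ w \in A, w' \in A, w != w',
     c w + dot (toR R w) X = trop_poly A c X
   & c w' + dot (toR R w') X = trop_poly A c X]].

(* A tropical surface S with Newton polytope P is given by the coefficients c
   (used at the lattice points of P only) of F_S: as a set S is the corner locus
   of F_S, and the weights of its facets are the lattice lengths of the dual
   edges of the subdivision.  Both together amount to F_S up to an additive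
   constant. *)

Section TropicalSurface.
Variables (R : realType) (P : set 'rV[R]_3) (c : 'rV[int]_3 -> R).
Local Notation A := (lattice_points P).

Definition F_S : 'rV[R]_3 -> R := trop_poly A c.

Definition surface : set 'rV[R]_3 := corner_locus A c.

Definition nu_S : 'rV[R]_3 -> R := lower_hull A (toR R) (fun w => - c w).

(* By Kapranov's theorem the closure of the image of {f = 0} under Val is the
   corner locus of the tropical polynomial of f. *)
Definition tropicalizes_to (f : 'rV[int]_3 -> puiseux R) : Prop :=
  exists k, forall X,
    trop_poly [fset w in A | f w != 0]%fset (fun w => Val (f w)) X = F_S X + k.

Definition in_Sing_tr : Prop := exists2 f, Sing P f & tropicalizes_to f.

Definition possible_singular_point : set 'rV[R]_3 :=
  [set y | surface y /\ exists f p,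
     [/\ Sing P f, tropicalizes_to f, singular_point P f p & Val_point p = y]].

Definition aff_dependent (B : {fset 'rV[int]_3}) : Prop :=
  exists t : 'rV[int]_3 -> R, [/\ exists2 w, w \in B & t w != 0,
    \sum_(w <- B) t w = 0 & \sum_(w <- B) t w *: toR R w = 0].

Definition is_circuit (B : {fset 'rV[int]_3}) : Prop :=
  aff_dependent B /\
  forall B', (B' `<` B)%fset -> ~ aff_dependent B'.

(* A circuit of the dual subdivision: the cells are the linearity domains. *)
Definition circuit_of (B : {fset 'rV[int]_3}) : Prop :=
  [/\ (B `<=` A)%fset, is_circuit B & exists2 D, linearity_domain P nu_S D
                                   & forall w, w \in B -> D (toR R w)].

Definition is_the_circuit (B : {fset 'rV[int]_3}) : Prop :=
  forall B', circuit_of B' <-> B' = B.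

End TropicalSurface.

Definition zvec (a b d : int) : 'rV[int]_3 := \row_j [:: a; b; d]`_j.

Definition circuit_C : {fset 'rV[int]_3} :=
  [fset zvec 1 0 0; zvec 2 1 0; zvec 0 2 0; zvec 1 1 0]%fset.

Definition zcoord (T : Type) (w : 'rV[T]_3) : T := w 0 2.

Section TypeC.
Variables (R : realType) (P : set 'rV[R]_3) (c : 'rV[int]_3 -> R).
(* Lambda' = <l, _> + k, and h0 stands for -c'_0 *)
Variables (l : 'rV[R]_3) (k h0 : R).
Local Notation A := (lattice_points P).

Definition Lambda1 (x : 'rV[R]_3) : R := dot l x + k.

Definition nu' (x : 'rV[R]_3) : R := nu_S P c x - Lambda1 x.

Definition pr_z : set R := @zcoord R @` P.

(* The levels m that contain lattice points of P; on the other integers of pr_z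
   the minimum that defines -c'_m is over the empty set, i.e. +oo. *)
Definition levels : {fset int} := [fset @zcoord int w | w in A]%fset.

(* m |-> -c'_m; the infimum is over a finite nonempty set for m \in levels *)
Definition level_height (m : int) : R :=
  if m == 0 then h0
  else inf [set nu' (toR R w) | w in [set w | w \in A /\ zcoord w = m]].

Definition nu_z : R -> R :=
  lower_hull levels (fun m => m%:~R : R^o) level_height.

Definition segments : seq (int * int) :=
  [:: (-3, -1); (-3, 1); (-3, 3); (-1, 1); (-1, 3); (1, 3)].

(* Lambda'' : z |-> s * z is represented by its slope s.  A linearity domain of
   nu_z is the projection of an edge of its graph. *)
Definition Lambda2_slopes : set R :=
  [set s | (forall z, pr_z z -> s * z < nu_z z) /\
     exists a b : int, [/\ (a, b) \in segments,
       linearity_domain (pr_z : set R^o) nu_z `[a%:~R, b%:~R]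
     & nu_z b%:~R - nu_z a%:~R = s * (b%:~R - a%:~R)]].

Definition gradient (s : R) : 'rV[R]_3 := l + s *: delta_mx 0 2.

End TypeC.

(* Main.v *)
Require Import Defs.
From HB Require Import structures.
From mathcomp Require Import all_boot all_order all_algebra.
From mathcomp Require Import finmap complex.
From mathcomp Require Import all_classical all_reals all_analysis.
From mathcomp Require Import ring lra zify.

(* Let a_w = f_w p^w be the terms of f at a singular point p over y.  Their leading
   coefficients form an affine dependence between lattice points of one cell of the
   dual subdivision, hence a multiple of the relation (1, 1, 1, -3) of the circuit.
   So y is the gradient of Lambda' + s z for some s, and u(w) = nu'(w) - s z(w) is
   zero on the circuit and positive at all other lattice points.  The circuit drops out
   of the equation sum z(w) a_w = 0, so the minimum of u over the points with
   z(w) <> 0 is attained at least twice.  It is attained only on the levels +-1 and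
   +-3: otherwise the tetrahedron spanned by the minimizer and the circuit contains a
   lattice point of smaller nonzero level, where u is smaller by convexity.  Two
   minimizers on the same level would give a linear relation between the M_i, which
   their growth excludes.  Hence s is the slope of an edge of nu_z over one of the six
   segments.  Conversely, for such a slope take monomials of order u(w) away from the
   circuit: two minimizers of u on different levels make it possible to solve the
   z-equation with the right leading terms, and a perturbation of (1, 1, 1, -3) solves
   the remaining three equations. *)

(** Tropicalization remembers only [F_S] up to a constant, so it determines [Val (f w)] only where
    the lower hull sees [w]. Here the uniqueness of the circuit enters: an affine dependence between
    lattice points at which one affine minorant of [nu_S] is tight is a multiple of [theta], whose
    only negative entry is at [vC]. So the height of every lattice point except [vC] is forced, and
    [vC] has to be treated separately throughout. As [nu_S] is defined by an infimum over weights,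
    this rests on linear programming duality, which supplies optimal weights and tight minorants.
    The levels +-3 survive because the triangle of the circuit has normalized area 3: over it there
    are tetrahedra of height 3 without lattice points at the heights 1 and 2. Puiseux exponents are
    rational, so the slope of an edge has to be proved rational before it can be realized by a
    singular point. The threshold for [h0] must serve all singular points at once; it is read off
    from the intercepts of the candidate edges over the six segments. *)

Set Implicit Arguments. Unset Strict Implicit. Unset Printing Implicit Defensive.
Import Order.TTheory GRing.Theory Num.Theory.
Local Open Scope classical_set_scope.
Local Open Scope ring_scope.

(** * Farkas' lemma and linear programming duality *)

(* Bartl's induction: if c is not already nonnegative on the cone cut out by the
   a_j with j != i, pick x0 there with c x0 < 0; then a_i x0 < 0, and subtracting
   multiples of a_i makes all functionals vanish at x0. *)
Lemma farkas (R : realFieldType) (W : lmodType R) (I : eqType) (s : seq I)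
    (a : I -> W -> R) (c : W -> R) :
  uniq s -> (forall i k x y, a i (k *: x + y) = k * a i x + a i y) ->
  (forall k x y, c (k *: x + y) = k * c x + c y) ->
  (forall x, (forall i, i \in s -> 0 <= a i x) -> 0 <= c x) ->
  exists2 t : I -> R, (forall i, 0 <= t i)
                    & forall x, c x = \sum_(i <- s) t i * a i x.
Proof.
have scal (f : W -> R) k x : (forall k x y, f (k *: x + y) = k * f x + f y) ->
    f (k *: x) = k * f x.
  move=> lf; rewrite -[k *: x]addr0 lf.
  have := lf 1 0 0; rewrite scaler0 add0r mul1r => /eqP.
  by rewrite -subr_eq0 opprD addNKr oppr_eq0 => /eqP ->; rewrite addr0.
elim: s a c => [|i s IH] a c.
  move=> _ _ lc c0; exists (fun=> 0) => // x; rewrite big_nil.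
  have /le_anti : 0 <= c x <= 0; last by move=> /esym.
  rewrite c0//= -oppr_ge0.
  by rewrite -[- _]mulN1r -scal// c0.
move=> /= /andP[nis us] la lc H.
case: (pselect (forall x, (forall j, j \in s -> 0 <= a j x) -> 0 <= c x)).
  move=> H'; have [t t0 E] := IH a c us la lc H'.
  exists (fun j => if j == i then 0 else t j) => [j|x].
    by case: ifP.
  rewrite big_cons eqxx mul0r add0r E; apply: eq_big_seq => j js.
  by case: eqP => // ji; rewrite -ji js in nis.
move=> /existsNP[x0 /not_implyP[ax0 /negP]]; rewrite -ltNge => cx0.
have aix0 : a i x0 < 0.
  rewrite ltNge; apply/negP => aix0; move: cx0; rewrite ltNge => /negP; apply.
  apply: H => j; rewrite inE => /predU1P[->//|]; exact: ax0.
pose b (f : W -> R) x := f x - f x0 / a i x0 * a i x.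
have lb f : (forall k x y, f (k *: x + y) = k * f x + f y) ->
    forall k x y, b f (k *: x + y) = k * b f x + b f y.
  by move=> lf k x y; rewrite /b lf la; ring.
have aix00 : a i x0 != 0 by rewrite lt_eqF.
have bE f x : (forall k x y, f (k *: x + y) = k * f x + f y) ->
    b f x = f (- (a i x / a i x0) *: x0 + x).
  by move=> lf; rewrite lf /b; field.
have [] := IH (fun j => b (a j)) (b c) us.
- by move=> j; exact: lb.
- exact: lb.
- move=> x bx; rewrite bE//; apply: H => j; rewrite inE => /predU1P[->|js].
    by rewrite -bE// /b divff// mul1r subrr.
  by rewrite -bE//; exact: bx.
move=> t t0 E.
exists (fun j => if j == i then (c x0 - \sum_(j <- s) t j * a j x0) / a i x0 else t j).
  move=> j; case: ifP => // _; rewrite -mulrNN -invrN mulr_ge0//; last first.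
    by rewrite invr_ge0 oppr_ge0 ltW.
  rewrite opprB subr_ge0 (le_trans (ltW cx0))// big_seq sumr_ge0// => k ks.
  by rewrite mulr_ge0// ax0.
move=> x; rewrite big_cons eqxx.
have -> : \sum_(j <- s) (if j == i then (c x0 - \sum_(j <- s) t j * a j x0) / a i x0
   else t j) * a j x = \sum_(j <- s) t j * a j x.
  by apply: eq_big_seq => j js; case: eqP => // ji; rewrite -ji js in nis.
have := E x; rewrite {1}/b => /(canRL (subrK _)) ->.
under eq_bigr do rewrite /b mulrBr.
rewrite big_split/= sumrN.
have -> : \sum_(i0 <- s) t i0 * (a i0 x0 / a i x0 * a i x) =
   (\sum_(i0 <- s) t i0 * a i0 x0) * (a i x / a i x0).
  by rewrite mulr_suml; apply: eq_bigr => j _; field.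
by field.
Qed.

Section Dot.
Variable R : realType.
Implicit Types u v w : 'rV[R]_3.

Lemma dotC u v : dot u v = dot v u.
Proof. by apply: eq_bigr => j _; rewrite mulrC. Qed.

Lemma dotDl u v w : dot (u + v) w = dot u w + dot v w.
Proof. by rewrite -big_split; apply: eq_bigr => j _; rewrite !mxE mulrDl. Qed.

Lemma dotZl k u w : dot (k *: u) w = k * dot u w.
Proof. by rewrite mulr_sumr; apply: eq_bigr => j _; rewrite !mxE mulrA. Qed.

Lemma dotNl u w : dot (- u) w = - dot u w.
Proof. by rewrite -scaleN1r dotZl mulN1r. Qed.

Lemma dotBl u v w : dot (u - v) w = dot u w - dot v w.
Proof. by rewrite dotDl dotNl. Qed.

Lemma dotDr u v w : dot w (u + v) = dot w u + dot w v.
Proof. by rewrite !(dotC w) dotDl. Qed.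

Lemma dotZr k u w : dot w (k *: u) = k * dot w u.
Proof. by rewrite !(dotC w) dotZl. Qed.

Lemma dot_suml (I : Type) (s : seq I) (F : I -> 'rV[R]_3) w :
  dot (\sum_(i <- s) F i) w = \sum_(i <- s) dot (F i) w.
Proof.
elim/big_rec2: _ => [|i y x _ <-]; last by rewrite dotDl.
by rewrite /dot big1// => j _; rewrite mxE mul0r.
Qed.

Lemma dot_delta u j : dot u (delta_mx 0 j) = u 0 j.
Proof.
rewrite /dot (bigD1 j)//= big1 => [|i ij]; first by rewrite mxE !eqxx mulr1 addr0.
by rewrite mxE (negPf ij) andbF mulr0.
Qed.

Lemma dot_comb (I : Type) (s : seq I) (t : I -> R) (F : I -> 'rV[R]_3) w :
  dot (\sum_(i <- s) t i *: F i) w = \sum_(i <- s) t i * dot (F i) w.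
Proof. by rewrite dot_suml; apply: eq_bigr => i _; rewrite dotZl. Qed.

Lemma dot_inj u v : (forall X, dot u X = dot v X) -> u = v.
Proof. by move=> E; apply/rowP => j; rewrite -!dot_delta E. Qed.

End Dot.

Section LinearProgram.
Variables (R : realType) (I : choiceType) (A : {fset I}).
Variables (pos : I -> 'rV[R]_3) (h : I -> R).
Implicit Types (t : I -> R) (x X : 'rV[R]_3).

Definition bary t x := convex_weights A t /\ x = \sum_(i <- A) t i *: pos i.

Definition under X eta := forall i, i \in A -> dot (pos i) X + eta <= h i.

Lemma under_bary X eta t x : under X eta -> bary t x ->
  dot x X + eta <= \sum_(i <- A) t i * h i.
Proof.
move=> uX [[t0 t1] ->]; rewrite dot_comb -[eta]mul1r -t1 mulr_suml -big_split/=.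
rewrite big_seq [leRHS]big_seq; apply: ler_sum => i iA.
by rewrite -mulrDr ler_wpM2l ?t0 ?uX.
Qed.

Lemma under_exists : exists eta, under 0 eta.
Proof.
exists (- \sum_(i <- A) `|h i|) => i iA.
rewrite dotC /dot big1 => [|j _]; last by rewrite mxE mul0r.
rewrite add0r lerNl (big_fsetD1 i)//= -[leLHS]addr0 lerD ?sumr_ge0//.
by rewrite -normrN ler_norm.
Qed.

(* A separating functional that ignores the heights can be tilted by an affine
   function below them; so it can be assumed to have height coefficient 1. *)
Lemma weights_below x m : (forall X eta, under X eta -> dot x X + eta <= m) ->
  exists2 t, bary t x & \sum_(i <- A) t i * h i <= m.
Proof.
move=> H; pose W : lmodType R := ('rV[R]_3 * R^o * R^o)%type.
pose a (i : option I) (z : W) : R := let: (X, eta, tau) := z in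
  if i is Some i then dot (pos i) X + eta + tau * h i else tau.
pose cc (z : W) : R := let: (X, eta, tau) := z in dot x X + eta + tau * m.
pose s := None :: [seq Some i | i <- A].
have us : uniq s.
  rewrite /s/= map_inj_uniq ?fset_uniq ?andbT; last by move=> ? ? [].
  by apply/negP => /mapP[].
have [] := @farkas R W _ s a cc us.
- by move=> [i|] k [[X e] r] [[X' e'] r']; rewrite /a/= ?dotDr ?dotZr /GRing.scale/=; ring.
- by move=> k [[X e] r] [[X' e'] r']; rewrite /cc/= ?dotDr ?dotZr /GRing.scale/=; ring.
- have pos_case X eta tau : 0 < tau ->
      (forall i, i \in A -> 0 <= dot (pos i) X + eta + tau * h i) ->
      0 <= dot x X + eta + tau * m.
    move=> tau0 HA.
    have norm v r : (dot v (- tau^-1 *: X) + - tau^-1 * eta <= r) =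
        (0 <= dot v X + eta + tau * r).
      by rewrite dotZr -mulrDr mulNr lerNl -(ler_pM2l tau0) mulVKf ?gt_eqF//
        mulrN -[RHS]subr_ge0 subr0 -[LHS]subr_ge0 opprK.
    by rewrite -norm; apply: H => i iA; rewrite norm HA.
  move=> [[X eta] tau] HA; rewrite leNgt; apply/negP => neg.
  have tau0 : 0 <= tau by exact: (HA None).
  have HA' i : i \in A -> 0 <= dot (pos i) X + eta + tau * h i.
    by move=> iA; apply: (HA (Some i)); rewrite inE/= mem_map// => ? ? [].
  have [eta0 u0] := under_exists.
  (* Adding [e] times the feasible triple [(0, - eta0, 1)] makes the height coefficient positive,
     and [e] is so small that [cc] stays negative. *)
  pose cX := m - eta0; pose e := - cc (X, eta, tau) / (`|cX| + 1).
  have c0 : 0 < `|cX| + 1 by rewrite ltr_wpDl.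
  have e0 : 0 < e by rewrite divr_gt0// oppr_gt0.
  have := pos_case X (eta - e * eta0) (tau + e).
  rewrite ltr_wpDl// => /(_ isT); apply/not_implyP; split.
    move=> i iA; have := u0 i iA.
    have -> : dot (pos i) 0 = 0 by rewrite dotC /dot big1// => j _; rewrite mxE mul0r.
    rewrite add0r => hi; have := HA' i iA.
    by have : 0 <= e * (h i - eta0); [rewrite mulr_ge0 ?subr_ge0// ltW|lra].
  apply/negP; rewrite -ltNge.
  have : e * cX < - cc (X, eta, tau).
    rewrite /e mulrAC ltr_pdivrMr// ltr_pM2l ?oppr_gt0//.
    by rewrite (le_lt_trans (ler_norm _))// ltrDl.
  by rewrite /cX /cc; lra.
move=> t t0 E; pose t' i := t (Some i).
have E' X eta tau : dot x X + eta + tau * m =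
    t None * tau + \sum_(i <- A) t' i * (dot (pos i) X + eta + tau * h i).
  by have := E (X, eta, tau); rewrite /cc big_cons big_map/=.
have z0 (v : 'rV[R]_3) : dot v 0 = 0.
  by rewrite dotC /dot big1// => j _; rewrite mxE mul0r.
exists t'; last first.
  have := E' 0 0 1; rewrite z0 !add0r mul1r mulr1 => ->.
  under [X in _ <= _ + X]eq_bigr do rewrite z0 !add0r mul1r.
  by rewrite lerDr.
split; [split|].
- by move=> i _; exact: t0.
- have := E' 0 1 0; rewrite z0 mul0r addr0 mulr0 !add0r => ->.
  by apply: eq_bigr => i _; rewrite z0 add0r mul0r addr0 mulr1.
- apply: dot_inj => X; have := E' X 0 0; rewrite mulr0 mul0r !addr0 add0r => ->.
  by rewrite dot_comb; apply: eq_bigr => i _; rewrite mul0r !addr0.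
Qed.

Lemma lower_hull_ge x X eta : (exists t, bary t x) -> under X eta ->
  dot x X + eta <= lower_hull A pos h x.
Proof.
move=> [t [wt xt]] uX; apply: lb_le_inf; first by exists (\sum_(i <- A) t i * h i); exists t.
by move=> _ [t' [wt' xt' ->]]; apply: under_bary.
Qed.

Lemma lower_hull_le x t : bary t x ->
  lower_hull A pos h x <= \sum_(i <- A) t i * h i.
Proof.
move=> [wt xt]; apply: ge_inf; last by exists t.
have [eta u0] := under_exists.
by exists (dot x 0 + eta) => _ [t' [wt' xt' ->]]; apply: under_bary.
Qed.

Lemma lower_hull_primal x : (exists t, bary t x) ->
  exists2 t, bary t x & \sum_(i <- A) t i * h i = lower_hull A pos h x.
Proof.
move=> fx; have [|t bt le] := @weights_below x (lower_hull A pos h x).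
  by move=> X eta; exact: lower_hull_ge.
by exists t => //; apply/le_anti; rewrite le lower_hull_le.
Qed.

(** If no minorant were tight at [x], the constraints would force [tau <= 0], and Farkas' lemma
    would write [- tau] as a nonnegative combination of them. Divided by [t None], its coefficients
    are barycentric weights of [x] whose value lies below the infimum by [1 / t None]. *)
Lemma lower_hull_dual x : (exists t, bary t x) ->
  exists X eta, under X eta /\ dot x X + eta = lower_hull A pos h x.
Proof.
move=> fx; pose m := lower_hull A pos h x.
pose W : lmodType R := ('rV[R]_3 * R^o * R^o)%type.
pose a (i : option I) (z : W) : R := let: (X, eta, tau) := z in
  if i is Some i then tau * h i - dot (pos i) X - eta else dot x X + eta - tau * m.
pose s := None :: [seq Some i | i <- A].
have us : uniq s.
  rewrite /s/= map_inj_uniq ?fset_uniq ?andbT; last by move=> ? ? [].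
  by apply/negP => /mapP[].
have [[X [eta [tau [Ha tau0]]]]|no] := pselect (exists X (eta tau : R),
    (forall i, i \in s -> 0 <= a i (X, eta, tau)) /\ 0 < tau).
  have tn : tau != 0 by rewrite gt_eqF.
  have uX : under (tau^-1 *: X) (tau^-1 * eta).
    move=> i iA; rewrite dotZr -mulrDr -(ler_pM2l tau0) mulVKf//.
    have : 0 <= a (Some i) (X, eta, tau).
      by apply: Ha; rewrite inE/= mem_map// => ? ? [].
    by rewrite /a; lra.
  exists (tau^-1 *: X), (tau^-1 * eta); split=> //.
  apply/le_anti; rewrite lower_hull_ge//= dotZr -mulrDr -(ler_pM2l tau0) mulVKf//.
  have : 0 <= a None (X, eta, tau) by apply: Ha; rewrite inE.
  by rewrite /a; lra.
have [] := @farkas R W _ s a (fun z => - z.2) us.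
- by move=> [i|] k [[X e] r] [[X' e'] r']; rewrite /a/= ?dotDr ?dotZr /GRing.scale/=; ring.
- by move=> k [[X e] r] [[X' e'] r']; rewrite /= /GRing.scale/=; ring.
- move=> [[X eta] tau] Hz; rewrite oppr_ge0 leNgt; apply/negP => z0; apply: no.
  by exists X, eta, tau.
move=> t t0 E; pose t' i := t (Some i).
have E' X eta tau : - tau = t None * (dot x X + eta - tau * m) +
    \sum_(i <- A) t' i * (tau * h i - dot (pos i) X - eta).
  by have := E (X, eta, tau); rewrite /a big_cons big_map/=.
have z0 (v : 'rV[R]_3) : dot v 0 = 0.
  by rewrite dotC /dot big1// => j _; rewrite mxE mul0r.
have S1 : \sum_(i <- A) t' i = t None.
  have := E' 0 1 0; rewrite z0.
  rewrite (eq_bigr (fun i => - t' i)) => [|i _]; last by rewrite z0; ring.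
  by rewrite sumrN => ?; lra.
have Sp X : t None * dot x X = \sum_(i <- A) t' i * dot (pos i) X.
  have := E' X 0 0.
  rewrite (eq_bigr (fun i => - (t' i * dot (pos i) X))) => [|i _]; last by ring.
  by rewrite sumrN => ?; lra.
have Sh : \sum_(i <- A) t' i * h i = t None * m - 1.
  have := E' 0 0 1; rewrite z0.
  rewrite (eq_bigr (fun i => t' i * h i)) => [?|i _]; first by lra.
  by rewrite z0; ring.
have [tN|tN] := eqVneq (t None) 0.
  exfalso; move: Sh; rewrite tN mul0r sub0r big_seq big1; first by lra.
  move=> i iA; suff -> : t' i = 0 by rewrite mul0r.
  apply/le_anti; rewrite t0 andbT; move: S1; rewrite tN (big_fsetD1 i)//= => S1.
  have : 0 <= \sum_(j <- (A `\ i)%fset) t' j by apply: sumr_ge0 => j _; exact: t0.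
  by lra.
have tp : 0 < t None by rewrite lt_def tN t0.
exfalso; have /lower_hull_le : bary (fun i => (t None)^-1 * t' i) x.
  split; first split.
  - by move=> i _; apply: mulr_ge0; [rewrite invr_ge0 ltW|exact: t0].
  - by rewrite -mulr_sumr S1 mulVf.
  - apply: dot_inj => X; rewrite dot_comb -[LHS](mulKf tN) Sp mulr_sumr.
    by apply: eq_bigr => i _; rewrite mulrA.
under eq_bigr do rewrite -mulrA.
rewrite -mulr_sumr Sh mulrBr mulKf// mulr1 lerDl oppr_ge0 leNgt invr_gt0 tp//.
Qed.

End LinearProgram.

(** * Coordinates, the circuit, lattice hulls and tropical polynomials *)

Section Coordinates.

Lemma sum3 (V : nmodType) (F : 'I_3 -> V) : \sum_j F j = F 0 + F 1 + F 2.
Proof.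
rewrite !big_ord_recl big_ord0 addr0 addrA.
by congr (_ + F _ + F _); apply: val_inj.
Qed.

Lemma row3P (T : Type) (u v : 'rV[T]_3) :
  u 0 0 = v 0 0 -> u 0 1 = v 0 1 -> u 0 2 = v 0 2 -> u = v.
Proof.
move=> H0 H1 H2; apply/rowP => -[[|[|[|//]]] j3].
- by rewrite (_ : Ordinal j3 = 0)//; apply: val_inj.
- by rewrite (_ : Ordinal j3 = 1)//; apply: val_inj.
- by rewrite (_ : Ordinal j3 = 2)//; apply: val_inj.
Qed.

Lemma zvecE a b d : (zvec a b d 0 0 = a) * (zvec a b d 0 1 = b) * (zvec a b d 0 2 = d).
Proof. by rewrite !mxE. Qed.

Lemma zvec_eq a b d a' b' d' :
  (zvec a b d == zvec a' b' d') = [&& a == a', b == b' & d == d'].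
Proof.
apply/eqP/and3P => [E|[/eqP-> /eqP-> /eqP->]//].
have := congr1 (fun u : 'rV[int]_3 => (u 0 0, u 0 1, u 0 2)) E.
by rewrite !zvecE => -[-> -> ->].
Qed.

Variable R : realType.

Lemma dot3 (u v : 'rV[R]_3) :
  dot u v = u 0 0 * v 0 0 + u 0 1 * v 0 1 + u 0 2 * v 0 2.
Proof. exact: sum3. Qed.

End Coordinates.

Section Circuit.

Definition vE := zvec 1 0 0.
Definition vF := zvec 2 1 0.
Definition vG := zvec 0 2 0.
Definition vC := zvec 1 1 0.

(** The affine relation of the circuit, extended by zero: [vC] is the centroid of the triangle [vE],
    [vF], [vG]. *)
Definition theta (w : 'rV[int]_3) : int :=
  if w == vC then -3 else if w \in circuit_C then 1 else 0.

Lemma circuitE w : (w \in circuit_C) = [|| w == vE, w == vF, w == vG | w == vC].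
Proof. by rewrite !in_fsetE -!orbA. Qed.

Lemma circuit_distinct : (vE == vF = false) * (vE == vG = false) * (vE == vC = false)
  * (vF == vG = false) * (vF == vC = false) * (vG == vC = false).
Proof. by rewrite !zvec_eq. Qed.

Lemma circuit_mem : [/\ vE \in circuit_C, vF \in circuit_C, vG \in circuit_C
  & vC \in circuit_C].
Proof. by rewrite !circuitE !eqxx !orbT. Qed.

Lemma theta_val : (theta vE = 1) * (theta vF = 1) * (theta vG = 1) * (theta vC = -3).
Proof. by rewrite /theta !circuit_distinct !circuitE !eqxx !orbT. Qed.

Lemma theta0 w : w \notin circuit_C -> theta w = 0.
Proof.
rewrite /theta => nC; rewrite (negPf nC); move: nC.
by rewrite circuitE !negb_or => /and4P[_ _ _ /negPf->].
Qed.

Lemma big_circuit (V : nmodType) (F : 'rV[int]_3 -> V) :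
  \sum_(w <- circuit_C) F w = F vE + F vF + F vG + F vC.
Proof.
rewrite (perm_big [:: vE; vF; vG; vC]) /=.
  by rewrite !big_cons big_nil addr0 !addrA.
apply: uniq_perm; first exact: fset_uniq.
  by rewrite /= !inE !circuit_distinct.
by move=> w; rewrite circuitE !inE.
Qed.

Lemma theta_sum (R : realType) (A : {fset 'rV[int]_3}) (F : 'rV[int]_3 -> R) :
  (circuit_C `<=` A)%fset ->
  \sum_(w <- A) (theta w)%:~R * F w = F vE + F vF + F vG - 3 * F vC.
Proof.
move=> CA; rewrite -(big_fset_incl _ CA) => [|w _ /theta0->]; last by rewrite mul0r.
by rewrite big_circuit !theta_val !mul1r rmorphN mulNr.
Qed.

End Circuit.

Section Hull.
Variable R : realType.
Implicit Types A B : {fset 'rV[int]_3}.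

Lemma hullP A x : lattice_hull A x <-> exists t, bary A (toR R) t x.
Proof. by split=> [[t]|[t []]]; exists t. Qed.

Lemma hull_comb A (I : choiceType) (B : {fset I}) s (x : I -> 'rV[R]_3) :
  convex_weights B s -> (forall i, i \in B -> lattice_hull A (x i)) ->
  lattice_hull A (\sum_(i <- B) s i *: x i).
Proof.
move=> [s0 s1] Hx.
have /choice[t Ht] : forall i, exists t, i \in B -> bary A (toR R) t (x i).
  move=> i; have [iB|/negP niB] := boolP (i \in B); last by exists (fun=> 0).
  by have /hullP[t Ht] := Hx i iB; exists t.
exists (fun w => \sum_(i <- B) s i * t i w).
  split=> [w wA|].
    rewrite big_seq sumr_ge0// => i iB; rewrite mulr_ge0 ?s0//.
    by have [[/(_ w wA)]] := Ht i iB.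
  rewrite exchange_big/= -[RHS]s1 big_seq [RHS]big_seq.
  by apply: eq_bigr => i /Ht[[_ t1] _]; rewrite -mulr_sumr t1 mulr1.
under [RHS]eq_bigr do rewrite scaler_suml.
rewrite exchange_big/= big_seq [RHS]big_seq; apply: eq_bigr => i /Ht[_ {1}->].
by rewrite scaler_sumr; apply: eq_bigr => w _; rewrite scalerA.
Qed.

Lemma hull_point A w : w \in A -> lattice_hull A (toR R w).
Proof.
move=> wA; exists (fun w' => (w' == w)%:R).
  split=> [//|]; rewrite (big_fsetD1 w)//= eqxx big_seq big1 ?addr0// => i.
  by rewrite !inE => /andP[/negPf->].
rewrite (big_fsetD1 w)//= eqxx scale1r big_seq big1 ?addr0// => i.
by rewrite !inE => /andP[/negPf->]; rewrite scale0r.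
Qed.

Lemma hull_conv A x y (t : R) : lattice_hull A x -> lattice_hull A y ->
  0 <= t <= 1 -> lattice_hull A (t *: x + (1 - t) *: y).
Proof.
move=> Hx Hy /andP[t0 t1].
have := @hull_comb A bool [fset true; false]%fset (fun b => if b then t else 1 - t)
  (fun b => if b then x else y).
have big2 (V : nmodType) (F : bool -> V) :
    \sum_(b <- [fset true; false]%fset) F b = F true + F false.
  rewrite (perm_big [:: true; false]) /=; first by rewrite !big_cons big_nil addr0.
  by apply: uniq_perm => // [|[]]; rewrite ?fset_uniq// !inE.
rewrite big2/=; apply; last by case.
split; last by rewrite big2/= addrC subrK.
by case => _; rewrite ?subr_ge0.
Qed.

End Hull.

Lemma convex_setE (R : realType) (V : lmodType R) (D : set V) :
  convex_set D <-> forall x y (t : R), D x -> D y -> 0 <= t <= 1 ->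
    D (t *: x + (1 - t) *: y).
Proof.
split=> [H x y t Dx Dy /andP[t0 t1]|H x y t Dx Dy].
  have := H x y (Itv01 t0 t1); rewrite !in_setE => /(_ Dx Dy).
  by rewrite /conv/= /unstable.onem.
move: Dx Dy; rewrite !in_setE => Dx Dy.
by apply: H => //; apply/andP; split; [exact: ge0|exact: le1].
Qed.

Section TropicalPolynomial.
Variables (R : realType) (A : {fset 'rV[int]_3}) (c : 'rV[int]_3 -> R).

Lemma trop_ge X w : w \in A -> c w + dot (toR R w) X <= trop_poly A c X.
Proof.
move=> wA; apply: ub_le_sup; last by exists w.
exists (\sum_(w <- A) `|c w + dot (toR R w) X|) => _ [w' /= w'A <-].
by rewrite (big_fsetD1 w')//= -[leLHS]addr0 lerD ?ler_norm ?sumr_ge0.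
Qed.

Lemma trop_le X r : A != fset0 ->
  (forall w, w \in A -> c w + dot (toR R w) X <= r) -> trop_poly A c X <= r.
Proof.
move=> /fset0Pn[w wA] H; apply: ge_sup => [|_ [w' /= w'A <-]]; last exact: H.
by exists (c w + dot (toR R w) X); exists w.
Qed.

Lemma trop_max X : A != fset0 -> exists2 w, w \in A &
  trop_poly A c X = c w + dot (toR R w) X.
Proof.
move=> A0; have [w0 w0A] := fset0Pn _ A0.
pose g (w : A) := c (val w) + dot (toR R (val w)) X.
have [w _ Hw] := @arg_maxP _ _ A [` w0A]%fset xpredT g isT.
exists (val w); first exact: valP.
apply/le_anti; rewrite trop_ge ?andbT; last exact: valP.
by apply: trop_le => // w' w'A; have := Hw [` w'A]%fset isT.
Qed.

(** Legendre duality: the best constant for a minorant with slope [X] is the negative of the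
    tropical polynomial at [X]. *)
Lemma under_trop X eta : A != fset0 ->
  under A (toR R) (fun w => - c w) X eta <-> trop_poly A c X <= - eta.
Proof.
move=> A0; split=> [uX|le].
  by apply: trop_le => // w wA; have := uX w wA; lra.
by move=> w wA; have := le_trans (trop_ge X wA) le; lra.
Qed.

End TropicalPolynomial.

(** * Contact sets and the circuit *)

Section AffineDependence.
Variable R : realType.
Implicit Types B : {fset 'rV[int]_3}.

Lemma circuit_exists B : aff_dependent R B ->
  exists2 B', (B' `<=` B)%fset & is_circuit R B'.
Proof.
have [n] := ubnP #|` B|; elim: n B => // n IH B Bn dB.
have [[B' [pB' dB']]|no] := pselect (exists B', (B' `<` B)%fset /\ aff_dependent R B').
  have [|B2 sB2 cB2] := IH B' _ dB'.
    by apply: leq_trans (fproper_ltn_card pB') _.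
  by exists B2 => //; apply: fsubset_trans sB2 (fproper_sub pB').
exists B; first exact: fsubset_refl.
by split=> // B' pB' dB'; apply: no; exists B'.
Qed.

Lemma aff_dependent_support (A : {fset 'rV[int]_3}) (t : 'rV[int]_3 -> R) :
  (exists2 w, w \in A & t w != 0) -> \sum_(w <- A) t w = 0 ->
  \sum_(w <- A) t w *: toR R w = 0 ->
  aff_dependent R [fset w in A | t w != 0]%fset.
Proof.
move=> [w wA tw] t0 t1; exists t.
have sA : ([fset w in A | t w != 0] `<=` A)%fset.
  by apply/fsubsetP => x; rewrite !inE => /andP[].
have nA x : x \in A -> x \notin [fset w in A | t w != 0]%fset -> t x = 0.
  by move=> xA; rewrite !inE xA negbK => /eqP.
split; first by exists w => //; rewrite !inE wA.
  by rewrite (big_fset_incl _ sA).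
by rewrite (big_fset_incl _ sA) => // x xA nx; rewrite nA ?scale0r.
Qed.

End AffineDependence.

Section LatticePolytope.
Variables (R : realType) (P : set 'rV[R]_3).
Local Notation A := (lattice_points P).
Hypotheses (polyP : lattice_polytope P) (A0 : A != fset0).

(** [fset_set] sends an infinite set to [fset0]; so [A0] guarantees that the set of lattice points
    is finite and that membership has its intended meaning. *)
Lemma latticeP w : reflect (P (toR R w)) (w \in A).
Proof.
have finA : finite_set [set w | P (toR R w)].
  apply: contrapT => inf; case/negP: A0; rewrite /lattice_points /fset_set.
  by case: pselect.
rewrite /lattice_points in_fset_set//.
by apply: (iffP idP); rewrite in_setE.
Qed.

Lemma polytope_bary x : P x -> exists t, bary A (toR R) t x.
Proof.
move: (polyP) => [B PB] Px; have /hullP[t [[t0 t1] ->]] : lattice_hull B x by rewrite -PB.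
have BA : (B `<=` A)%fset.
  by apply/fsubsetP => w wB; apply/latticeP; rewrite PB; exact: hull_point.
exists (fun w => if w \in B then t w else 0); split; first split.
- by move=> w _; case: ifP => // /t0.
- rewrite -(big_fset_incl _ BA) => [|w _ /negPf->//].
  by rewrite -t1 big_seq [RHS]big_seq; apply: eq_bigr => w ->.
- rewrite -[RHS](big_fset_incl _ BA) => [|w _ /negPf->]; last by rewrite scale0r.
  by rewrite big_seq [RHS]big_seq; apply: eq_bigr => w ->.
Qed.

Lemma polytope_comb (I : choiceType) (B : {fset I}) s (x : I -> 'rV[R]_3) :
  convex_weights B s -> (forall i, i \in B -> P (x i)) ->
  P (\sum_(i <- B) s i *: x i).
Proof. by move: polyP => [B' ->]; exact: hull_comb. Qed.

Lemma polytope_conv x y (t : R) : P x -> P y -> 0 <= t <= 1 ->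
  P (t *: x + (1 - t) *: y).
Proof. by move: polyP => [B' ->]; exact: hull_conv. Qed.

Variable c : 'rV[int]_3 -> R.
Local Notation nu := (nu_S P c).
Local Notation height := (fun w => - c w).

Lemma nu_le w : w \in A -> nu (toR R w) <= - c w.
Proof.
move=> wA; have [t bt] := polytope_bary ((latticeP w) wA).
pose d w' : R := (w' == w)%:R.
have -> : - c w = \sum_(w' <- A) d w' * - c w'.
  rewrite (big_fsetD1 w)//= /d eqxx mul1r big_seq big1 ?addr0// => i.
  by rewrite !inE => /andP[/negPf->]; rewrite mul0r.
apply: lower_hull_le; split; first split.
- by move=> i _; rewrite ler0n.
- rewrite (big_fsetD1 w)//= /d eqxx big_seq big1 ?addr0// => i.
  by rewrite !inE => /andP[/negPf->].
- rewrite (big_fsetD1 w)//= /d eqxx scale1r big_seq big1 ?addr0// => i.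
  by rewrite !inE => /andP[/negPf->]; rewrite scale0r.
Qed.

Lemma nu_ge X eta x : under A (toR R) height X eta -> P x -> dot x X + eta <= nu x.
Proof. by move=> uX Px; apply: lower_hull_ge => //; exact: polytope_bary. Qed.

Lemma nu_dual x : P x ->
  exists X eta, under A (toR R) height X eta /\ nu x = dot x X + eta.
Proof.
move=> Px; have [X [eta [uX E]]] := lower_hull_dual height (polytope_bary Px).
by exists X, eta; split.
Qed.

Lemma under_F X : under A (toR R) height X (- F_S P c X).
Proof. by apply/under_trop => //; rewrite opprK. Qed.

Lemma nu_F x X : P x -> dot x X - nu x <= F_S P c X.
Proof. by move=> /(nu_ge (under_F X)); lra. Qed.

Lemma nu_convex x y (t : R) : P x -> P y -> 0 <= t <= 1 ->
  nu (t *: x + (1 - t) *: y) <= t * nu x + (1 - t) * nu y.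
Proof.
move=> Px Py /andP[t0 t1].
have [|X [eta [uX ->]]] := @nu_dual (t *: x + (1 - t) *: y).
  by apply: polytope_conv => //; apply/andP.
have := ler_wpM2l t0 (nu_ge uX Px).
have t1' : 0 <= 1 - t by lra.
have := ler_wpM2l t1' (nu_ge uX Py).
by rewrite dotDl !dotZl; lra.
Qed.

Definition contact X eta := [set x | P x /\ nu x = dot x X + eta].

Lemma contact_convex X eta x y (t : R) : under A (toR R) height X eta ->
  contact X eta x -> contact X eta y -> 0 <= t <= 1 ->
  contact X eta (t *: x + (1 - t) *: y).
Proof.
move=> uX [Px Ex] [Py Ey] t01; have Pz := polytope_conv Px Py t01.
split=> //; apply/le_anti; rewrite nu_ge// andbT.
by have := nu_convex Px Py t01; rewrite Ex Ey dotDl !dotZl; lra.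
Qed.

(** The circuit is characterized through maximal linearity domains, whereas duality produces contact
    sets; Zorn's lemma leads from the latter to the former. *)
Lemma contact_domain X eta : under A (toR R) height X eta ->
  exists2 D, linearity_domain P nu D & contact X eta `<=` D.
Proof.
move=> uX; pose D0 := contact X eta.
pose Q D := [/\ D0 `<=` D \/ D = set0, D `<=` P, convex_set D & affine_on D nu].
have QD0 : Q D0.
  split; [by left|by move=> x []| |].
    by apply/convex_setE => x y t; exact: contact_convex.
  move=> x y t Dx Dy t01; have [_ ->] := contact_convex uX Dx Dy t01.
  by move: Dx Dy => [_ ->] [_ ->]; rewrite dotDl !dotZl; ring.
have [F FQ Ftot|D [QD maxD]] := @Zorn_bigcup _ Q.
  have join x y : (\bigcup_(D in F) D) x -> (\bigcup_(D in F) D) y ->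
      exists2 D, F D & D x /\ D y.
    move=> [D1 FD1 D1x] [D2 FD2 D2y].
    by have [s|s] := Ftot _ _ FD1 FD2; [exists D2 => //; split=> //; exact: s
                                     |exists D1 => //; split=> //; exact: s].
  split.
  - have [[D [FD sD]]|no] := pselect (exists D, F D /\ D0 `<=` D).
      by left=> x /sD Dx; exists D.
    right; apply/seteqP; split=> // x [D FD Dx].
    have [[sD|D0'] _ _ _] := FQ _ FD; last by move: Dx; rewrite D0'.
    by apply: no; exists D.
  - by move=> x [D FD Dx]; have [_ sD _ _] := FQ _ FD; exact: sD.
  - apply/convex_setE => x y t Ux Uy t01; have [D FD [Dx Dy]] := join _ _ Ux Uy.
    by have [_ _ /convex_setE cD _] := FQ _ FD; exists D => //; exact: cD.
  - move=> x y t Ux Uy t01; have [D FD [Dx Dy]] := join _ _ Ux Uy.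
    by have [_ _ _ aD] := FQ _ FD; exact: aD.
have maxD' D' : D `<=` D' -> Q D' -> D' = D.
  move=> sD QD'; apply: contrapT => ne; apply: (maxD D') => //.
  by split=> // sD'; apply: ne; apply/seteqP.
have sD0 : D0 `<=` D.
  have [[//|D00] _ _ _] := QD.
  by have := maxD' D0; rewrite D00 => <-.
exists D => //; have [_ DP cD aD] := QD; split=> // D' sD D'P cD' aD'.
by apply: maxD' => //; split=> //; left; exact: subset_trans sD.
Qed.

Hypothesis circC : is_the_circuit P c circuit_C.

Lemma circuit_sub : (circuit_C `<=` A)%fset.
Proof. by have [_ /(_ erefl)[]] := circC circuit_C. Qed.

Lemma circuit_A : [/\ vE \in A, vF \in A, vG \in A & vC \in A].
Proof.
by have [? ? ? ?] := circuit_mem; split; apply: (fsubsetP circuit_sub).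
Qed.

(** A minimal dependent subset of [B] is a circuit of the subdivision, and there is only one. *)
Lemma contact_circuit X eta B : under A (toR R) height X eta -> (B `<=` A)%fset ->
  (forall w, w \in B -> nu (toR R w) = dot (toR R w) X + eta) ->
  aff_dependent R B -> (circuit_C `<=` B)%fset.
Proof.
move=> uX BA HB /circuit_exists[B' sB' cB'].
have [D lD sD] := contact_domain uX.
suff /circC <- : circuit_of P c B' by [].
split=> //; first exact: fsubset_trans sB' BA.
exists D => // w wB'; have wB := fsubsetP sB' _ wB'.
apply: sD; split; last exact: HB.
by apply/latticeP; exact: (fsubsetP BA).
Qed.

(** Subtracting the multiple of [theta] that cancels [t vE] leaves a dependence in the same contact
    set whose support misses [vE]. This support cannot contain the circuit, so the difference is
    zero. *)
Lemma contact_theta X eta (t : 'rV[int]_3 -> R) : under A (toR R) height X eta ->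
  (forall w, w \in A -> t w != 0 -> nu (toR R w) = dot (toR R w) X + eta) ->
  \sum_(w <- A) t w = 0 -> \sum_(w <- A) t w *: toR R w = 0 ->
  forall w, w \in A -> t w = t vE * (theta w)%:~R.
Proof.
move=> uX Ht t0 t1 w wA; apply/eqP; rewrite -subr_eq0; apply/negPn/negP => tw.
pose t' w := t w - t vE * (theta w)%:~R.
have nz : exists2 w, w \in A & t w != 0.
  have [tw0|nw] := eqVneq (t w) 0; last by exists w.
  have [tE|nE] := eqVneq (t vE) 0; last by exists vE => //; have [] := circuit_A.
  by move: tw; rewrite tw0 tE mul0r subr0 eqxx.
have supp (s : 'rV[int]_3 -> R) :
    (forall w, w \in A -> s w != 0 -> nu (toR R w) = dot (toR R w) X + eta) ->
    aff_dependent R [fset w in A | s w != 0]%fset ->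
    (circuit_C `<=` [fset w in A | s w != 0])%fset.
  move=> Hs; apply: (contact_circuit uX).
    by apply/fsubsetP => x; rewrite !inE => /andP[].
  by move=> x; rewrite !inE => /andP[]; exact: Hs.
(* The support of [t] contains the circuit, so [theta] lives in the contact set as well. *)
have C1 := supp t Ht (aff_dependent_support nz t0 t1).
have cn w' : w' \in circuit_C -> t w' != 0.
  by move=> /(fsubsetP C1); rewrite !inE => /andP[].
have := supp t'; apply/not_implyP; split.
  move=> w' w'A; have [w'C _|w'C] := boolP (w' \in circuit_C).
    by apply: Ht => //; exact: cn.
  by rewrite /t' theta0// mulr0 subr0; exact: Ht.
apply/not_implyP; split.
  apply: aff_dependent_support; first by exists w.
    rewrite sumrB t0 -mulr_sumr; under eq_bigr do rewrite -[_%:~R]mulr1.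
    by rewrite (theta_sum (fun=> 1)) ?circuit_sub//; ring.
  under eq_bigr do rewrite scalerBl -scalerA.
  rewrite sumrB t1 -scaler_sumr sub0r.
  suff -> : \sum_(w <- A) (theta w)%:~R *: toR R w = 0 by rewrite scaler0 oppr0.
  have co j : (\sum_(w <- A) (theta w)%:~R *: toR R w) 0 j =
      \sum_(w <- A) (theta w)%:~R * (w 0 j)%:~R.
    by rewrite summxE; apply: eq_bigr => w' _; rewrite !mxE.
  by apply: row3P; rewrite co theta_sum ?circuit_sub// !zvecE mxE; ring.
move=> /fsubsetP/(_ vE); have [-> _ _ _] := circuit_mem => /(_ isT).
by rewrite !inE /t' theta_val mulr1 subrr eqxx andbF.
Qed.

Section Heights.
Variables (B : {fset 'rV[int]_3}) (b : 'rV[int]_3 -> R) (k : R).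
Hypotheses (BA : (B `<=` A)%fset) (B0 : B != fset0).
Hypothesis trop_B : forall X, trop_poly B b X = F_S P c X + k.

Lemma nu_le_height w : w \in B -> nu (toR R w) <= k - b w.
Proof.
move=> wB; have wA := fsubsetP BA _ wB.
have [X [eta [uX ->]]] := nu_dual ((latticeP w) wA).
have := trop_ge b X wB; rewrite trop_B.
by have /under_trop := uX => /(_ A0); rewrite /F_S; lra.
Qed.

(* Another representation of w as a convex combination of B would be an affine
   dependence in the contact set with its only negative coefficient at w. *)
Lemma nu_height w : w \in A -> w != vC -> w \in B /\ nu (toR R w) = k - b w.
Proof.
move=> wA wC; have Pw := (latticeP w) wA.
have [|t [[t0 t1] tw] tle] :=
    @weights_below R _ B (toR R) (fun w => k - b w) (toR R w) (nu (toR R w)).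
  move=> X eta uX; apply: nu_ge => //; apply/under_trop => //.
  suff : trop_poly B b X <= k - eta by rewrite trop_B /F_S; lra.
  by apply: trop_le => // w' /uX; lra.
have [X [eta [uX Ew]]] := nu_dual Pw.
have gap w' : w' \in B -> 0 <= k - b w' - (dot (toR R w') X + eta).
  move=> w'B; rewrite subr_ge0 (le_trans _ (nu_le_height w'B))// nu_ge//.
  by apply/latticeP; exact: (fsubsetP BA).
(* Complementary slackness: the weighted gaps are nonnegative with sum at most 0, so the minorant is
   tight wherever [t] is nonzero. *)
have gap0 : \sum_(w' <- B) t w' * (k - b w' - (dot (toR R w') X + eta)) <= 0.
  under eq_bigr do rewrite mulrBr.
  rewrite sumrB; under [X in _ - X]eq_bigr do rewrite mulrDr.
  rewrite big_split/= -mulr_suml t1 mul1r -dot_comb -tw.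
  by move: tle; rewrite Ew; lra.
have tight w' : w' \in B -> t w' != 0 -> k - b w' = dot (toR R w') X + eta.
  move=> w'B tn; have := gap w' w'B; rewrite le_eqVlt => /predU1P[|g0]; first lra.
  exfalso; move: gap0; rewrite leNgt => /negP; apply.
  rewrite (big_fsetD1 w')//= ltr_pwDl ?mulr_gt0// ?lt_def ?tn ?t0//.
  by rewrite big_seq sumr_ge0// => i; rewrite !inE => /andP[_ iB]; rewrite mulr_ge0 ?t0 ?gap.
have tight' w' : w' \in B -> t w' != 0 -> nu (toR R w') = k - b w'.
  move=> w'B tn; apply/le_anti; rewrite nu_le_height// tight// nu_ge//.
  by apply/latticeP; exact: (fsubsetP BA).
pose t' w' : R := if w' \in B then t w' else 0.
have t'0 w' : 0 <= t' w' by rewrite /t'; case: ifP => // /t0.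
have Bsum (V : lmodType R) (F : 'rV[int]_3 -> V) :
    \sum_(w' <- A) t' w' *: F w' = \sum_(w' <- B) t w' *: F w'.
  rewrite -(big_fset_incl _ BA) => [|w' _ /negPf n]; last by rewrite /t' n scale0r.
  by rewrite big_seq [RHS]big_seq; apply: eq_bigr => w' w'B; rewrite /t' w'B.
pose d w' : R := t' w' - (w' == w)%:R.
have dsum (V : lmodType R) (F : 'rV[int]_3 -> V) :
    \sum_(w' <- A) d w' *: F w' = \sum_(w' <- B) t w' *: F w' - F w.
  under eq_bigr do rewrite scalerBl.
  rewrite sumrB Bsum; congr (_ - _).
  rewrite (big_fsetD1 w wA)/= eqxx scale1r big_seq big1 ?addr0// => i.
  by rewrite !inE => /andP[/negPf->]; rewrite scale0r.
have dE : forall w', w' \in A -> d w' = d vE * (theta w')%:~R.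
  apply: (contact_theta uX).
  - move=> w' w'A; rewrite /d; have [->|_] := eqVneq w' w; first by rewrite Ew.
    rewrite subr0 /t'; case: ifP => [w'B tn|_]; last by rewrite eqxx.
    by rewrite tight'// tight.
  - have := dsum R^o (fun=> 1); under eq_bigr do rewrite /GRing.scale/= mulr1.
    by move=> ->; under eq_bigr do rewrite /GRing.scale/= mulr1; rewrite t1 subrr.
  - by rewrite dsum -tw subrr.
have [EA FA GA CA] := circuit_A.
have tE w' : w' \in A -> t' w' = (w' == w)%:R + d vE * (theta w')%:~R.
  by move=> w'A; rewrite -dE// /d addrC subrK.
(* Since [w] is not [vC], the weight of [vC] is [-3 * d vE]. If [w] lies on the circuit, another
   vertex has weight [d vE], which forces [d vE = 0]; otherwise [theta w = 0]. In both cases [w]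
   itself has weight 1. *)
have r0 : d vE <= 0.
  by have := t'0 vC; rewrite tE// eq_sym (negPf wC) theta_val add0r rmorphN/=; lra.
have tw1 : t' w = 1.
  rewrite tE// eqxx; suff : d vE * (theta w)%:~R = 0 by move=> ->; rewrite addr0.
  have [wc|/theta0->] := boolP (w \in circuit_C); last by rewrite mulr0.
  suff -> : d vE = 0 by rewrite mul0r.
  apply/le_anti; rewrite r0/=; move: wc; rewrite circuitE (negPf wC) orbF => /or3P[]/eqP wE.
  - by have := t'0 vF; rewrite tE// wE eq_sym circuit_distinct theta_val add0r mulr1.
  - by have := t'0 vE; rewrite {1}tE// wE circuit_distinct theta_val add0r mulr1.
  - by have := t'0 vE; rewrite {1}tE// wE circuit_distinct theta_val add0r mulr1.
have wB : w \in B.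
  by move: tw1; rewrite /t'; case: ifP => // _ /eqP; rewrite eq_sym oner_eq0.
by split=> //; apply: tight' => //; move: tw1; rewrite /t' wB => ->; rewrite oner_eq0.
Qed.

End Heights.

(** The point [vC] is left out because [- c vC] may lie strictly above the hull. *)
Lemma nu_coef w : w \in A -> w != vC -> nu (toR R w) = - c w.
Proof.
move=> wA wC; have [|_ ->] := @nu_height A c 0 (fsubset_refl _) A0 _ w wA wC.
  by move=> X; rewrite addr0.
by rewrite sub0r.
Qed.

End LatticePolytope.

(** * Orders of Puiseux series *)

Lemma prod3 (S : pzRingType) (F : 'I_3 -> S) : \prod_j F j = F 0 * F 1 * F 2.
Proof.
rewrite !big_ord_recl big_ord0 mulr1 mulrA.
by congr (_ * F _ * F _); apply: val_inj.
Qed.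

Lemma mulr_intACA (S : comPzRingType) (x m r : S) (n : int) :
  x * n%:~R * (m * r) = (x * m) *~ n * r.
Proof. by rewrite -[in RHS]mulrzr; ring. Qed.

Section PuiseuxOrder.
Variable R : realType.
Local Notation K := (puiseux R).
Implicit Types (a b : K) (r s : rat) (p : 'rV[K]_3) (w : 'rV[int]_3).

Definition coef_at r a : R[i] := pcoef a r.

Lemma coef_at_zmod r : zmod_morphism (coef_at r).
Proof. by []. Qed.

HB.instance Definition _ r :=
  GRing.isZmodMorphism.Build K R[i] (coef_at r) (coef_at_zmod r).

Definition order_ge r a := forall s, s < r -> coef_at s a = 0.

Definition has_order a r := order_ge r a /\ coef_at r a != 0.

Lemma has_order_neq0 a r : has_order a r -> a != 0.
Proof. by move=> [_]; apply: contraNneq => ->; rewrite raddf0. Qed.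

Lemma order_exists a : a != 0 -> exists r, has_order a r.
Proof.
move=> a0; have [m [n [m0 sa _]]] := pcoefP a.
have [r0 ar0] : exists r, pcoef a r != 0.
  apply: contrapT => no; move/negP: a0; apply; apply/eqP/val_inj/funext => r /=.
  by apply/eqP/negPn/negP => ar; apply: no; exists r.
have [k0 E0] := sa _ ar0.
have ex : exists k, pcoef a (pexp m n k) != 0 by exists k0; rewrite -E0.
exists (pexp m n (ex_minn ex)); case: ex_minnP => k ak kmin; split=> // s sk.
apply/eqP/negPn/negP => as0; have [j Ej] := sa _ as0.
move: sk; rewrite Ej; apply/negP; rewrite -leNgt /pexp ler_pM2r ?invr_gt0 ?ltr0n//.
by rewrite ler_int lerD2l lez_nat; apply: kmin; rewrite -Ej.
Qed.

Lemma Val_order a r : has_order a r -> Val a = - ratr r.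
Proof.
move=> [lo ar]; rewrite /Val; case: xgetP => [r' _ [ar' r'min]|no].
  suff -> : r = r' by [].
  apply/le_anti; rewrite r'min// andbT leNgt; apply/negP => lt.
  by move/eqP: ar'; apply; exact: lo.
exfalso; apply: (no r); split=> // s; apply: contraNT; rewrite -ltNge => /lo as0.
by apply/eqP; exact: as0.
Qed.

Lemma coef_mul_low a b r s : order_ge r a -> order_ge s b ->
  order_ge (r + s) (a * b) /\
  coef_at (r + s) (a * b) = coef_at r a * coef_at s b.
Proof.
move=> la lb; split=> [u us|].
  rewrite /coef_at [LHS]/(puiseux_mul _ _ _); apply: fsbig1 => x _.
  have [xr|rx] := ltP x r; first by rewrite [pcoef a x]la// mul0r.
  by rewrite [pcoef b _]lb ?mulr0// ltrBlDl (lt_le_trans us)// lerD2r.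
rewrite /coef_at [LHS]/(puiseux_mul _ _ _).
rewrite (@fsbigE _ _ _ _ _ [:: r]) //.
  under eq_bigl do rewrite in_setT.
  by rewrite big_seq1 addrC addKr.
move=> x _; rewrite inE => xr.
have [xr'|rx] := ltP x r; first by rewrite [pcoef a x]la// mul0r.
rewrite [pcoef b _]lb ?mulr0// ltrBlDl ltrD2r lt_def eq_sym rx andbT.
by rewrite eq_sym.
Qed.

Lemma has_orderM a b r s : has_order a r -> has_order b s ->
  has_order (a * b) (r + s).
Proof.
move=> [la ar] [lb bs]; have [lab E] := coef_mul_low la lb.
by split=> //; rewrite E mulf_neq0.
Qed.

Lemma has_order_inj a r s : has_order a r -> has_order a s -> r = s.
Proof.
move=> [la ar] [lb bs]; apply/le_anti/andP; split; rewrite leNgt; apply/negP => lt.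
  by move/eqP: bs; apply; exact: la.
by move/eqP: ar; apply; exact: lb.
Qed.

Lemma monom_subproof r : (fun s => (s == r)%:R : R[i]) \in @puiseux_pred R.
Proof.
apply: (@puiseux_of_prep R (absz (denq r)) (numq r)); split.
- by rewrite absz_gt0 denq_neq0.
- move=> s /=; have [-> _|_] := eqVneq s r; last by rewrite eqxx.
  by exists 0%N; rewrite /pexp addr0 natr_absz ger0_norm ?denq_ge0// divq_num_den.
- exists 1, 1; split=> // k /=; rewrite expr1n mulr1.
  by case: eqP => _; rewrite ?nrm0 ?ler01// Normc.normc1.
Qed.

Definition monom r : K := Puiseux (monom_subproof r).

Lemma coef_monom r s : coef_at s (monom r) = (s == r)%:R.
Proof. by []. Qed.

Lemma order_ge_monom r s : s <= r -> order_ge s (monom r).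
Proof.
move=> sr u us; rewrite coef_monom (_ : (u == r) = false)//.
by rewrite lt_eqF// (lt_le_trans us).
Qed.

Lemma has_order_monom r : has_order (monom r) r.
Proof. by split; [exact: order_ge_monom|rewrite coef_monom eqxx oner_eq0]. Qed.

Lemma monom0 : monom 0 = 1.
Proof. exact: val_inj. Qed.

Lemma has_order1 : has_order 1 0.
Proof. by rewrite -monom0; exact: has_order_monom. Qed.

Lemma monom_neq0 r : monom r != 0.
Proof. exact: has_order_neq0 (has_order_monom r). Qed.

Lemma has_orderV a r : has_order a r -> has_order a^-1 (- r).
Proof.
move=> ar; have a0 := has_order_neq0 ar.
have [|s as0] := @order_exists a^-1; first by rewrite invr_eq0.
have := has_orderM ar as0; rewrite mulfV// => /has_order_inj/(_ has_order1) rs.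
by rewrite (_ : - r = s)//; apply/eqP; rewrite eq_sym -addr_eq0 addrC rs.
Qed.

Lemma has_orderXz a r (n : int) : has_order a r -> has_order (a ^ n) (r * n%:~R).
Proof.
move=> ar; have H m : has_order (a ^+ m) (r * m%:R).
  elim: m => [|m IH]; first by rewrite mulr0; exact: has_order1.
  by rewrite exprSr -natr1 mulrDr mulr1; exact: has_orderM.
case: n => n; first by exact: H.
by rewrite NegzE -invr_expz rmorphN mulrN; apply: has_orderV; exact: H.
Qed.

Lemma ValM a b : a != 0 -> b != 0 -> Val (a * b) = Val a + Val b.
Proof.
move=> /order_exists[r ar] /order_exists[s bs].
by rewrite (Val_order ar) (Val_order bs) (Val_order (has_orderM ar bs)) rmorphD opprD.
Qed.

Lemma ValXz a (n : int) : a != 0 -> Val (a ^ n) = n%:~R * Val a.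
Proof.
move=> /order_exists[r ar].
by rewrite (Val_order ar) (Val_order (has_orderXz n ar)) rmorphM /= ratr_int mulrN mulrC.
Qed.

Definition mono (p : 'rV[K]_3) (w : 'rV[int]_3) : K := \prod_j p 0 j ^ w 0 j.

Lemma mono3 p w : mono p w = p 0 0 ^ w 0 0 * p 0 1 ^ w 0 1 * p 0 2 ^ w 0 2.
Proof.
exact: prod3.
Qed.

Lemma mono_neq0 p w : (forall j, p 0 j != 0) -> mono p w != 0.
Proof. by move=> p0; rewrite mono3 !mulf_neq0// expfz_neq0. Qed.

Lemma Val_mono p w : (forall j, p 0 j != 0) ->
  Val (mono p w) = dot (toR R w) (Val_point p).
Proof.
by move=> p0; rewrite mono3 dot3 !ValM ?mulf_neq0 ?expfz_neq0// !ValXz// !mxE.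
Qed.

(** Multiplying the i-th partial derivative by the i-th coordinate of [p] makes all conditions
    linear in the terms [f w * mono p w], with the entries of the lattice points as coefficients. *)
Lemma singular_pointP (P : set 'rV[R]_3) f p : (forall j, p 0 j != 0) ->
  singular_point P f p <->
  \sum_(w <- lattice_points P) f w * mono p w = 0 /\
  forall i, \sum_(w <- lattice_points P) (f w * mono p w) *~ w 0 i = 0.
Proof.
move=> p0; have part i : lpartial P i f p =
    (\sum_(w <- lattice_points P) (f w * mono p w) *~ w 0 i) * (p 0 i)^-1.
  rewrite mulr_suml; apply: eq_bigr => w _.
  have -> : \prod_j p 0 j ^ (w 0 j - (j == i)%:Z) = mono p w * (p 0 i)^-1.
    under eq_bigr => j _ do rewrite expfzDr//.
    rewrite big_split/= -/(mono p w); congr (_ * _).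
    rewrite (bigD1 i)//= eqxx big1 ?mulr1// => j /negPf->.
    by rewrite oppr0 expr0z.
  exact: mulr_intACA.
split=> [[_ H0 H1]|[H0 H1]]; split=> // i; last by rewrite part H1 mul0r.
by have /eqP := H1 i; rewrite part mulf_eq0 invr_eq0 (negPf (p0 i)) orbF => /eqP.
Qed.

End PuiseuxOrder.

(** * Consequences of a singular point for the heights *)

Section SingularPoints.
Variables (R : realType) (P : set 'rV[R]_3).
Local Notation A := (lattice_points P).
Hypotheses (polyP : lattice_polytope P) (A0 : A != fset0).
Variable c : 'rV[int]_3 -> R.
Local Notation nu := (nu_S P c).

(** Otherwise no combination of differences could reach [zvec 0 0 1]. This makes the minimum over
    the nonzero levels a minimum over a nonempty set. *)
Lemma nonzero_level : differences_generate P ->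
  exists2 w, w \in A & zcoord w != 0.
Proof.
move=> genP; apply: contrapT => no.
have z0 w : w \in A -> zcoord w = 0.
  by move=> wA; apply/eqP/negPn/negP => zw; apply: no; exists w.
have [n] := genP (zvec 0 0 1).
move=> /(congr1 (fun u : 'rV[int]_3 => u 0 2)); rewrite zvecE summxE big_seq big1 //.
move=> w wA; rewrite summxE big_seq big1 // => w' w'A.
by rewrite -scaler_int !mxE -!/(zcoord _) !z0// subrr mulr0.
Qed.

Lemma trop_support f : Sing P f -> tropicalizes_to P c f -> exists k : R,
  [/\ [fset w in A | f w != 0]%fset != fset0,
      ([fset w in A | f w != 0] `<=` A)%fset
    & forall X, trop_poly [fset w in A | f w != 0]%fset (fun w => Val (f w)) X
                = F_S P c X + k].
Proof.
move=> [[w fw] supp _] [k H]; exists k; split=> //.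
  by apply/fset0Pn; exists w; rewrite !inE fw supp.
by apply/fsubsetP => x; rewrite !inE => /andP[].
Qed.

Hypothesis circC : is_the_circuit P c circuit_C.

Section Necessity.
Variables (f : 'rV[int]_3 -> puiseux R) (p : 'rV[puiseux R]_3).
Hypotheses (Sf : Sing P f) (tf : tropicalizes_to P c f) (sp : singular_point P f p).
Variables (l : 'rV[R]_3) (k : R).
Hypotheses (lz : zcoord l = 0) (Hl : forall x, lattice_hull circuit_C x ->
  nu x = Lambda1 l k x).
Let y := Val_point p.
Let u w := nu (toR R w) - dot (toR R w) y + F_S P c y.
Let a w := f w * mono p w.

Let p0 j : p 0 j != 0.
Proof. by have [] := sp. Qed.

Let Va w : f w != 0 -> Val (a w) = Val (f w) + dot (toR R w) y.
Proof. by move=> fw; rewrite ValM ?mono_neq0// Val_mono. Qed.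

Lemma singular_point_gap :
  [/\ y = l + y 0 2 *: delta_mx 0 2,
      forall w, w \in circuit_C -> u w = 0,
      forall w, w \in A -> w \notin circuit_C -> 0 < u w
    & differences_generate P -> exists w1 w2,
        [/\ w1 \in A, w2 \in A, w1 != w2, zcoord w1 != 0 & zcoord w2 != 0] /\
        u w2 = u w1 /\ forall w, w \in A -> zcoord w != 0 -> u w1 <= u w].
Proof.
have [k0 [B0 BA tB]] := trop_support Sf tf.
have fB w : (w \in [fset w in A | f w != 0]%fset) = (w \in A) && (f w != 0).
  by rewrite !inE.
have hgt w : w \in A -> w != vC -> f w != 0 /\ nu (toR R w) = k0 - Val (f w).
  move=> wA wC; have [+ ->] := nu_height polyP A0 circC BA B0 tB wA wC.
  by rewrite fB => /andP[_].
(* [w0] is a dominant term at [y]: its order [r0] is the smallest order among all terms, and [al]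
   will collect the coefficients of [t^r0]. *)
have [w0 w0B] := trop_max (fun w => Val (f w)) y B0.
move: w0B; rewrite tB fB => /andP[w0A fw0]; rewrite -Va// => maxE.
have a_neq0 w : f w != 0 -> a w != 0 by move=> fw; rewrite mulf_neq0 ?mono_neq0.
have [r0 r0w0] := order_exists (a_neq0 _ fw0).
rewrite (Val_order r0w0) in maxE.
have low w : w \in A -> order_ge r0 (a w).
  move=> wA; have [fw|/a_neq0/order_exists[r ar]] := eqVneq (f w) 0.
    by move=> r _; rewrite /a fw mul0r raddf0.
  have [la ar0] := ar; have aw0 := has_order_neq0 ar.
  have fw : f w != 0 by apply: contraNneq aw0 => fw; rewrite /a fw mul0r.
  have := trop_ge (fun w => Val (f w)) y (A := [fset w in A | f w != 0]%fset) (w := w).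
  rewrite fB wA fw => /(_ isT); rewrite tB maxE -Va// (Val_order ar) lerN2 ler_rat.
  by move=> r0r s sr0; apply: la; exact: lt_le_trans r0r.
pose al w := coef_at r0 (a w).
have alP w : w \in A -> al w != 0 -> f w != 0 /\ Val (a w) = F_S P c y + k0.
  move=> wA aw; split.
    by apply: contraNneq aw => fw; rewrite /al /a fw mul0r raddf0.
  by rewrite maxE; apply: Val_order; split => //; exact: low.
have al_nu w : w \in A -> al w != 0 -> nu (toR R w) = dot (toR R w) y - F_S P c y.
  move=> wA /(alP _ wA)[fw]; rewrite Va// => E.
  have := nu_F polyP A0 c y (elimT (latticeP A0 w) wA).
  have := nu_le_height polyP A0 BA tB (w := w).
  by rewrite fB wA fw => /(_ isT); move: E; lra.
have [/(_ sp) [S0 S1] _] := singular_pointP P f p0.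
have al0 : \sum_(w <- A) al w = 0 by rewrite -raddf_sum S0 raddf0.
have al1 i : \sum_(w <- A) al w *~ w 0 i = 0.
  rewrite -[RHS](raddf0 (coef_at r0)) -(S1 i) raddf_sum.
  by apply: eq_bigr => w _; rewrite raddfMz.
(* Affine dependences are controlled over the reals only, so the complex relation is tested on its
   real and imaginary parts. *)
have part (g : {additive R[i] -> R}) w : w \in A -> g (al w) = g (al vE) * (theta w)%:~R.
  apply: (contact_theta polyP A0 circC (under_F A0 c y) (t := fun w => g (al w))).
  - move=> w' w'A gw; apply: al_nu => //.
    by apply: contraNneq gw => ->; rewrite raddf0.
  - by rewrite -raddf_sum al0 raddf0.
  - apply/rowP => i; rewrite summxE mxE -[RHS](raddf0 g) -(al1 i) raddf_sum.
    by apply: eq_bigr => w' _; rewrite !mxE raddfMz mulrzr.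
have alE w : w \in A -> al w = al vE *~ theta w.
  move=> wA; have ext (z1 z2 : R[i]) : complex.Re z1 = complex.Re z2 ->
      complex.Im z1 = complex.Im z2 -> z1 = z2.
    by case: z1 => ? ?; case: z2 => ? ? /= -> ->.
  by apply: ext; rewrite raddfMz -mulrzr part.
have alw0 : al w0 != 0 by have [] := r0w0.
have alvE : al vE != 0.
  by apply: contraNneq alw0 => E; rewrite alE// E mul0rz.
have CA := fsubsetP (circuit_sub circC).
have uC w : w \in circuit_C -> u w = 0.
  move=> wC; rewrite /u al_nu ?CA//; first by ring.
  rewrite alE ?CA// -mulrzr mulf_neq0// intr_eq0.
  by move: wC; rewrite circuitE => /or4P[]/eqP->; rewrite theta_val.
(* If [u w = 0] off the circuit, then [a w] has order exactly [r0], so [al w] is nonzero although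
   [theta w = 0]. *)
have u0 w : w \in A -> w \notin circuit_C -> 0 < u w.
  move=> wA wC; have := nu_F polyP A0 c y (elimT (latticeP A0 w) wA).
  rewrite -subr_ge0 => ge; rewrite lt_def; apply/andP; split; last by rewrite /u; lra.
  apply/eqP => u0; have wvC : w != vC.
    by apply: contraNneq wC => ->; have [] := circuit_mem.
  have [fw nuE] := hgt w wA wvC.
  have [r ar] := order_exists (a_neq0 _ fw).
  have rr0 : r = r0.
    apply: (fmorph_inj (@ratr R)); have := Val_order ar; rewrite Va// => E.
    by move: u0; rewrite /u nuE; lra.
  by have := alE w wA; rewrite theta0// mulr0z => E; have [_] := ar; rewrite rr0 -/(al w) E eqxx.
have onC w : w \in circuit_C -> dot (toR R w) y - F_S P c y = dot l (toR R w) + k.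
  by move=> wC; have := uC w wC; rewrite /u (Hl (hull_point R wC)) /Lambda1; lra.
have [EC FC GC CC] := circuit_mem.
(* The points [vE], [vF], [vC] affinely span the plane [z = 0] and so determine the first two
   coordinates of [y]. *)
have yE : y = l + y 0 2 *: delta_mx 0 2.
  move: lz (onC _ EC) (onC _ FC) (onC _ CC).
  rewrite /zcoord !dot3 !mxE => l2 HE HF HC.
  by apply: row3P; rewrite !mxE /=; lra.
split=> // genP.
have [w3 w3A w3z] := nonzero_level genP.
pose Z := [fset w in A | zcoord w != 0]%fset.
have ZP w : (w \in Z) = (w \in A) && (zcoord w != 0) by rewrite !inE.
have w3Z : w3 \in Z by rewrite ZP w3A.
have [w1' _ Hw1] := @arg_minP _ _ Z [` w3Z]%fset xpredT (fun w => u (val w)) isT.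
have := valP w1'; set w1 := val w1' in Hw1 *; rewrite ZP => /andP[w1A w1z].
have min1 w : w \in A -> zcoord w != 0 -> u w1 <= u w.
  by move=> wA wz; have wZ : w \in Z by [rewrite ZP wA]; exact: (Hw1 [` wZ]%fset).
exists w1; apply: contrapT => no.
have offC w : zcoord w != 0 -> w != vC.
  by apply: contraNneq => ->; rewrite /zcoord zvecE.
have Vu w : w \in A -> zcoord w != 0 -> f w != 0 /\ Val (a w) = F_S P c y + k0 - u w.
  move=> wA wz; have [fw nuE] := hgt w wA (offC w wz); split=> //.
  by rewrite Va// /u nuE; ring.
have [fw1 V1] := Vu w1 w1A w1z.
have [r ar] := order_exists (a_neq0 _ fw1).
(* Without a second minimizer, every other term of the z-equation has level 0 or an order larger
   than [r], so nothing cancels the leading term of [a w1]. *)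
have : coef_at r (\sum_(w <- A) (a w) *~ w 0 2) = 0 by rewrite S1 raddf0.
rewrite raddf_sum (big_fsetD1 w1)//= big_seq big1 => [|w].
  rewrite addr0 raddfMz -mulrzr => /eqP; rewrite mulf_eq0 intr_eq0.
  by have [_ /negPf->] := ar; rewrite orFb (negPf w1z).
rewrite !inE => /andP[ww1 wA]; rewrite raddfMz.
have [wz|wz] := eqVneq (w 0 2) 0; first by rewrite wz mulr0z.
have [fw V] := Vu w wA wz.
have [s bs] := order_exists (a_neq0 _ fw).
transitivity (0 *~ w 0 2 : R[i]); last exact: mul0rz.
congr (_ *~ _); apply: (proj1 bs).
rewrite -(ltr_rat R); move: V V1; rewrite (Val_order ar) (Val_order bs) => V V1.
suff : u w1 < u w by lra.
rewrite lt_def min1// andbT; apply/eqP => uw; apply: no.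
by exists w; split=> //; split; rewrite // eq_sym.
Qed.

End Necessity.

End SingularPoints.

(** * Lattice points in tetrahedra over the circuit *)

Section Tetrahedron.

(* In the basis f - c, g - c of the plane z = 0, the apex lies over (al, be) at
   height m; (i, j) is a lattice point of the slice at height h of the tetrahedron
   over the triangle e f g with this apex. *)
Lemma level_point_int (m al be : int) : 1 < m -> m != 3 ->
  exists h i j : int, let D1 := m * i - h * al in let D2 := m * j - h * be in
  [/\ 0 < h < m, D1 + D2 <= m - h, D2 - 2 * D1 <= m - h & D1 - 2 * D2 <= m - h].
Proof.
move=> m1 m3; have m0 : m != 0 by lia.
(* Up to a lattice shear the apex lies over [(a, b)] with both entries in [[0, m)]; at height 1 the
   four lattice points around [(al / m, be / m)] are tried. *)
have [Ea Eb] := (divz_eq al m, divz_eq be m).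
have := modz_ge0 al m0; have := modz_ge0 be m0.
have m0' : 0 < m by lia.
have := ltz_pmod al m0'; have := ltz_pmod be m0'.
move: Ea Eb; set a := (al %% m)%Z; set b := (be %% m)%Z.
set a' := (al %/ m)%Z; set b' := (be %/ m)%Z => -> -> bm am b0 a0.
have [H|H1] := leP (m + 1) (a + b).
  by exists 1, (a' + 1), (b' + 1); split; lia.
have [H|H2] := boolP ((2 * b - a <= m - 1) && (2 * a - b <= m - 1)).
  by exists 1, a', b'; move/andP: H => [? ?]; split; lia.
have [H|H3] := boolP ((2 * b + 1 <= a) && (1 <= a + b)).
  by exists 1, (a' + 1), b'; move/andP: H => [? ?]; split; lia.
have [H|H4] := boolP ((2 * a + 1 <= b) && (1 <= a + b)).
  by exists 1, a', (b' + 1); move/andP: H => [? ?]; split; lia.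
(* In the two exceptional families [m] is a multiple of 3, and the slice three levels below the apex
   contains a lattice point. For [m = 3] this slice would be the plane of the circuit, which is why
   that level is excluded. *)
have [[aE mE]|[bE mE]] : (a = 2 * b /\ m = 3 * b) \/ (b = 2 * a /\ m = 3 * a) by lia.
  exists (m - 3), (a' * m + a - 2 - 3 * a'), (b' * m + b - 1 - 3 * b').
  by rewrite aE mE; split; lia.
exists (m - 3), (a' * m + a - 1 - 3 * a'), (b' * m + b - 2 - 3 * b').
by rewrite bE mE; split; lia.
Qed.

Lemma level_point (R : realType) (w : 'rV[int]_3) :
  1 < `|zcoord w| -> `|zcoord w| != 3 -> exists q (tE tF tG tw : R),
  [/\ zcoord q != 0, [/\ 0 <= tE, 0 <= tF, 0 <= tG & 0 <= tw < 1],
      tE + tF + tG + tw = 1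
    & toR R q = tE *: toR R vE + tF *: toR R vF + tG *: toR R vG + tw *: toR R w].
Proof.
(* [al] and [be] are the coordinates of the projection of [w - vC] to the plane [z = 0] in the basis
   [vF - vC], [vG - vC]. *)
move=> m1 m3; pose al := w 0 0 + w 0 1 - 2; pose be := w 0 1 - 1.
have [h [i [j /= [/andP[h0 hm] H1 H2 H3]]]] := level_point_int al be m1 m3.
set m := `|zcoord w| in m1 m3 hm H1 H2 H3.
pose sg : int := if 0 <= zcoord w then 1 else -1.
have zE : zcoord w = sg * m by rewrite /sg /m; case: ifP; lia.
set D1 := m * i - h * al in H1 H2 H3; set D2 := m * j - h * be in H1 H2 H3.
pose M : R := m%:~R.
have M0 : 0 < M by rewrite ltr0z; lia.
have Mn : M != 0 by rewrite gt_eqF.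
exists (zvec (1 + i - j) (1 + j) (sg * h)).
(* Each of these three weights is the affine form that vanishes on the opposite edge of the slice;
   the numerators add up to [3 * (m - h)]. *)
exists ((m - h - D1 - D2)%:~R / (3 * M)), ((m - h + 2 * D1 - D2)%:~R / (3 * M)),
  ((m - h + 2 * D2 - D1)%:~R / (3 * M)), (h%:~R / M).
have dge (z : int) : 0 <= z -> 0 <= z%:~R / (3 * M) :> R.
  by move=> z0; rewrite divr_ge0 ?ler0z ?mulr_ge0// ltW.
split.
- by rewrite /zcoord zvecE /sg; case: ifP; lia.
- split; [by apply: dge; lia|by apply: dge; lia|by apply: dge; lia|].
  apply/andP; split; last by rewrite ltr_pdivrMr// mul1r ltr_int.
  by rewrite divr_ge0// ?ler0z ltW.
- by rewrite /M; field; exact: Mn.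
- apply: row3P; rewrite !mxE /= ?/(zcoord w) /M /D1 /D2 /al /be.
  + by field; exact: Mn.
  + by field; exact: Mn.
  + by rewrite -/(zcoord w) zE; field; exact: Mn.
Qed.

End Tetrahedron.

(** * Genericity of the point configuration *)

Section WellSpaced.
Variable R : realType.

Lemma well_spaced_gt0 N (C : rat) M i : 1 <= C -> well_spaced N C M ->
  (i < N)%N -> 0 < M i.
Proof.
move=> C1 [M0 HM]; elim: i => [|i IH] iN; first by rewrite (lt_trans _ M0)//; lra.
have Mi := IH (ltnW iN); have := HM i iN; rewrite ltr_pdivlMr//; apply: lt_trans.
by rewrite mulr_gt0//; lra.
Qed.

Lemma well_spaced_mono N (C : rat) M i j : 1 <= C -> well_spaced N C M ->
  (i <= j)%N -> (j < N)%N -> M i <= M j.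
Proof.
move=> C1 W; elim: j => [|j IH]; first by rewrite leqn0 => /eqP->.
rewrite leq_eqVlt => /predU1P[->//|]; rewrite ltnS => ij jN.
rewrite (le_trans (IH ij (ltnW jN)))//.
have Mj := well_spaced_gt0 C1 W (ltnW jN).
have [_ /(_ j jN)] := W; rewrite ltr_pdivlMr// => /ltW; apply: le_trans.
by rewrite ler_peMl// ltW.
Qed.

(** The term with the last nonzero [b j] outweighs the sum of all earlier ones as soon as the ratios
    exceed the sum of absolute values [S] divided by the absolute value of [b j]. [B] bounds this
    quotient for every possible [j]; the summands with [b i = 0] are 0, by the convention for
    division. *)
Lemma well_spaced_independent N (b : nat -> R) :
  (exists2 i, (i < N)%N & b i != 0) -> exists2 C : rat, 0 < C &
  forall C' M, C <= C' -> well_spaced N C' M ->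
  \sum_(i < N) b i * ratr (M i) != 0.
Proof.
move=> exb; pose S := \sum_(i < N) `|b i|; pose B := \sum_(i < N) S / `|b i|.
have S0 : 0 <= S by apply: sumr_ge0.
have B0 : 0 <= B by apply: sumr_ge0 => i _; rewrite divr_ge0.
pose C : rat := (Num.bound B).+1%:R; exists C => [|C' M CC' W]; first by rewrite ltr0n.
have BC : B < ratr C' :> R.
  apply: (lt_le_trans (archi_boundP B0)); rewrite (@le_trans _ _ (ratr C))//.
    by rewrite ratr_nat ler_nat.
  by rewrite ler_rat.
have C1 : 1 <= C' by rewrite (le_trans _ CC')// ler1n.
have ex : exists i, (i < N)%N && (b i != 0).
  by have [i iN bi] := exb; exists i; rewrite iN.
have [|j /andP[jN bj] jmax] := @ex_maxnP _ N ex.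
  by move=> i /andP[/ltnW].
have Mj0 : 0 < ratr (M j) :> R by rewrite ltr0q (well_spaced_gt0 C1 W).
have E : \sum_(i < N) b i * ratr (M i) =
    \sum_(i < j) b i * ratr (M i) + b j * ratr (M j).
  rewrite -(big_mkord xpredT (fun i => b i * ratr (M i))) (big_cat_nat _ (n := j.+1))//=.
  rewrite [X in _ + X]big1_seq ?addr0 => [|i /andP[_]].
    by rewrite big_nat_recr//= big_mkord.
  rewrite mem_index_iota => /andP[ji iN]; suff -> : b i = 0 by rewrite mul0r.
  apply/eqP/negPn/negP => bi; have := jmax i; rewrite iN bi => /(_ isT).
  by rewrite leqNgt ji.
rewrite E; apply/eqP => /eqP; rewrite addr_eq0 => /eqP/(congr1 Num.norm).
rewrite normrN normrM (gtr0_norm Mj0) => E'.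
have : \sum_(i < j) `|b i * ratr (M i)| < `|b j| * ratr (M j).
  case: j jN bj Mj0 {jmax E E'} => [|j] jN bj Mj0.
    by rewrite big_ord0 mulr_gt0// normr_gt0.
  have nb : 0 < `|b j.+1| by rewrite normr_gt0.
  have Mj : 0 < ratr (M j) :> R by rewrite ltr0q (well_spaced_gt0 C1 W)// ltnW.
  apply: (@le_lt_trans _ _ (S * ratr (M j))).
    apply: (@le_trans _ _ (\sum_(i < j.+1) `|b i| * ratr (M j))).
      apply: ler_sum => i _; rewrite normrM ler_wpM2l//.
      rewrite ger0_norm ?ler0q ?ler_rat; last first.
        by rewrite ltW// (well_spaced_gt0 C1 W)// (ltn_trans (ltn_ord i)).
      by rewrite (well_spaced_mono C1 W)// ?(ltnW jN)// -ltnS.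
    rewrite -mulr_suml ler_wpM2r ?(ltW Mj)// /S -!(big_mkord xpredT (fun i => `|b i|)).
    by rewrite (big_cat_nat _ (n := j.+1) (p := N))//= ?(ltnW jN)// lerDl sumr_ge0.
  rewrite -ltr_pdivrMl// mulrA.
  apply: (@lt_trans _ _ (ratr C' * ratr (M j))).
    rewrite ltr_pM2r// (le_lt_trans _ BC)// mulrC /B.
    rewrite (bigD1 (Ordinal jN))//= lerDl; apply: sumr_ge0 => i _.
    by rewrite divr_ge0.
  have [_ /(_ j jN)] := W; rewrite ltr_pdivlMr => [|]; last by rewrite -(ltr0q R).
  by rewrite -rmorphM/= ltr_rat.
by rewrite ltNge -E' ler_norm_sum.
Qed.

End WellSpaced.

Section Genericity.
Variables (R : realType) (P : set 'rV[R]_3) (v : 'rV[rat]_3).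
Local Notation A := (lattice_points P).
Local Notation N := (num_points P).
Hypotheses (N0 : (0 < N)%N) (genv : generic_direction P v).
Let lam (w : 'rV[int]_3) : R := dot (toR R w) (map_mx ratr v).

Lemma card_lattice_points : #|` A| = N.+2.
Proof. by move: N0; rewrite /num_points; lia. Qed.

Lemma generic_edge p q : p \in A -> q \in A -> p != q -> lam q - lam p != 0.
Proof.
move=> pA qA pq; apply/eqP => pq0; pose B := [fset p; q]%fset.
have big2 (V : nmodType) (F : 'rV[int]_3 -> V) : \sum_(w <- B) F w = F p + F q.
  by rewrite big_fsetU1 ?big_seq_fset1//= inE.
pose d : 'rV[R]_3 := toR R q - toR R p.
have d0 : d != 0.
  apply: contra pq; rewrite subr_eq0 => /eqP E; apply/eqP/rowP => j.
  by have /rowP/(_ j) := E; rewrite !mxE => /intr_inj.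
have dirB u : aff_direction B u -> exists t, u = t *: d.
  move=> [t]; rewrite !big2 => t0 ->; exists (t q).
  by rewrite (_ : t p = - t q) /d ?scalerBr ?scaleNr 1?addrC//; lra.
have [] := genv (B := B).
- by apply/fsubsetP => w; rewrite !inE => /orP[]/eqP->.
- by apply/fset0Pn; exists p; rewrite !inE eqxx.
(* A nonzero vector orthogonal to [d] leads out of the line through [p] and [q]; so this line is a
   proper subspace and genericity applies to it. *)
- have [X X0 dX] : exists2 X : 'rV[R]_3, X != 0 & dot d X = 0.
    have [/eqP d00|nd] := boolP (d 0 0 == 0).
      exists (delta_mx 0 0); last by rewrite dot_delta.
      by apply/eqP => /rowP/(_ 0); rewrite !mxE => /eqP; rewrite oner_eq0.
    exists (\row_j [:: - d 0 1; d 0 0; 0]`_j); last by rewrite dot3 !mxE/=; ring.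
    by apply/eqP => /rowP/(_ 1); rewrite !mxE/= => d00; case/eqP: nd; rewrite !mxE.
  move=> /(congr1 (fun D => D (toR R p + X))); rewrite propeqE => -[_ /(_ I)[t]].
  rewrite !big2 => t1 E; have XE : X = t q *: d.
    have tp : t p = 1 - t q by lra.
    move: E; rewrite tp scalerBl scale1r -addrA => /addrI ->.
    by rewrite scalerBr addrC.
  have : dot X X = 0 by rewrite {1}XE dotZl dX mulr0.
  rewrite dot3 => /eqP; rewrite !paddr_eq0 ?addr_ge0 -?expr2 ?sqr_ge0// !sqrf_eq0.
  move=> /andP[/andP[/eqP x0 /eqP x1] /eqP x2]; case/eqP: X0.
  by apply: row3P; rewrite ?x0 ?x1 ?x2 mxE.
move=> _ [].
  have qp : q != p by rewrite eq_sym.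
  have dB : aff_direction B d.
    exists (fun w => (w == q)%:R - (w == p)%:R).
      by rewrite big2 !eqxx (negPf pq) (negPf qp); ring.
    rewrite big2 !eqxx (negPf pq) (negPf qp) subr0 sub0r scale1r scaleN1r.
    by rewrite addrC.
  by move=> E; rewrite E in dB; rewrite dB eqxx in d0.
move=> u /dirB[t ->]; rewrite dotC dotZl /d dotBl -!/(lam _) pq0 mulr0 //.
Qed.

End Genericity.

Section GenericConstant.
Variables (R : realType) (P : set 'rV[R]_3) (v : 'rV[rat]_3).
Local Notation A := (lattice_points P).
Local Notation N := (num_points P).
Hypotheses (N0 : (0 < N)%N) (genv : generic_direction P v).
Let lam (w : 'rV[int]_3) : R := dot (toR R w) (map_mx ratr v).

(** For [g = nu_S] and two points on the same level this is the difference of their gaps: the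
    coordinates of [l] are the differences of [nu_S] along [vF], [vC] and along [vC], [vE], and the
    slope [s] cancels. *)
Definition level_relation (w1 w2 : 'rV[int]_3) (g : 'rV[int]_3 -> R) : R :=
  g w1 - g w2 - (w1 0 0 - w2 0 0)%:~R * (g vF - g vC)
    - (w1 0 1 - w2 0 1)%:~R * (g vC - g vE).

(* N edge equations, the circuit and the level relation are N + 2 functionals on
   the space R^A of the same dimension that vanish on the constants; so a nontrivial
   combination of them vanishes, and it turns the edge equations into a linear
   relation between the M i. *)
Lemma relation_bound (p q : nat -> 'rV[int]_3) w1 w2 :
  (circuit_C `<=` A)%fset ->
  (forall i, (i < N)%N -> [/\ p i \in A, q i \in A & p i != q i]) ->
  w1 \in A -> w2 \in A -> w1 != w2 -> w1 \notin circuit_C ->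
  exists2 C : rat, 0 < C & forall C' M, C <= C' -> well_spaced N C' M ->
  forall g : 'rV[int]_3 -> R,
    (forall i, (i < N)%N -> g (q i) - g (p i) = ratr (M i) * (lam (q i) - lam (p i))) ->
    g vE + g vF + g vG - 3 * g vC = 0 -> level_relation w1 w2 g <> 0.
Proof.
move=> CA Hpq w1A w2A w12 w1C.
pose dl (w w' : 'rV[int]_3) : R := (w == w')%:R.
pose co (i : nat) (w : 'rV[int]_3) : R :=
  if (i < N)%N then dl w (q i) - dl w (p i)
  else if i == N then (theta w)%:~R
  else dl w w1 - dl w w2 - (w1 0 0 - w2 0 0)%:~R * (dl w vF - dl w vC)
    - (w1 0 1 - w2 0 1)%:~R * (dl w vC - dl w vE).
pose L (i : nat) (g : 'rV[int]_3 -> R) : R :=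
  if (i < N)%N then g (q i) - g (p i)
  else if i == N then g vE + g vF + g vG - 3 * g vC
  else level_relation w1 w2 g.
have [EA FA GA CA'] : [/\ vE \in A, vF \in A, vG \in A & vC \in A].
  by have [? ? ? ?] := circuit_mem; split; apply: (fsubsetP CA).
have dlE w g : w \in A -> \sum_(w' <- A) dl w' w * g w' = g w.
  move=> wA; rewrite (big_fsetD1 w)//= /dl eqxx mul1r big_seq big1 ?addr0// => i.
  by rewrite !inE => /andP[/negPf->]; rewrite mul0r.
have LE i g : \sum_(w <- A) co i w * g w = L i g.
  rewrite /co /L; case: ltnP => [/Hpq[pA qA _]|_].
    by under eq_bigr do rewrite mulrBl; rewrite sumrB !dlE.
  case: eqVneq => _; first by rewrite theta_sum.
  have E w : (dl w w1 - dl w w2 - (w1 0 0 - w2 0 0)%:~R * (dl w vF - dl w vC)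
    - (w1 0 1 - w2 0 1)%:~R * (dl w vC - dl w vE)) * g w =
    dl w w1 * g w - dl w w2 * g w
    - (w1 0 0 - w2 0 0)%:~R * (dl w vF * g w - dl w vC * g w)
    - (w1 0 1 - w2 0 1)%:~R * (dl w vC * g w - dl w vE * g w) by ring.
  under eq_bigr do rewrite E.
  by rewrite !sumrB -!mulr_sumr !sumrB !dlE.
pose wj (j : 'I_N.+2) := nth 0 A j.
have sumA (V : nmodType) (F : 'rV[int]_3 -> V) :
    \sum_(w <- A) F w = \sum_(j < N.+2) F (wj j).
  by rewrite (big_nth 0) big_mkord; have := card_lattice_points N0; rewrite cardfE => ->.
pose Mx : 'M[R]_N.+2 := \matrix_(i, j) co i (wj j).
have det0 : \det Mx = 0.
  rewrite -det_tr; apply/eqP/det0P; exists (const_mx 1).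
    by apply/eqP => /rowP/(_ 0); rewrite !mxE => /eqP; rewrite oner_eq0.
  apply/rowP => i; rewrite !mxE; under eq_bigr do rewrite !mxE mul1r.
  have := LE i (fun=> 1); rewrite sumA/=; under eq_bigr do rewrite mulr1.
  move=> ->; rewrite /L /level_relation; case: ifP => _; [ring|case: ifP => _; ring].
have /eqP/det0P[ka ka0 kaM] := det0.
have rel w : w \in A -> \sum_(i < N.+2) ka 0 i * co i w = 0.
  move=> wA; have jN : (index w A < N.+2)%N.
    by rewrite -(card_lattice_points N0) index_mem.
  have := congr1 (fun B : 'rV[R]_N.+2 => B 0 (Ordinal jN)) kaM; rewrite !mxE => E; rewrite -[RHS]E.
  by apply: eq_bigr => i _; rewrite mxE /wj/= nth_index.
have relL g : \sum_(i < N.+2) ka 0 i * L i g = 0.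
  under eq_bigr do rewrite -LE mulr_sumr.
  rewrite exchange_big/= big_seq big1// => w wA.
  under eq_bigr do rewrite mulrA.
  by rewrite -mulr_suml rel// mul0r.
pose kn (i : nat) : R := if (i < N)%N then ka 0 (inord i) else 0.
pose b i := kn i * (lam (q i) - lam (p i)).
have split_sum (F : nat -> R) : \sum_(i < N.+2) ka 0 i * F i =
    \sum_(i < N) kn i * F i + ka 0 (inord N) * F N + ka 0 (inord N.+1) * F N.+1.
  rewrite 2!big_ord_recr/=; congr (_ + ka 0 _ * _ + ka 0 _ * _).
  - apply: eq_bigr => i _; rewrite /kn ltn_ord; congr (ka 0 _ * _).
    by apply: val_inj; rewrite /= inordK//; move: (ltn_ord i); clear; lia.
  - by apply: val_inj; rewrite /= inordK//; clear; lia.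
  - by apply: val_inj; rewrite /= inordK//; clear; lia.
(* Some [b i] is nonzero: otherwise, by [generic_edge], only the circuit and the level functional
   occur in the combination. The entry at [w1], off the circuit, kills the coefficient of the
   latter, and the entry at [vE] then that of the former. *)
have [|C C0 HC] := @well_spaced_independent R N b.
  apply: contrapT => no.
  have kn0 i : kn i = 0.
    rewrite /kn; case: ifP => // iN; apply/eqP/negPn/negP => ki; apply: no.
    exists i => //; rewrite /b /kn iN mulf_neq0//.
    by have [pA qA pq] := Hpq i iN; exact: (generic_edge genv).
  have rel' w : w \in A -> ka 0 (inord N) * co N w + ka 0 (inord N.+1) * co N.+1 w = 0.
    move=> /rel; rewrite (split_sum (fun i => co i w)) big1 ?add0r// => i _.
    by rewrite kn0 mul0r.
  have coN w : co N w = (theta w)%:~R by rewrite /co ltnn eqxx.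
  have coN1 w : co N.+1 w = dl w w1 - dl w w2 - (w1 0 0 - w2 0 0)%:~R * (dl w vF - dl w vC)
    - (w1 0 1 - w2 0 1)%:~R * (dl w vC - dl w vE).
    by rewrite /co ltnNge leqnSn /= gtn_eqF.
  have k1 : ka 0 (inord N.+1) = 0.
    have := rel' w1 w1A; rewrite coN coN1 theta0// mulr0 add0r /dl eqxx (negPf w12).
    move: w1C; rewrite circuitE !negb_or => /and4P[/negPf-> /negPf-> _ /negPf->].
    by rewrite !(subr0, mulr0) mulr1.
  have k0 : ka 0 (inord N) = 0.
    by have := rel' vE EA; rewrite k1 mul0r addr0 coN theta_val mulr1.
  case/eqP: ka0; apply/rowP => i; rewrite mxE.
  have [iN|Ni] := ltnP i N.
    by have := kn0 i; rewrite /kn iN inord_val.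
  have [iN|iN] := eqVneq (val i) N.
    by rewrite -k0; congr (ka 0 _); apply: val_inj; rewrite /= inordK ?iN//; lia.
  rewrite -k1; congr (ka 0 _); apply: val_inj; rewrite /= inordK//.
  by have := ltn_ord i; move: iN Ni => /=; clear; lia.
exists C => // C' M CC' W g Hg gC gL; have /negP := HC C' M CC' W; apply.
have := relL g; rewrite (split_sum (fun i => L i g)).
have -> : L N g = 0 by rewrite /L ltnn eqxx.
have -> : L N.+1 g = 0 by rewrite /L ltnNge leqnSn /= gtn_eqF.
rewrite !mulr0 !addr0 => E; apply/eqP; rewrite -[RHS]E.
apply: eq_bigr => i _; rewrite /L ltn_ord Hg// /b; ring.
Qed.

(** The bound of [relation_bound] depends on the edges and on the two points, but these range over
    the finite type [T]; one plus the sum of all bounds works for every choice. *)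
Lemma generic_constant : (circuit_C `<=` A)%fset -> exists2 C : rat, 0 < C &
  forall M, well_spaced N C M -> forall (p q : nat -> 'rV[int]_3) w1 w2 g,
  (forall i, (i < N)%N -> [/\ p i \in A, q i \in A & p i != q i]) ->
  w1 \in A -> w2 \in A -> w1 != w2 -> w1 \notin circuit_C ->
  (forall i, (i < N)%N -> g (q i) - g (p i) = ratr (M i) * (lam (q i) - lam (p i))) ->
  g vE + g vF + g vG - 3 * g vC = 0 -> level_relation w1 w2 g <> 0.
Proof.
move=> CA; pose T : finType := ({ffun 'I_N -> A * A} * (A * A))%type.
pose pp (d : T) i := if insub i is Some j then val (d.1 j).1 else 0.
pose qq (d : T) i := if insub i is Some j then val (d.1 j).2 else 0.
have /choice[C HC] : forall d : T, exists C : rat, 0 < C /\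
  forall C' M, C <= C' -> well_spaced N C' M -> forall g,
  (forall i, (i < N)%N -> [/\ pp d i \in A, qq d i \in A & pp d i != qq d i]) ->
  val d.2.1 != val d.2.2 -> val d.2.1 \notin circuit_C ->
  (forall i, (i < N)%N ->
     g (qq d i) - g (pp d i) = ratr (M i) * (lam (qq d i) - lam (pp d i))) ->
  g vE + g vF + g vG - 3 * g vC = 0 -> level_relation (val d.2.1) (val d.2.2) g <> 0.
  move=> d; have [[H w12 w1C]|no] := pselect [/\
    (forall i, (i < N)%N -> [/\ pp d i \in A, qq d i \in A & pp d i != qq d i]),
    val d.2.1 != val d.2.2 & val d.2.1 \notin circuit_C].
    have [C C0 HC] := relation_bound CA H (valP d.2.1) (valP d.2.2) w12 w1C.
    by exists C; split=> // C' M CC' W g _ _ _; exact: HC W g.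
  by exists 1; split=> // C' M _ _ g H w12 w1C; case: no.
exists (1 + \sum_d C d).
  by rewrite ltr_pwDl// sumr_ge0// => d _; have [/ltW] := HC d.
move=> M W p q w1 w2 g H w1A w2A w12 w1C Hg.
have pA (i : 'I_N) : p i \in A by have [] := H i (ltn_ord i).
have qA (i : 'I_N) : q i \in A by have [] := H i (ltn_ord i).
pose d : T := ([ffun i : 'I_N => ([` pA i]%fset, [` qA i]%fset)], ([` w1A]%fset, [` w2A]%fset)).
have pd i : (i < N)%N -> pp d i = p i.
  by move=> iN; rewrite /pp insubT/= ffunE.
have qd i : (i < N)%N -> qq d i = q i.
  by move=> iN; rewrite /qq insubT/= ffunE.
have [_ /(_ _ M _ W g)] := HC d; apply => //.
- rewrite (bigD1 d)//= addrCA lerDl addr_ge0// sumr_ge0// => d' _.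
  by have [/ltW] := HC d'.
- by move=> i iN; rewrite pd// qd//; exact: H.
- by move=> i iN; rewrite pd// qd//; exact: Hg.
Qed.

End GenericConstant.

(** * Lower hulls over a line *)

Section LineHull.
Variables (R : realType) (L : {fset int}) (h : int -> R).

Definition line_weights (t : int -> R) (z : R) :=
  convex_weights L t /\ z = \sum_(m <- L) t m * m%:~R.

Definition line_hull : set R := [set z | exists t, line_weights t z].

Definition hull_height : R -> R := lower_hull L (fun m => m%:~R : R^o) h.
Local Notation nz := hull_height.

(** The levels are placed on the z-axis of 3-space, so that the duality proved for row vectors of
    length 3 applies. *)
Let pos (m : int) : 'rV[R]_3 := m%:~R *: delta_mx 0 2.

Lemma line_bary t z : line_weights t z <-> bary L pos t (z *: delta_mx 0 2).
Proof.
have E : \sum_(m <- L) t m *: pos m = (\sum_(m <- L) t m * m%:~R) *: delta_mx 0 2.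
  by rewrite scaler_suml; apply: eq_bigr => m _; rewrite scalerA.
split=> -[wt]; first by move=> ->; split; rewrite ?E.
rewrite E => /rowP/(_ 2); rewrite !mxE !mulr1 => Ez; split=> //.
Qed.

Lemma hull_heightE z : nz z = lower_hull L pos h (z *: delta_mx 0 2).
Proof.
congr inf; apply/seteqP; split=> s [t [wt xt ->]]; exists t; split=> //.
  by have [_] : bary L pos t (z *: delta_mx 0 2) by apply/line_bary.
by have [] : line_weights t z by apply/line_bary; split.
Qed.

Definition line_below s mu := forall m, m \in L -> s * m%:~R + mu <= h m.

Lemma line_under X eta : under L pos h X eta <-> line_below (X 0 2) eta.
Proof.
by split=> H m /H; rewrite dotZl dotC dot_delta mulrC.
Qed.

Lemma line_hull_ex z : line_hull z -> exists t, bary L pos t (z *: delta_mx 0 2).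
Proof. by move=> [t /line_bary]; exists t. Qed.

Lemma height_ge z s mu : line_hull z -> line_below s mu -> s * z + mu <= nz z.
Proof.
move=> /line_hull_ex Hz sb; rewrite hull_heightE.
have -> : s * z = dot (z *: delta_mx 0 2) (s *: delta_mx 0 2).
  by rewrite dotZl dotZr dot_delta mxE !eqxx mulr1 mulrC.
by apply: lower_hull_ge => //; apply/line_under; rewrite mxE mxE !eqxx mulr1.
Qed.

Lemma height_le z t : line_weights t z -> nz z <= \sum_(m <- L) t m * h m.
Proof. by move=> /line_bary; rewrite hull_heightE; exact: lower_hull_le. Qed.

Lemma height_dual z : line_hull z ->
  exists s mu, line_below s mu /\ nz z = s * z + mu.
Proof.
move=> /line_hull_ex/(lower_hull_dual h)[X [mu [uX E]]].
exists (X 0 2), mu; split; first exact/line_under.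
by rewrite hull_heightE -E dotZl dotC dot_delta mulrC.
Qed.

(** Complementary slackness: the optimal weights at [z] charge only levels where the supporting line
    is tight. *)
Lemma height_tight z s mu : line_hull z -> line_below s mu -> nz z = s * z + mu ->
  exists2 t, line_weights t z & forall m, m \in L -> t m != 0 -> h m = s * m%:~R + mu.
Proof.
move=> Hz sb E; have [t /line_bary tz Et] := lower_hull_primal h (line_hull_ex Hz).
rewrite -hull_heightE E in Et; exists t => // m mL tm.
have [[t0 t1] zE] := tz.
have : \sum_(m <- L) t m * (h m - (s * m%:~R + mu)) = 0.
  have F n : t n * (h n - (s * n%:~R + mu)) = t n * h n - s * (t n * n%:~R) - t n * mu.
    by ring.
  under eq_bigr do rewrite F.
  by rewrite !sumrB Et -mulr_sumr -zE -mulr_suml t1; ring.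
have nn n : n \in L -> 0 <= t n * (h n - (s * n%:~R + mu)).
  by move=> nL; rewrite mulr_ge0 ?t0 ?subr_ge0 ?sb.
rewrite (big_fsetD1 m)//= => /eqP; rewrite paddr_eq0 ?nn//; last first.
  by rewrite big_seq sumr_ge0// => n; rewrite !inE => /andP[_ /nn].
by rewrite mulf_eq0 (negPf tm) subr_eq0 => /andP[/eqP].
Qed.

Lemma line_weights_ge t z b : line_weights t z ->
  (forall m, m \in L -> t m != 0 -> b <= m%:~R) -> b <= z.
Proof.
move=> [[t0 t1] ->] H; rewrite -[b]mulr1 -[X in _ * X <= _]t1 mulr_sumr big_seq [leRHS]big_seq.
apply: ler_sum => m mL; have [->|tm] := eqVneq (t m) 0; first by rewrite mulr0 mul0r.
by rewrite mulrC ler_wpM2l ?t0// H.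
Qed.

Lemma line_weights_le t z b : line_weights t z ->
  (forall m, m \in L -> t m != 0 -> m%:~R <= b) -> z <= b.
Proof.
move=> [[t0 t1] ->] H; rewrite -[b]mulr1 -[X in _ <= _ * X]t1 mulr_sumr big_seq [leRHS]big_seq.
apply: ler_sum => m mL; have [->|tm] := eqVneq (t m) 0; first by rewrite mulr0 mul0r.
by rewrite [leRHS]mulrC ler_wpM2l ?t0// H.
Qed.

Lemma line_hull_conv x y (t : R) : line_hull x -> line_hull y -> 0 <= t <= 1 ->
  line_hull (t * x + (1 - t) * y).
Proof.
move=> [r [[r0 r1] ->]] [q [[q0 q1] ->]] /andP[t0 t1].
exists (fun m => t * r m + (1 - t) * q m); split; first split.
- by move=> m mL; rewrite addr_ge0// mulr_ge0 ?r0 ?q0//; lra.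
- by rewrite big_split/= -!mulr_sumr r1 q1; ring.
- under [RHS]eq_bigr do rewrite mulrDl -!mulrA.
  by rewrite big_split/= -!mulr_sumr.
Qed.

Lemma height_convex x y (t : R) : line_hull x -> line_hull y -> 0 <= t <= 1 ->
  nz (t * x + (1 - t) * y) <= t * nz x + (1 - t) * nz y.
Proof.
move=> Hx Hy t01; have [s [mu [sb ->]]] := height_dual (line_hull_conv Hx Hy t01).
move: t01 => /andP[t0 t1]; have t1' : 0 <= 1 - t by lra.
have := ler_wpM2l t0 (height_ge Hx sb).
by have := ler_wpM2l t1' (height_ge Hy sb); lra.
Qed.

Lemma between_conv (a b z : R) : a < b -> a <= z <= b ->
  0 <= (b - z) / (b - a) <= 1 /\
  z = (b - z) / (b - a) * a + (1 - (b - z) / (b - a)) * b.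
Proof.
move=> ab /andP[az zb]; have ab0 : 0 < b - a by lra.
split; last by field; rewrite gt_eqF.
apply/andP; split; last by rewrite ler_pdivrMr// mul1r; lra.
by apply: divr_ge0; lra.
Qed.

Lemma level_hull m : m \in L -> line_hull m%:~R /\ nz m%:~R <= h m.
Proof.
move=> mL; pose t (n : int) : R := (n == m)%:R.
have tS (F : int -> R) : \sum_(n <- L) t n * F n = F m.
  rewrite (big_fsetD1 m)//= /t eqxx mul1r big_seq big1 ?addr0// => n.
  by rewrite !inE => /andP[/negPf->]; rewrite mul0r.
have tm : line_weights t m%:~R.
  split; last by rewrite (tS (fun n => n%:~R)).
  split; first by move=> n _; rewrite ler0n.
  by rewrite -[RHS](tS (fun=> 1)); apply: eq_bigr => n _; rewrite mulr1.
by split; [exists t|rewrite -[leRHS]tS; exact: height_le].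
Qed.

Section Edge.
Variables (a b : int) (s mu : R).
Hypotheses (ab : a < b) (sb : line_below s mu).
Hypotheses (aL : a \in L) (bL : b \in L).
Hypotheses (ha : h a = s * a%:~R + mu) (hb : h b = s * b%:~R + mu).

Let abR : (a%:~R : R) < b%:~R. Proof. by rewrite ltr_int. Qed.

Lemma edge_height z : a%:~R <= z <= b%:~R -> line_hull z /\ nz z = s * z + mu.
Proof.
move=> /(between_conv abR); set t := _ / _ => -[t01 zE].
have [Ha na] := level_hull aL; have [Hb nb] := level_hull bL.
have Hz : line_hull z by rewrite zE; exact: line_hull_conv.
split=> //; apply/le_anti; rewrite height_ge// andbT {1}zE.
apply: le_trans (height_convex Ha Hb t01) _.
move: t01 => /andP[t0 t1]; have t1' : 0 <= 1 - t by lra.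
have := ler_wpM2l t0 na; have := ler_wpM2l t1' nb.
have : s * z = s * (t * a%:~R + (1 - t) * b%:~R) by rewrite -zE.
by rewrite ha hb; lra.
Qed.

Lemma edge_convex : convex_set (`[a%:~R, b%:~R]%classic : set R^o) /\
  affine_on (`[a%:~R, b%:~R]%classic : set R^o) nz /\
  `[a%:~R, b%:~R]%classic `<=` line_hull.
Proof.
have cv (x y t : R) : `[a%:~R, b%:~R]%classic x -> `[a%:~R, b%:~R]%classic y ->
    0 <= t <= 1 -> `[a%:~R, b%:~R]%classic (t * x + (1 - t) * y).
  rewrite /= !in_itv/= => /andP[x0 x1] /andP[y0 y1] /andP[t0 t1].
  have t1' : 0 <= 1 - t by lra.
  have := ler_wpM2l t0 x0; have := ler_wpM2l t0 x1.
  have := ler_wpM2l t1' y0; have := ler_wpM2l t1' y1.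
  by move=> *; apply/andP; split; lra.
split; [|split].
- exact/convex_setE.
- move=> x y t Dx Dy t01; have Dz := cv x y t Dx Dy t01.
  move: Dx Dy Dz; rewrite /= !in_itv/= => Dx Dy Dz.
  have [_ ->] := edge_height Dx; have [_ ->] := edge_height Dy.
  have [_] := edge_height Dz; rewrite /GRing.scale/= => ->; ring.
- by move=> z; rewrite /= in_itv/= => /edge_height[].
Qed.

(** If a larger domain contained a point [z] outside the segment, affinity would put [z] on the line
    of the edge as well. By [height_tight] it would then be an average of tight levels, all of which
    lie in [[a, b]]. *)
Lemma edge_domain :
  (forall m, m \in L -> h m = s * m%:~R + mu -> a <= m <= b) ->
  linearity_domain (line_hull : set R^o) nz `[a%:~R, b%:~R].
Proof.
move=> tight; have abR' := abR; have [cv [af sub]] := edge_convex; split=> // D' sD D'H cD' aD'.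
have Da : D' a%:~R by apply: sD; rewrite /= in_itv/= lexx ltW.
have Db : D' b%:~R by apply: sD; rewrite /= in_itv/= lexx ltW.
have [_ na] : line_hull a%:~R /\ nz a%:~R = s * a%:~R + mu.
  by apply: edge_height; rewrite lexx ltW.
have [_ nb] : line_hull b%:~R /\ nz b%:~R = s * b%:~R + mu.
  by apply: edge_height; rewrite lexx ltW.
have on z : D' z -> nz z = s * z + mu -> a%:~R <= z <= b%:~R.
  move=> Dz /(height_tight (D'H _ Dz) sb)[t tz Ht]; apply/andP; split.
    by apply: line_weights_ge tz _ => m mL /(Ht m mL)/(tight m mL)/andP[am _]; rewrite ler_int.
  by apply: line_weights_le tz _ => m mL /(Ht m mL)/(tight m mL)/andP[_ mb]; rewrite ler_int.
apply/seteqP; split=> // z Dz; rewrite /= in_itv/=.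
have [az|za] := leP a%:~R z; have [zb|bz] := leP z b%:~R => //.
- have az' : (a%:~R : R) < z := lt_trans abR bz.
  have [|t01 zE] := @between_conv a%:~R z b%:~R az'; first by rewrite !ltW.
  set t := _ / _ in t01 zE.
  have := aD' a%:~R z t Da Dz t01; rewrite /GRing.scale/= -zE nb na => E.
  suff : nz z = s * z + mu by move=> /(on z Dz); rewrite az leNgt bz.
  have t1 : 1 - t != 0.
    by apply/eqP => t1; move: zE; rewrite t1 mul0r addr0 (_ : t = 1)//; lra.
  apply: (mulfI t1); have : s * b%:~R = s * (t * a%:~R + (1 - t) * z) by rewrite -zE.
  by move=> ?; lra.
- have zb' : z < b%:~R := lt_trans za abR.
  have [|t01 zE] := @between_conv z b%:~R a%:~R zb'; first by rewrite !ltW.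
  set t := _ / _ in t01 zE.
  have := aD' z b%:~R t Dz Db t01; rewrite /GRing.scale/= -zE nb na => E.
  suff : nz z = s * z + mu by move=> /(on z Dz); rewrite zb leNgt za.
  have t1 : t != 0.
    by apply/eqP => t1; move: zE; rewrite t1 mul0r add0r subr0 mul1r; lra.
  apply: (mulfI t1); have : s * a%:~R = s * (t * z + (1 - t) * b%:~R) by rewrite -zE.
  by move=> ?; lra.
- by exfalso; lra.
Qed.

End Edge.

(** By convexity the line over the domain stays below all heights. Optimal weights at the two
    endpoints yield tight levels [m <= a] and [n >= b]; the height is affine on [[m, n]], so
    maximality of the domain forces [m = a] and [n = b]. *)
Lemma domain_edge (a b : int) (s mu : R) : a < b ->
  linearity_domain (line_hull : set R^o) nz `[a%:~R, b%:~R] ->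
  nz a%:~R = s * a%:~R + mu -> nz b%:~R = s * b%:~R + mu ->
  [/\ line_below s mu, a \in L /\ h a = s * a%:~R + mu
    & b \in L /\ h b = s * b%:~R + mu].
Proof.
move=> ab [sub cv af maxD] na nb.
have abR : (a%:~R : R) < b%:~R by rewrite ltr_int.
have Da : `[a%:~R, b%:~R]%classic (a%:~R : R) by rewrite /= in_itv/= lexx ltW.
have Db : `[a%:~R, b%:~R]%classic (b%:~R : R) by rewrite /= in_itv/= lexx ltW.
have [Ha Hb] := (sub _ Da, sub _ Db).
have below : line_below s mu.
  move=> m mL; have [Hm nm] := level_hull mL; apply: le_trans _ nm.
  have [am|ma] := leP a%:~R (m%:~R : R); have [mb|bm] := leP (m%:~R : R) b%:~R.
  - have [|t01 zE] := @between_conv a%:~R b%:~R m%:~R abR; first by rewrite am.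
    set t := _ / _ in t01 zE.
    have E : nz (t * a%:~R + (1 - t) * b%:~R) = t * nz a%:~R + (1 - t) * nz b%:~R.
      exact: af _ _ t Da Db t01.
    rewrite -zE na nb in E; rewrite E.
    suff -> : s * m%:~R + mu = t * (s * a%:~R + mu) + (1 - t) * (s * b%:~R + mu) by [].
    by rewrite {1}zE; ring.
  - have az' : (a%:~R : R) < m%:~R := lt_trans abR bm.
    have [|t01 zE] := @between_conv a%:~R m%:~R b%:~R az'; first by rewrite !ltW.
    set t := _ / _ in t01 zE.
    have := height_convex Ha Hm t01; rewrite -zE na nb => E.
    have t1 : 0 < 1 - t.
      rewrite lt_def; move: (t01) => /andP[_ tl]; rewrite subr_ge0 tl andbT.
      by apply/eqP => t1; move: zE; rewrite t1 mul0r addr0 (_ : t = 1)//; lra.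
    rewrite -(ler_pM2l t1).
    have : s * b%:~R = s * (t * a%:~R + (1 - t) * m%:~R) by rewrite -zE.
    by move=> ?; lra.
  - have zb' : (m%:~R : R) < b%:~R := lt_trans ma abR.
    have [|t01 zE] := @between_conv m%:~R b%:~R a%:~R zb'; first by rewrite !ltW.
    set t := _ / _ in t01 zE.
    have := height_convex Hm Hb t01; rewrite -zE na nb => E.
    have t1 : 0 < t.
      rewrite lt_def; move: (t01) => /andP[-> _]; rewrite andbT.
      by apply/eqP => t1; move: zE; rewrite t1 mul0r add0r subr0 mul1r; lra.
    rewrite -(ler_pM2l t1).
    have : s * a%:~R = s * (t * m%:~R + (1 - t) * b%:~R) by rewrite -zE.
    by move=> ?; lra.
  - by have := lt_trans (lt_trans abR bm) ma; rewrite ltxx.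
have [m [mL ma hm]] : exists m, [/\ m \in L, m <= a & h m = s * m%:~R + mu].
  apply: contrapT => no; have [t tz Ht] := height_tight Ha below na.
  suff : (a + 1)%:~R <= a%:~R :> R by rewrite ler_int; lia.
  apply: line_weights_ge tz _ => m mL tm; rewrite ler_int lezD1 ltNge; apply/negP => ma.
  by apply: no; exists m; split=> //; exact: Ht.
have [n [nL bn hn]] : exists n, [/\ n \in L, b <= n & h n = s * n%:~R + mu].
  apply: contrapT => no; have [t tz Ht] := height_tight Hb below nb.
  suff : b%:~R <= (b - 1)%:~R :> R by rewrite ler_int; lia.
  apply: line_weights_le tz _ => n nL tn; rewrite ler_int lerBrDr lezD1 ltNge; apply/negP => bn.
  by apply: no; exists n; split=> //; exact: Ht.
have mn : m < n by lia.
have [cv' [af' sub']] := edge_convex mn below mL nL hm hn.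
have DE : `[m%:~R, n%:~R]%classic = `[a%:~R, b%:~R]%classic :> set R.
  apply: maxD => //; move=> z; rewrite /= !in_itv/= => /andP[az zb].
  by rewrite (le_trans _ az) ?(le_trans zb)// ler_int.
have Dm : `[a%:~R, b%:~R]%classic (m%:~R : R).
  by rewrite -DE /= in_itv/= lexx ler_int ltW.
have Dn : `[a%:~R, b%:~R]%classic (n%:~R : R).
  by rewrite -DE /= in_itv/= lexx ler_int ltW.
move: Dm Dn; rewrite /= !in_itv/= !ler_int => /andP[am _] /andP[_ nb'].
have -> : a = m by lia.
have -> : b = n by lia.
by [].
Qed.

End LineHull.

(** * Construction of singular points *)

Lemma big_split_circuit (V : nmodType) (A : {fset 'rV[int]_3}) (F : 'rV[int]_3 -> V) :
  (circuit_C `<=` A)%fset ->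
  \sum_(w <- A) F w = F vE + F vF + F vG + F vC + \sum_(w <- A | w \notin circuit_C) F w.
Proof.
move=> CA; rewrite (bigID (mem circuit_C))/= -big_circuit; congr (_ + _).
rewrite big_mkcond -(big_fset_incl _ CA)/= => [|w _ /negPf->//].
by rewrite big_seq [RHS]big_seq; apply: eq_bigr => w ->.
Qed.

Section Sufficiency.
Variables (R : realType) (P : set 'rV[R]_3).
Local Notation A := (lattice_points P).
Hypotheses (polyP : lattice_polytope P) (A0 : A != fset0).
Variable c : 'rV[int]_3 -> R.
Local Notation nu := (nu_S P c).
Hypothesis circC : is_the_circuit P c circuit_C.
Variables (l : 'rV[R]_3) (k : R).
Hypotheses (lz : zcoord l = 0) (Hl : forall x, lattice_hull circuit_C x ->
  nu x = Lambda1 l k x).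

Lemma nu_circuit w : w \in circuit_C -> nu (toR R w) = dot l (toR R w) + k.
Proof. by move=> wC; rewrite Hl//; exact: hull_point. Qed.

Lemma nu_circuit_relation :
  nu (toR R vE) + nu (toR R vF) + nu (toR R vG) - 3 * nu (toR R vC) = 0.
Proof.
have [EC FC GC CC] := circuit_mem.
by rewrite !nu_circuit// !dot3 !mxE /=; ring.
Qed.

Lemma slope_circuit :
  l 0 0 = nu (toR R vF) - nu (toR R vC) /\ l 0 1 = nu (toR R vC) - nu (toR R vE).
Proof.
have [EC FC GC CC] := circuit_mem.
by move: lz; rewrite /zcoord !nu_circuit// !dot3 !mxE /= => ->; split; ring.
Qed.

(** Equality at [w] would put [w] into the contact set of the circuit, where the affine relation of
    [w] with [vE], [vF], [vC] contradicts [contact_theta]. *)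
Lemma plane_gap w : w \in A -> zcoord w = 0 -> w \notin circuit_C ->
  0 < nu (toR R w) - (dot l (toR R w) + k).
Proof.
move=> wA wz wC; have [EA FA GA CA] := circuit_A circC.
have [EC FC GC CC] := circuit_mem.
have inP x := elimT (latticeP A0 x).
(* A minorant tight at [vC] is tight at [vE], [vF], [vG] too, because their heights average to that
   of [vC]; hence it agrees with [Lambda1] on the plane [z = 0]. *)
have [X [eta [uX EX]]] := nu_dual polyP A0 c (inP _ CA).
have [eqE eqF eqG lE] : [/\ nu (toR R vE) = dot (toR R vE) X + eta,
    nu (toR R vF) = dot (toR R vF) X + eta, nu (toR R vG) = dot (toR R vG) X + eta
    & dot l (toR R w) + k = dot (toR R w) X + eta].
  have := nu_circuit_relation; have := slope_circuit; have := nu_circuit CC.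
  have := nu_ge polyP A0 uX (inP _ EA); have := nu_ge polyP A0 uX (inP _ FA).
  have := nu_ge polyP A0 uX (inP _ GA).
  move: EX lz wz; rewrite /zcoord !dot3 !mxE/= => EX l2 wz G1 F1 E1 C1 [l0 l1] rel.
  have x0 : X 0 0 = l 0 0 by lra.
  have x1 : X 0 1 = l 0 1 by lra.
  have ke : k = eta by lra.
  by rewrite l2 wz x0 x1; split; lra.
rewrite lE subr_gt0 lt_def nu_ge ?andbT//; last exact: inP.
apply/eqP => nuw.
pose dl (v v' : 'rV[int]_3) : R := (v == v')%:R.
(* In the plane, [w = vC + (x - 1) (vF - vC) + (1 - y) (vE - vC)] for the coordinates [x], [y] of
   [w]. *)
pose d v := dl v w - dl v vC - ((w 0 0)%:~R - 1) * (dl v vF - dl v vC)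
  - (1 - (w 0 1)%:~R) * (dl v vE - dl v vC).
have dlE v g : v \in A -> \sum_(v' <- A) dl v' v * g v' = g v.
  move=> vA; rewrite (big_fsetD1 v)//= /dl eqxx mul1r big_seq big1 ?addr0// => i.
  by rewrite !inE => /andP[/negPf->]; rewrite mul0r.
have dS g : \sum_(v <- A) d v * g v = g w - g vC - ((w 0 0)%:~R - 1) * (g vF - g vC)
  - (1 - (w 0 1)%:~R) * (g vE - g vC).
  have E v : d v * g v = dl v w * g v - dl v vC * g v
     - ((w 0 0)%:~R - 1) * (dl v vF * g v - dl v vC * g v)
     - (1 - (w 0 1)%:~R) * (dl v vE * g v - dl v vC * g v) by rewrite /d; ring.
  under eq_bigr do rewrite E.
  by rewrite !sumrB -!mulr_sumr !sumrB !dlE.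
have : d w = d vE * (theta w)%:~R.
  apply: (contact_theta polyP A0 circC uX) => //.
  - move=> v vA; rewrite /d /dl.
    have [->//|_] := eqVneq v w; have [->//|_] := eqVneq v vC.
    have [->//|_] := eqVneq v vF.
    have [->//|_] := eqVneq v vE.
    by rewrite !subr0 !mulr0 !subr0 eqxx.
  - by have := dS (fun=> 1); under eq_bigr do rewrite mulr1; move=> ->; ring.
  - have co j : (\sum_(v <- A) d v *: toR R v) 0 j = \sum_(v <- A) d v * (v 0 j)%:~R.
      by rewrite summxE; apply: eq_bigr => v _; rewrite !mxE.
    move: wz; rewrite /zcoord => wz.
    by apply: row3P; rewrite co (dS (fun v => (v 0 _)%:~R)) !zvecE mxE ?wz; ring.
rewrite theta0// mulr0 /d /dl eqxx.
move: wC; rewrite circuitE !negb_or => /and4P[/negPf-> /negPf-> _ /negPf->].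
by rewrite !subr0 !mulr0 !subr0 => /eqP; rewrite oner_eq0.
Qed.

Hypothesis trS : in_Sing_tr P c.

(** Away from [vC] the heights are, up to a common constant, orders of coefficients of a singular
    polynomial, hence rational; the height at [vC] is the average of the other three on the
    circuit. *)
Lemma rational_heights : exists k0 : R, forall w, w \in A ->
  exists q : rat, nu (toR R w) = k0 + ratr q.
Proof.
have [f Sf tf] := trS; have [k0 [B0 BA tB]] := trop_support Sf tf.
have rat_off w : w \in A -> w != vC -> exists q : rat, nu (toR R w) = k0 + ratr q.
  move=> wA wC; have [] := nu_height polyP A0 circC BA B0 tB wA wC.
  rewrite !inE wA => /order_exists[r fr] ->; exists r.
  by rewrite (Val_order fr) opprK.
exists k0 => w wA; have [->|] := eqVneq w vC; last exact: rat_off.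
have [EA FA GA _] := circuit_A circC.
have [qE HE] : exists q : rat, nu (toR R vE) = k0 + ratr q.
  by apply: rat_off; rewrite ?circuit_distinct.
have [qF HF] : exists q : rat, nu (toR R vF) = k0 + ratr q.
  by apply: rat_off; rewrite ?circuit_distinct.
have [qG HG] : exists q : rat, nu (toR R vG) = k0 + ratr q.
  by apply: rat_off; rewrite ?circuit_distinct.
exists ((qE + qF + qG) / 3).
have -> : ratr ((qE + qF + qG) / 3) = (ratr qE + ratr qF + ratr qG) / 3 :> R.
  by rewrite fmorph_div/= rmorph_nat; congr (_ / _); rewrite !rmorphD.
by have := nu_circuit_relation; rewrite HE HF HG; lra.
Qed.

End Sufficiency.

Section Construction.
Variables (R : realType) (P : set 'rV[R]_3).
Local Notation A := (lattice_points P).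
Local Notation K := (puiseux R).

Lemma coef_atMz s (x : K) n : coef_at s (x *~ n) = coef_at s x *~ n.
Proof. exact: (raddfMz (coef_at s) n x). Qed.

Lemma coef_at_sum s (I : Type) (r : seq I) (Q : pred I) (F : I -> K) :
  coef_at s (\sum_(i <- r | Q i) F i) = \sum_(i <- r | Q i) coef_at s (F i).
Proof. exact: (raddf_sum (coef_at s)). Qed.

Lemma coef_atD s (x y : K) : coef_at s (x + y) = coef_at s x + coef_at s y.
Proof. by []. Qed.

Lemma coef_atB s (x y : K) : coef_at s (x - y) = coef_at s x - coef_at s y.
Proof. by []. Qed.

Lemma coef_atN s (x : K) : coef_at s (- x) = - coef_at s x.
Proof. exact: (raddfN (coef_at s)). Qed.

Lemma big_fset_eq1 (V : nmodType) (B : {fset 'rV[int]_3}) (Q : pred 'rV[int]_3)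
    (F : 'rV[int]_3 -> V) w : w \in B -> Q w ->
  \sum_(w' <- B | Q w' && (w' == w)) F w' = F w.
Proof.
move=> wB Qw; rewrite big_mkcond (big_fsetD1 w)//= Qw eqxx big_seq big1 ?addr0// => v.
by rewrite !inE => /andP[/negPf->]; rewrite andbF.
Qed.

(** With the coefficient at [vG] fixed to 1, three equations remain for those at [vE], [vF], [vC].
    These points form a unimodular triangle, so the solution has no denominators. *)
Lemma circuit_solution (S : comPzRingType) (r0 rx ry : S) :
  let aE := 1 + ry - r0 in let aF := 1 + r0 - rx in let aC := - 3 - r0 + rx - ry in
  [/\ aE + aF + 1 + aC + r0 = 0, aE + aF * 2 + aC + rx = 0 & aF + 2 + aC + ry = 0].
Proof. by split; ring. Qed.

(* The coefficients a_w are monomials away from the circuit and w2; a_w2 solves the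
   z-equation, and its leading term survives for a suitable multiple of a_w1; then
   the circuit coefficients solve the other three equations. *)
Lemma coefficients_exist (q : 'rV[int]_3 -> rat) (w1 w2 : 'rV[int]_3) :
  (circuit_C `<=` A)%fset -> w1 \in A -> w2 \in A -> w1 != w2 ->
  zcoord w1 != 0 -> zcoord w2 != 0 -> q w1 = q w2 ->
  (forall w, w \in A -> zcoord w != 0 -> q w2 <= q w) ->
  (forall w, w \in A -> w \notin circuit_C -> 0 < q w) ->
  (forall w, w \in circuit_C -> q w = 0) ->
  exists a : 'rV[int]_3 -> K,
  [/\ forall w, w \in A -> has_order (a w) (q w), \sum_(w <- A) a w = 0
    & forall i, \sum_(w <- A) a w *~ w 0 i = 0].
Proof.
move=> CA w1A w2A w12 z1 z2 q12 qmin qpos qC.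
have zC w : w \in circuit_C -> zcoord w = 0.
  by rewrite circuitE => /or4P[]/eqP->; rewrite /zcoord zvecE.
have nC1 : w1 \notin circuit_C by apply: contra z1 => /zC ->.
have nC2 : w2 \notin circuit_C by apply: contra z2 => /zC ->.
pose lead (g : int) : int := \sum_(w <- A | [&& w \notin circuit_C, w != w2 & q w == q w2])
  (if w == w1 then g else 1) * zcoord w.
(* The leading coefficient of [a2] will be [- lead g]. It is affine in [g] with slope [- zcoord w1],
   which is nonzero, so it cannot vanish for both [g = 1] and [g = 2]. *)
have [g g0 lg] : exists2 g : int, g != 0 & lead g != 0.
  have E g : lead g = g * zcoord w1 + \sum_(w <- A | [&& [&& w \notin circuit_C, w != w2
     & q w == q w2] & w != w1]) zcoord w.
    rewrite /lead (bigID (pred1 w1))/= big_fset_eq1 ?nC1 ?w12 ?q12 ?eqxx//.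
    by congr (_ + _); apply: eq_bigr => w /andP[_ /negPf->]; rewrite mul1r.
  have [l1|] := eqVneq (lead 1) 0; last by exists 1.
  by exists 2 => //; move: l1; rewrite !E; move: z1; lia.
pose ga w : int := if w == w1 then g else 1.
have ga0 w : ga w != 0 by rewrite /ga; case: ifP.
(* In [a1] the other monomials carry the factor [zcoord w2]; thus the z-equation holds without a
   division by this level. *)
pose a2 : K := - \sum_(w <- A | (w \notin circuit_C) && (w != w2))
  monom R (q w) *~ (ga w * zcoord w).
pose a1 w : K := if w == w2 then a2 else monom R (q w) *~ (ga w * zcoord w2).
have intz_neq0 (n : int) : n != 0 -> 1 *~ n != 0 :> R[i] by rewrite intr_eq0.
have coefz r s n : coef_at s (monom R r *~ n) = (s == r)%:R *~ n.
  by rewrite coef_atMz coef_monom.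
have order1 w : w \in A -> w \notin circuit_C -> has_order (a1 w) (q w).
  move=> wA wC; rewrite /a1; have [->|ww2] := eqVneq w w2; last first.
    split=> [s sq|]; first by rewrite coefz lt_eqF// mul0rz.
    by rewrite coefz eqxx intz_neq0// mulf_neq0.
  have coef2 s : coef_at s a2 = - \sum_(w <- A | (w \notin circuit_C) && (w != w2))
      (s == q w)%:R *~ (ga w * zcoord w).
    by rewrite coef_atN coef_at_sum; congr (- _); apply: eq_bigr => v _; rewrite coefz.
  split=> [s sq|].
    rewrite coef2 big_seq_cond big1 ?oppr0// => v /andP[vA _].
    have [->|zv] := eqVneq (zcoord v) 0; first by rewrite mulr0 mulr0z.
    by rewrite lt_eqF ?mul0rz// (lt_le_trans sq)// qmin.
  rewrite coef2 oppr_eq0 (bigID (fun v => q v == q w2))/= [X in _ + X]big1 ?addr0.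
    rewrite (eq_bigr (fun v => (ga v * zcoord v)%:~R)) => [|v /andP[_ /eqP->]]; last first.
      by rewrite eqxx.
    rewrite -rmorph_sum/= intr_eq0; apply: contra lg => /eqP E; apply/eqP.
    by rewrite -[RHS]E; apply: eq_bigl => v; rewrite andbA.
  by move=> v /andP[_ qv]; rewrite eq_sym (negPf qv) mul0rz.
pose S0 := \sum_(w <- A | w \notin circuit_C) a1 w.
pose Sj j := \sum_(w <- A | w \notin circuit_C) a1 w *~ w 0 j.
have low_sum (G : 'rV[int]_3 -> int) s : s <= 0 ->
    coef_at s (\sum_(w <- A | w \notin circuit_C) a1 w *~ G w) = 0.
  move=> s0; rewrite coef_at_sum big_seq_cond big1// => w /andP[wA wC].
  rewrite coef_atMz; have [lo _] := order1 w wA wC.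
  by rewrite lo ?mul0rz// (le_lt_trans s0)// qpos.
have low0 s : s <= 0 -> coef_at s S0 = 0 by move=> /(low_sum (fun=> 1)).
have lowj j s : s <= 0 -> coef_at s (Sj j) = 0 by move=> /(low_sum (fun w => w 0 j)).
have coef1 s (n : int) : coef_at s (n%:~R : K) = (s == 0)%:R *~ n.
  by rewrite -[RHS](coefz 0) monom0.
have Sz : Sj 2 = 0.
  rewrite /Sj (bigID (fun w => w == w2))/=.
  rewrite big_fset_eq1//= {1}/a1 eqxx -/(zcoord w2).
  rewrite /a2 mulNrz mulrz_suml addrC; apply/eqP; rewrite subr_eq0; apply/eqP.
  apply: eq_bigr => w /andP[_ /negPf ww2]; rewrite /a1 ww2 -!mulrzA; congr (_ *~ _).
  by rewrite /zcoord mulrAC.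
(* [S0] and the [Sj] have positive order, so these corrections leave the orders 0 and the leading
   coefficients of the circuit unchanged. *)
pose a w : K := if w == vE then 1 + Sj 1 - S0 else if w == vF then 1 + S0 - Sj 0
  else if w == vG then 1 else if w == vC then - 3 - S0 + Sj 0 - Sj 1 else a1 w.
have [EC FC GC CC] := circuit_mem.
have aE : (a vE = 1 + Sj 1 - S0) * (a vF = 1 + S0 - Sj 0) * (a vG = 1) *
    (a vC = - 3 - S0 + Sj 0 - Sj 1).
  by rewrite /a !zvec_eq.
have aoff w : w \notin circuit_C -> a w = a1 w.
  by rewrite circuitE !negb_or /a => /and4P[/negPf-> /negPf-> /negPf-> /negPf->].
have sumE (G : 'rV[int]_3 -> int) : \sum_(w <- A) a w *~ G w =
   (1 + Sj 1 - S0) *~ G vE + (1 + S0 - Sj 0) *~ G vF + 1 *~ G vG +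
   (- 3 - S0 + Sj 0 - Sj 1) *~ G vC + \sum_(w <- A | w \notin circuit_C) a1 w *~ G w.
  rewrite (big_split_circuit _ CA) !aE; congr (_ + _).
  by apply: eq_bigr => w /aoff->.
have [sol0 solx soly] := circuit_solution S0 (Sj 0) (Sj 1).
exists a; split.
- move=> w wA; have [wC|wC] := boolP (w \in circuit_C); last by rewrite aoff//; exact: order1.
  rewrite qC//.
  have ord (x : K) (n : int) : n != 0 ->
      (forall s, s <= 0 -> coef_at s x = (s == 0)%:R *~ n) -> has_order x 0.
    move=> n0 H; split=> [s s0|]; first by rewrite H ?ltW// lt_eqF// mul0rz.
    by rewrite H// eqxx intz_neq0.
  move: wC; rewrite circuitE => /or4P[]/eqP->; rewrite aE.
  + apply: (ord _ 1) => // s s0; rewrite coef_atB coef_atD low0// lowj// (coef1 _ 1).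
    by rewrite addr0 subr0.
  + apply: (ord _ 1) => // s s0; rewrite coef_atB coef_atD low0// lowj// (coef1 _ 1).
    by rewrite addr0 subr0.
  + by apply: (ord _ 1) => // s s0; rewrite (coef1 _ 1).
  + apply: (ord _ (-3)) => // s s0; rewrite coef_atB coef_atD coef_atB low0// !lowj//.
    by rewrite (coef1 _ (-3)) !subr0 addr0.
- have := sumE (fun=> 1); rewrite !mulr1z => E.
  by rewrite [LHS]E.
- have c0 : \sum_(w <- A) a w *~ w 0 0 = 0.
    by rewrite (sumE (fun w => w 0 0)) !zvecE !mulr1z mulr0z addr0 -/(Sj 0) -[_ *~ 2]mulrzr.
  have c1 : \sum_(w <- A) a w *~ w 0 1 = 0.
    by rewrite (sumE (fun w => w 0 1)) !zvecE !mulr1z mulr0z add0r -/(Sj 1).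
  have c2 : \sum_(w <- A) a w *~ w 0 2 = 0.
    by rewrite (sumE (fun w => w 0 2)) !zvecE !mulr0z !add0r -/(Sj 2).
  have /rowP H : (\row_i \sum_(w <- A) a w *~ w 0 i) = (0 : 'rV[K]_3).
    by apply: row3P; rewrite !mxE.
  by move=> i; have := H i; rewrite !mxE.
Qed.

End Construction.

Section SingularPointExists.
Variables (R : realType) (P : set 'rV[R]_3).
Local Notation A := (lattice_points P).
Hypotheses (polyP : lattice_polytope P) (A0 : A != fset0).
Variable c : 'rV[int]_3 -> R.
Local Notation nu := (nu_S P c).
Hypothesis circC : is_the_circuit P c circuit_C.
Variables (l : 'rV[R]_3) (k : R).
Hypotheses (lz : zcoord l = 0) (Hl : forall x, lattice_hull circuit_C x ->
  nu x = Lambda1 l k x).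
Hypothesis trS : in_Sing_tr P c.

Definition gap (s : R) (w : 'rV[int]_3) : R :=
  nu (toR R w) - (dot l (toR R w) + k) - s * (zcoord w)%:~R.

Lemma gradientE s w : dot (toR R w) (gradient l s) = dot l (toR R w) + s * (zcoord w)%:~R.
Proof. by rewrite dotDr dotZr dot_delta dotC mxE. Qed.

Lemma gap_circuit s w : w \in circuit_C -> gap s w = 0.
Proof.
move=> wC; rewrite /gap (nu_circuit Hl wC) subrr sub0r.
by move: wC; rewrite circuitE => /or4P[]/eqP->; rewrite /zcoord zvecE mulr0 oppr0.
Qed.

Lemma gap_off_circuit s w2 w : 0 < gap s w2 ->
  (forall w, w \in A -> zcoord w != 0 -> gap s w2 <= gap s w) ->
  w \in A -> w \notin circuit_C -> 0 < gap s w.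
Proof.
move=> g2 gmin wA wC; have [wz|wz] := eqVneq (zcoord w) 0.
  by rewrite /gap wz mulr0 subr0; exact: plane_gap.
exact: lt_le_trans g2 (gmin w wA wz).
Qed.

(** Two points on different levels with equal gaps express [s] as a quotient of rational numbers;
    the common constant [k0] of the heights is absorbed by [k]. This provides admissible exponents
    for [p] and for the coefficients. *)
Lemma gap_rational s w1 w2 : w1 \in A -> w2 \in A -> zcoord w1 != zcoord w2 ->
  gap s w1 = gap s w2 -> exists l0 l1 sq : rat, exists q : 'rV[int]_3 -> rat,
  [/\ l 0 0 = ratr l0, l 0 1 = ratr l1, s = ratr sq
    & forall w, w \in A -> gap s w = ratr (q w)].
Proof.
move=> w1A w2A z12 g12.
have [k0 Hk0] := rational_heights polyP A0 circC Hl trS.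
have /choice[r Hr] : forall w, exists q : rat, w \in A -> nu (toR R w) = k0 + ratr q.
  move=> w; have [wA|_] := boolP (w \in A); last by exists 0.
  by have [q Hq] := Hk0 w wA; exists q.
have [EA FA GA CA] := circuit_A circC; have [EC FC GC CC] := circuit_mem.
pose l0 := r vF - r vC; pose l1 := r vC - r vE; pose kq := r vC - l0 - l1.
have [] := slope_circuit lz Hl; rewrite !Hr// => E0 E1.
have {}E0 : l 0 0 = ratr l0 by rewrite E0 rmorphB; ring.
have {}E1 : l 0 1 = ratr l1 by rewrite E1 rmorphB; ring.
have Ek : k = k0 + ratr kq.
  have := nu_circuit Hl CC; rewrite Hr// dot3 !mxE /= E0 E1 => H.
  by rewrite /kq 2!rmorphB /=; move: H; rewrite mulr0 !mulr1; lra.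
clearbody kq; clearbody l0 l1.
pose bq w := r w - (l0 * (w 0 0)%:~R + l1 * (w 0 1)%:~R) - kq.
have Eb w : w \in A -> nu (toR R w) - (dot l (toR R w) + k) = ratr (bq w).
  move=> wA; rewrite Hr// dot3 -/(zcoord l) lz mul0r addr0 !mxE E0 E1 Ek.
  by rewrite /bq; ring.
pose sq := (bq w1 - bq w2) / (zcoord w1 - zcoord w2)%:~R.
have zn : (zcoord w1 - zcoord w2)%:~R != 0 :> R by rewrite intr_eq0 subr_eq0.
have Es : s = ratr sq.
  have -> : ratr sq = (ratr (bq w1) - ratr (bq w2)) / (zcoord w1 - zcoord w2)%:~R :> R.
    by rewrite fmorph_div/=; congr (_ / _); ring.
  rewrite -!Eb//; apply: (mulIf zn); rewrite divfK//.
  by move: g12; rewrite /gap rmorphB; lra.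
exists l0, l1, sq, (fun w => bq w - sq * (zcoord w)%:~R); split=> // w wA.
by rewrite /gap Eb// Es; ring.
Qed.

Lemma singular_point_exists s w1 w2 : w1 \in A -> w2 \in A ->
  zcoord w1 != 0 -> zcoord w2 != 0 -> zcoord w1 != zcoord w2 ->
  gap s w1 = gap s w2 -> 0 < gap s w2 ->
  (forall w, w \in A -> zcoord w != 0 -> gap s w2 <= gap s w) ->
  possible_singular_point P c (gradient l s).
Proof.
move=> w1A w2A z1 z2 z12 g12 g2 gmin.
have [l0 [l1 [sq [q [E0 E1 Es Eq]]]]] := gap_rational w1A w2A z12 g12.
have goff w := @gap_off_circuit s w2 w g2 gmin.
have CA := circuit_sub circC; have CA' := fsubsetP CA.
have ri (x x' : rat) : ratr x = ratr x' :> R -> x = x' by move/fmorph_inj.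
have [|||||a [ao a0 a1]] := @coefficients_exist R P q w1 w2 CA w1A w2A _ z1 z2.
- by apply: contraNneq z12 => ->.
- by apply: ri; rewrite -!Eq.
- by move=> w wA wz; rewrite -(ler_rat R) -!Eq// gmin.
- by move=> w wA wC; rewrite -(ltr_rat R) -Eq// rmorph0 goff.
- by move=> w wC; apply: ri; rewrite -Eq ?CA'// gap_circuit// rmorph0.
pose y := gradient l s.
(* The sign is due to [Val] being minus the order. *)
pose p : 'rV[puiseux R]_3 := \row_j monom R (- [:: l0; l1; sq]`_j).
have p0 j : p 0 j != 0 by rewrite mxE monom_neq0.
have Vp : Val_point p = y.
  have VE j : Val_point p 0 j = ratr [:: l0; l1; sq]`_j.
    by rewrite !mxE (Val_order (has_order_monom R _)) rmorphN opprK.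
  apply: row3P; rewrite VE /= !mxE /= ?mulr0 ?addr0 ?E0 ?E1//.
  by move: lz; rewrite /zcoord => ->; rewrite add0r mulr1.
pose f w := if w \in A then a w * (mono p w)^-1 else 0.
have fa w : w \in A -> f w * mono p w = a w.
  by move=> wA; rewrite /f wA divfK// mono_neq0.
have f0 w : w \in A -> f w != 0.
  move=> wA; rewrite /f wA mulf_neq0 ?invr_eq0 ?mono_neq0//.
  exact: has_order_neq0 (ao w wA).
have Vf w : w \in A -> Val (f w) = k - nu (toR R w).
  move=> wA; have : Val (f w * mono p w) = - gap s w.
    by rewrite fa// (Val_order (ao w wA)) -Eq.
  by rewrite ValM ?f0 ?mono_neq0// Val_mono// Vp gradientE /gap; lra.
have supA : [fset w in A | f w != 0]%fset = A.
  apply/fsetP => w; rewrite !inE; case: (boolP (w \in A)) => //= wA.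
  by rewrite f0.
have sp : singular_point P f p.
  apply/(singular_pointP P f p0); split=> [|i].
    by rewrite -[RHS]a0 big_seq [RHS]big_seq; apply: eq_bigr => w /fa->.
  by rewrite -[RHS](a1 i) big_seq [RHS]big_seq; apply: eq_bigr => w /fa->.
have Sf : Sing P f.
  split; [by exists w1; exact: f0| |by exists p].
  by move=> w; rewrite /f; case: ifP => //; rewrite eqxx.
have inP w : w \in A -> P (toR R w) by move/(latticeP A0).
(* [Val (f w)] is [k - nu] even at [vC], where [- c] may exceed [nu]; replacing [- c] by its lower
   hull does not change [F_S]. *)
have tf : tropicalizes_to P c f.
  exists k => X; rewrite supA; apply/le_anti/andP; split.
    by apply: trop_le => // w wA; have := nu_F polyP A0 c X (inP w wA); rewrite Vf//; lra.
  rewrite -lerBrDr; apply: trop_le => // w wA.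
  have := trop_ge (fun w => Val (f w)) X wA; rewrite Vf//.
  by have := nu_le polyP A0 c wA; lra.
have [EA FA GA _] := circuit_A circC; have [EC FC GC CC] := circuit_mem.
have gE w : c w + dot (toR R w) y = c w + nu (toR R w) - k - gap s w.
  by rewrite gradientE /gap; lra.
have Fy : F_S P c y <= - k.
  apply: trop_le => // w wA; rewrite gE; have := nu_le polyP A0 c wA.
  have [wC|wC] := boolP (w \in circuit_C); first by rewrite gap_circuit//; lra.
  by have := goff w wA wC; lra.
(* The maximum at [y] is attained on the circuit outside [vC]; two such points show that [y] lies on
   the surface. *)
have onC w : w \in circuit_C -> w != vC -> c w + dot (toR R w) y = F_S P c y.
  move=> wC wvC; apply/le_anti; rewrite trop_ge ?CA'//=; apply: le_trans Fy _.
  by rewrite gE gap_circuit// (nu_coef polyP A0 circC) ?CA'//; lra.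
split; first by exists vE, vF; split=> //; rewrite ?circuit_distinct// onC// circuit_distinct.
by exists f, p.
Qed.

End SingularPointExists.

(** * The correspondence *)

Lemma segments_lt a b : (a, b) \in segments -> [/\ a < b, a != 0 & b != 0].
Proof. by rewrite !inE => /or4P[|||/or3P[]] /eqP[-> ->]. Qed.

Lemma segmentsP (a b : int) : a < b -> `|a| = 1 \/ `|a| = 3 -> `|b| = 1 \/ `|b| = 3 ->
  (a, b) \in segments.
Proof.
move=> ab Ha Hb.
have aE : a = -3 \/ a = -1 \/ a = 1 \/ a = 3 by lia.
have bE : b = -3 \/ b = -1 \/ b = 1 \/ b = 3 by lia.
by case: aE ab => [->|[->|[->|->]]]; case: bE => [->|[->|[->|->]]].
Qed.

Section Levels.
Variables (R : realType) (P : set 'rV[R]_3).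
Local Notation A := (lattice_points P).
Hypotheses (polyP : lattice_polytope P) (A0 : A != fset0).
Variables (c : 'rV[int]_3 -> R) (l : 'rV[R]_3) (k : R).
Local Notation height h0 := (level_height P c l k h0).

Lemma levelsP m : reflect (exists2 w, w \in A & zcoord w = m) (m \in levels P).
Proof.
apply: (iffP idP) => [/imfsetP[w /= wA ->]|[w wA <-]]; first by exists w.
by apply/imfsetP; exists w.
Qed.

Lemma pr_zE : pr_z P = @line_hull R (levels P).
Proof.
apply/seteqP; split=> z.
  move=> [x Px <-]; have [t [[t0 t1] ->]] := polytope_bary polyP A0 Px.
  exists (fun m => \sum_(w <- A | zcoord w == m) t w); split; first split.
  - by move=> m _; rewrite big_seq_cond sumr_ge0// => w /andP[/t0].
  - by rewrite -[RHS]t1 (partition_big_imfset _ (@zcoord int)).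
  - rewrite /zcoord summxE (partition_big_imfset _ (@zcoord int))/=.
    apply: eq_bigr => m _; rewrite mulr_suml; apply: eq_bigr => w /eqP <-.
    by rewrite !mxE.
move=> [t [[t0 t1] ->]].
have /choice[w Hw] : forall m, exists w, m \in levels P -> w \in A /\ zcoord w = m.
  move=> m; have [/levelsP[w wA wm]|_] := boolP (m \in levels P); last by exists 0.
  by exists w.
exists (\sum_(m <- levels P) t m *: toR R (w m)).
  by apply: polytope_comb => // m /Hw[/(latticeP A0)].
rewrite /zcoord summxE big_seq [RHS]big_seq; apply: eq_bigr => m /Hw[_ wm].
by rewrite !mxE -/(zcoord (w m)) wm.
Qed.

Lemma level_height_min h0 m : m \in levels P -> m != 0 ->
  exists w, [/\ w \in A, zcoord w = m, height h0 m = nu' P c l k (toR R w)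
    & forall w', w' \in A -> zcoord w' = m -> height h0 m <= nu' P c l k (toR R w')].
Proof.
move=> /levelsP[w0 w0A w0m] m0; pose Z := [fset w in A | zcoord w == m]%fset.
have ZP w : (w \in Z) = (w \in A) && (zcoord w == m) by rewrite !inE.
have w0Z : w0 \in Z by rewrite ZP w0A w0m eqxx.
have [w' _ Hw] := @arg_minP _ _ Z [` w0Z]%fset xpredT
  (fun w => nu' P c l k (toR R (val w))) isT.
have := valP w'; rewrite ZP => /andP[wA /eqP wm].
have wmin v : v \in A -> zcoord v = m ->
    nu' P c l k (toR R (val w')) <= nu' P c l k (toR R v).
  by move=> vA vm; have vZ : v \in Z; [rewrite ZP vA vm eqxx|exact: (Hw [` vZ]%fset)].
have hE : height h0 m = nu' P c l k (toR R (val w')).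
  rewrite /level_height (negPf m0); apply/le_anti/andP; split.
    apply: ge_inf; last by exists (val w').
    by exists (nu' P c l k (toR R (val w'))) => _ [v [vA vm] <-]; exact: wmin.
  apply: lb_le_inf => [|_ [v [vA vm] <-]]; last exact: wmin.
  by exists (nu' P c l k (toR R (val w'))), (val w').
by exists (val w'); rewrite hE; split.
Qed.

Lemma gapE s w : gap P c l k s w = nu' P c l k (toR R w) - s * (zcoord w)%:~R.
Proof. by []. Qed.

End Levels.

Section MinimalLevels.
Variables (R : realType) (P : set 'rV[R]_3).
Local Notation A := (lattice_points P).
Hypotheses (polyP : lattice_polytope P) (A0 : A != fset0).
Variables (c : 'rV[int]_3 -> R) (l : 'rV[R]_3) (k s : R).
Hypothesis circC : is_the_circuit P c circuit_C.
Hypothesis Hl : forall x, lattice_hull circuit_C x -> nu_S P c x = Lambda1 l k x.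
Local Notation gap := (gap P c l k s).

Lemma minimal_level w : w \in A -> 0 < gap w -> zcoord w != 0 ->
  (forall w', w' \in A -> zcoord w' != 0 -> gap w <= gap w') ->
  `|zcoord w| = 1 \/ `|zcoord w| = 3.
Proof.
move=> wA g0 wz gmin; apply: contrapT => no.
have [|| q [tE [tF [tG [tw [qz [tE0 tF0 tG0 /andP[tw0 tw1]] t1 qE]]]]]] := @level_point R w.
- by move: no wz; move: (zcoord w) => z no wz; lia.
- by move: no; move: (zcoord w) => z no; lia.
have [EA FA GA _] := circuit_A circC; have [EC FC GC _] := circuit_mem.
pose B := [fset vE; vF; vG; w]%fset.
have neq v : v \in circuit_C -> (v == w) = false.
  move=> vC; apply/eqP => vw; move: wz; rewrite -vw.
  by move: vC; rewrite circuitE => /or4P[]/eqP->; rewrite /zcoord zvecE.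
have bigB (V : nmodType) (F : 'rV[int]_3 -> V) :
    \sum_(v <- B) F v = F vE + F vF + F vG + F w.
  rewrite (perm_big [:: vE; vF; vG; w]) /=; first by rewrite !big_cons big_nil addr0 !addrA.
  apply: uniq_perm; first exact: fset_uniq.
    by rewrite /= !inE !circuit_distinct !neq.
  by move=> v; rewrite !inE -!orbA.
pose t v := if v == vE then tE else if v == vF then tF else if v == vG then tG else tw.
have tV : (t vE = tE) * (t vF = tF) * (t vG = tG) * (t w = tw).
  rewrite /t !eqxx (eq_sym vF) !(eq_sym vG) !circuit_distinct.
  by rewrite !(eq_sym w) !neq.
have inP v := elimT (latticeP A0 v).
have BA v : v \in B -> v \in A.
  by rewrite !inE -!orbA => /or4P[]/eqP->.
have Pq : P (toR R q).
  have := @polytope_comb R P polyP _ B t (fun v => toR R v).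
  rewrite bigB !tV -qE; apply; last by move=> v /BA/inP.
  split; last by rewrite bigB !tV.
  by move=> v _; rewrite /t; do ![case: ifP => _ //].
have qA : q \in A by apply/latticeP.
have [X [eta [uX Eq]]] := nu_dual polyP A0 c Pq.
have gC v : v \in circuit_C -> gap v = 0 by exact: gap_circuit.
have dq Y : dot (toR R q) Y = tE * dot (toR R vE) Y + tF * dot (toR R vF) Y
    + tG * dot (toR R vG) Y + tw * dot (toR R w) Y.
  by rewrite qE !dotDl !dotZl.
have nuq : nu_S P c (toR R q) <= tE * nu_S P c (toR R vE) + tF * nu_S P c (toR R vF)
    + tG * nu_S P c (toR R vG) + tw * nu_S P c (toR R w).
  have := ler_wpM2l tE0 (nu_ge polyP A0 uX (inP _ EA)).
  have := ler_wpM2l tF0 (nu_ge polyP A0 uX (inP _ FA)).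
  have := ler_wpM2l tG0 (nu_ge polyP A0 uX (inP _ GA)).
  have := ler_wpM2l tw0 (nu_ge polyP A0 uX (inP _ wA)).
  have e1 : eta = tE * eta + tF * eta + tG * eta + tw * eta.
    by rewrite -!mulrDl t1 mul1r.
  by rewrite Eq dq; lra.
have gE v : gap v = nu_S P c (toR R v) - k - dot (toR R v) (gradient l s).
  by rewrite gradientE gapE /nu' /Lambda1; ring.
have gq : gap q <= tw * gap w.
  have e1 : k = tE * k + tF * k + tG * k + tw * k by rewrite -!mulrDl t1 mul1r.
  have := congr1 ( *%R tE) (gC _ EC); have := congr1 ( *%R tF) (gC _ FC).
  by have := congr1 ( *%R tG) (gC _ GC); rewrite !gE dq; lra.
have := gmin q qA qz; have : tw * gap w < gap w by rewrite gtr_pMl.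
by lra.
Qed.

End MinimalLevels.

Section Correspondence.
Variables (R : realType) (P : set 'rV[R]_3).
Local Notation A := (lattice_points P).
Hypotheses (polyP : lattice_polytope P) (A0 : A != fset0).
Hypothesis genP : differences_generate P.
Variables (c : 'rV[int]_3 -> R) (l : 'rV[R]_3) (k : R).
Hypothesis circC : is_the_circuit P c circuit_C.
Hypotheses (lz : zcoord l = 0) (Hl : forall x, lattice_hull circuit_C x ->
  nu_S P c x = Lambda1 l k x).
Hypothesis trS : in_Sing_tr P c.
Local Notation height h0 := (level_height P c l k h0).
Local Notation gap := (gap P c l k).

Lemma zcoord_off_circuit w : zcoord w != 0 -> w \notin circuit_C.
Proof.
by apply: contra; rewrite circuitE => /or4P[]/eqP->; rewrite /zcoord zvecE.
Qed.

Lemma mem_levels w : w \in A -> zcoord w \in levels P.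
Proof. by move=> wA; apply/levelsP; exists w. Qed.

(** Strictness of the inequality for [nu_z] says that the edge has positive intercept [mu]. This is
    the common gap of the minimizers on the levels [a] and [b], which is what the construction
    requires. *)
Lemma slope_singular h0 s : Lambda2_slopes P c l k h0 s ->
  possible_singular_point P c (gradient l s).
Proof.
move=> [strict [a [b [seg dom slope]]]].
have [ab a0 b0] := segments_lt seg.
have abR : 0 < (b - a)%:~R :> R by rewrite ltr0z subr_gt0.
rewrite pr_zE// -[nu_z _ _ _ _ _]/(hull_height (levels P) (height h0)) in dom slope strict.
pose mu := hull_height (levels P) (height h0) a%:~R - s * a%:~R.
have [below [aL ha] [bL hb]] : [/\ line_below (levels P) (height h0) s mu,
    a \in levels P /\ height h0 a = s * a%:~R + mu
  & b \in levels P /\ height h0 b = s * b%:~R + mu].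
  apply: domain_edge => //; rewrite /mu; first by ring.
  by move: slope; lra.
have mu0 : 0 < mu by rewrite subr_gt0 strict//; have [] := level_hull (height h0) aL.
have [wa [waA waz Ea _]] := level_height_min c l k h0 aL a0.
have [wb [wbA wbz Eb _]] := level_height_min c l k h0 bL b0.
have ga : gap s wa = mu by rewrite gapE waz -Ea ha; ring.
have gb : gap s wb = mu by rewrite gapE wbz -Eb hb; ring.
apply: (singular_point_exists polyP A0 circC lz Hl trS waA wbA).
- by rewrite waz.
- by rewrite wbz.
- by rewrite waz wbz lt_eqF.
- by rewrite ga gb.
- by rewrite gb.
move=> w wA wz; rewrite gb gapE lerBrDr addrC.
have wL := mem_levels wA.
apply: le_trans (below _ wL) _.
have [_ [_ _ _]] := level_height_min c l k h0 wL wz; exact.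
Qed.

Hypothesis level_uniq : forall s w1 w2, w1 \in A -> w2 \in A -> w1 != w2 ->
  zcoord w1 != 0 -> gap s w1 = gap s w2 -> zcoord w1 <> zcoord w2.

(* The endpoints of the segments are nonzero, so the height 0 at level 0 is not used. *)
Definition slope_bound : R := \sum_(ab <- segments)
  `|height 0 ab.1 - ab.1%:~R * ((height 0 ab.2 - height 0 ab.1) / (ab.2 - ab.1)%:~R)|.

Lemma singular_slope h0 y : slope_bound < h0 -> possible_singular_point P c y ->
  exists2 s, Lambda2_slopes P c l k h0 s & gradient l s = y.
Proof.
move=> Th0 [_ [f [p [Sf tf sp yE]]]].
have [y_eq uC u0 /(_ genP)[w1 [w2 [[w1A w2A w12 w1z w2z] [u21 umin]]]]] :=
  singular_point_gap polyP A0 circC Sf tf sp lz Hl.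
rewrite yE in y_eq uC u0 u21 umin; pose s := y 0 2.
have gy : gradient l s = y by rewrite [RHS]y_eq.
have [_ _ _ CC] := circuit_mem.
have Fk : F_S P c y = - k.
  have := gap_circuit Hl s CC; rewrite gapE /nu' /Lambda1.
  have := uC _ CC; rewrite -[in dot _ _]gy gradientE; lra.
have uE w : nu_S P c (toR R w) - dot (toR R w) y + F_S P c y = gap s w.
  by rewrite Fk -[in dot _ _]gy gradientE gapE /nu' /Lambda1; ring.
rewrite !uE in u21; pose mu := gap s w1.
have mu0 : 0 < mu by rewrite /mu -uE u0// zcoord_off_circuit.
have gmin w : w \in A -> zcoord w != 0 -> mu <= gap s w.
  by move=> wA wz; have := umin w wA wz; rewrite !uE.
(* The edge runs between the extreme levels of all minimizers, which need not be those of [w1] and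
   [w2]. *)
pose E := [fset w in A | (zcoord w != 0) && (gap s w == mu)]%fset.
have EP w : (w \in E) = [&& w \in A, zcoord w != 0 & gap s w == mu] by rewrite !inE.
have w1E : w1 \in E by rewrite EP w1A w1z eqxx.
have w2E : w2 \in E by rewrite EP w2A w2z u21 eqxx.
have [wa' _ amin] := @arg_minP _ _ E [` w1E]%fset xpredT (fun w => zcoord (val w)) isT.
have [wb' _ bmax] := @arg_maxP _ _ E [` w1E]%fset xpredT (fun w => zcoord (val w)) isT.
have := valP wa'; have := valP wb'; set wa := val wa' in amin *; set wb := val wb' in bmax *.
rewrite !EP => /and3P[wbA wbz /eqP gb] /and3P[waA waz /eqP ga].
have bounds w : w \in E -> zcoord wa <= zcoord w <= zcoord wb.
  by move=> wE; apply/andP; split; [exact: (amin [` wE]%fset isT)|exact: (bmax [` wE]%fset isT)].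
have ab : zcoord wa < zcoord wb.
  have := level_uniq w1A w2A w12 w1z (esym u21).
  move: (bounds _ w1E) (bounds _ w2E).
  by move: (zcoord w1) (zcoord w2) (zcoord wa) (zcoord wb); clear; lia.
have lev w : w \in A -> zcoord w != 0 -> gap s w = mu ->
    `|zcoord w| = 1 \/ `|zcoord w| = 3.
  move=> wA wz gw; apply: (minimal_level polyP A0 circC Hl (s := s)) => //.
    by rewrite gw.
  by rewrite gw.
set a := zcoord wa in ab waz; set b := zcoord wb in ab wbz.
have seg : (a, b) \in segments.
  by apply: segmentsP => //; [exact: (lev wa waA waz ga)|exact: (lev wb wbA wbz gb)].
have [aL bL] := (mem_levels waA, mem_levels wbA).
have hmin h m : m \in levels P -> m != 0 -> s * m%:~R + mu <= height h m.
  move=> mL m0; have [w [wA wm -> _]] := level_height_min c l k h mL m0.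
  have wz : zcoord w != 0 by rewrite wm.
  by have := gmin w wA wz; rewrite gapE wm; lra.
have hE h w : w \in A -> zcoord w != 0 -> gap s w = mu ->
    height h (zcoord w) = s * (zcoord w)%:~R + mu.
  move=> wA wz gw; apply/le_anti; rewrite hmin ?mem_levels// andbT.
  have [v [_ _ _ /(_ w wA erefl)]] := level_height_min c l k h (mem_levels wA) wz.
  by move: gw; rewrite gapE; lra.
have ha h : height h a = s * a%:~R + mu := hE h _ waA waz ga.
have hb h : height h b = s * b%:~R + mu := hE h _ wbA wbz gb.
(* [mu] is the intercept of the line through the heights at [a] and [b], hence bounded by a summand
   of [slope_bound]; so the threshold does not depend on [y]. *)
have muT : mu <= slope_bound.
  have abn : b%:~R - a%:~R != 0 :> R by rewrite subr_eq0 eqr_int gt_eqF.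
  have -> : mu = height 0 a - a%:~R * ((height 0 b - height 0 a) / (b - a)%:~R).
    by rewrite ha hb; field; exact: abn.
  rewrite /slope_bound (big_rem (a, b))//= (le_trans (ler_norm _))// lerDl.
  by apply: sumr_ge0.
have below : line_below (levels P) (height h0) s mu.
  move=> m mL; have [->|m0] := eqVneq m 0; last exact: hmin.
  by rewrite mulr0 add0r /level_height eqxx ltW// (le_lt_trans muT).
exists s; rewrite // /Lambda2_slopes /= pr_zE//.
have edge := edge_height ab below aL bL (ha h0) (hb h0).
have abR : (a%:~R : R) <= b%:~R by rewrite ler_int ltW.
split.
  move=> z Hz; apply: lt_le_trans (height_ge Hz below).
  by rewrite ltrDl.
exists a, b; split=> //.
  apply: (edge_domain ab below aL bL (ha h0) (hb h0)) => m mL hm.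
  (* Level 0 is not tight because [h0] exceeds [mu]; any other tight level is the level of an
     element of [E]. *)
  have m0 : m != 0.
    apply/eqP => m0; move: hm; rewrite m0 mulr0 add0r /level_height eqxx => h0mu.
    by move: (le_lt_trans muT Th0); rewrite h0mu ltxx.
  have [w [wA wm Ew _]] := level_height_min c l k h0 mL m0.
  rewrite -wm; apply: bounds; rewrite EP wA wm m0/= gapE wm -Ew hm.
  by apply/eqP; ring.
have [|_ na] := edge a%:~R; first by rewrite lexx.
have [|_ nb] := edge b%:~R; first by rewrite lexx andbT.
by rewrite -[nu_z _ _ _ _ _]/(hull_height (levels P) (height h0)) na nb; ring.
Qed.

End Correspondence.

(** Each point of the configuration on the surface yields one edge equation for [nu_S]; equal gaps
    on a common level would add a vanishing [level_relation], against [generic_constant]. *)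
Lemma level_uniqueness (R : realType) (P : set 'rV[R]_3) (v : 'rV[rat]_3) :
  lattice_polytope P -> (0 < num_points P)%N -> generic_direction P v ->
  exists2 C : rat, 0 < C & forall M, well_spaced (num_points P) C M ->
  forall c, (forall i, (i < num_points P)%N -> surface P c (config R v M i)) ->
  is_the_circuit P c circuit_C -> forall (l : 'rV[R]_3) (k : R), zcoord l = 0 ->
  (forall x, lattice_hull circuit_C x -> nu_S P c x = Lambda1 l k x) ->
  forall s w1 w2, w1 \in lattice_points P -> w2 \in lattice_points P -> w1 != w2 ->
  zcoord w1 != 0 -> gap P c l k s w1 = gap P c l k s w2 -> zcoord w1 <> zcoord w2.
Proof.
move=> polyP N0 genv.
have A0 : lattice_points P != fset0.
  by rewrite -cardfs_gt0 (card_lattice_points N0).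
have [CA|nCA] := boolP (circuit_C `<=` lattice_points P)%fset; last first.
  exists 1 => // M _ c _ circC; case/negP: nCA.
  exact: (circuit_sub circC).
have [C C0 HC] := generic_constant N0 genv CA.
exists C => // M W c Hx circC l k lz Hl s w1 w2 w1A w2A w12 w1z g12 z12.
have inP w : w \in lattice_points P -> P (toR R w) by move/(latticeP A0).
have /choice[pq Hpq] : forall i, exists pq : 'rV[int]_3 * 'rV[int]_3,
    (i < num_points P)%N -> [/\ pq.1 \in lattice_points P, pq.2 \in lattice_points P,
      pq.1 != pq.2 & nu_S P c (toR R pq.2) - nu_S P c (toR R pq.1) = ratr (M i) *
      (dot (toR R pq.2) (map_mx ratr v) - dot (toR R pq.1) (map_mx ratr v))].
  move=> i; have [iN|_] := boolP (i < num_points P)%N; last by exists (0, 0).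
  (* Two lattice points attain [F_S] at the i-th point; there [nu_S] is squeezed between [- c] and
     its Legendre bound, so it is known exactly. *)
  have [p [q [pA qA pq Ep Eq]]] := Hx i iN.
  have on w : w \in lattice_points P -> c w + dot (toR R w) (config R v M i) =
      trop_poly (lattice_points P) c (config R v M i) ->
      nu_S P c (toR R w) = ratr (M i) * dot (toR R w) (map_mx ratr v)
         - F_S P c (config R v M i).
    have -> : config R v M i = ratr (M i) *: map_mx ratr v by rewrite /config map_mxZ.
    move=> wA; rewrite dotZr -/(F_S _ _ _) => E.
    have := nu_le polyP A0 c wA.
    by have := nu_F polyP A0 c (ratr (M i) *: map_mx ratr v) (inP w wA); rewrite dotZr; lra.
  by exists (p, q) => _; split=> //=; rewrite !on//; ring.
apply: (HC M W (fun i => (pq i).1) (fun i => (pq i).2) w1 w2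
  (fun w => nu_S P c (toR R w))) => //.
- by move=> i /Hpq[].
- exact: zcoord_off_circuit.
- by move=> i /Hpq[].
- exact: (nu_circuit_relation Hl).
have [l0 l1] := slope_circuit lz Hl.
rewrite /level_relation -l0 -l1; move: g12; rewrite /gap !dot3 -/(zcoord l) lz z12 !mxE.
by rewrite !rmorphB /=; lra.
Qed.

Theorem lemma4p1 (R : realType) (Delta : set 'rV[R]_3) (v : 'rV[rat]_3) :
  lattice_polytope Delta ->
  differences_generate Delta ->
  (0 < num_points Delta)%N ->
  nondefective Delta ->
  generic_direction Delta v ->
  exists2 C : rat, 0 < C & forall M : nat -> rat,
    well_spaced (num_points Delta) C M ->
    forall c : 'rV[int]_3 -> R,
      in_Sing_tr Delta c ->
      (forall i, (i < num_points Delta)%N -> surface Delta c (config R v M i)) ->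
      is_the_circuit Delta c circuit_C ->
      forall (l : 'rV[R]_3) (k : R),
        zcoord l = 0 ->
        (forall x, lattice_hull circuit_C x -> nu_S Delta c x = Lambda1 l k x) ->
        exists T : R, forall h0 : R, T < h0 ->
          set_bij (Lambda2_slopes Delta c l k h0)
                  (possible_singular_point Delta c)
                  (gradient l).
Proof.
move=> polyP genP N0 _ genv.
have A0 : lattice_points Delta != fset0%fset.
  by rewrite -cardfs_gt0 (card_lattice_points N0).
have [C C0 HC] := level_uniqueness polyP N0 genv.
exists C => // M W c trS Hx circC l k lz Hl.
have level_uniq := HC M W c Hx circC l k lz Hl.
exists (slope_bound Delta c l k) => h0 Th0; split.
- by move=> s; exact: slope_singular.
- by move=> s s' _ _ /addrI/rowP/(_ 2); rewrite !mxE !mulr1.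
- by move=> y Hy; have [s Hs <-] :=
    singular_slope polyP A0 genP circC lz Hl level_uniq Th0 Hy; exists s.
Qed.
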